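(* There exists $\varepsilon>0$ such that $$\mathbb E\left[\left|\frac{\#\mathcal L^{\max}_\cap(T^k)}{k}-\alpha\right|\right]=O(k^{-\varepsilon})\qquad\text{as }k\to\infty.$$
   Context: A sign-decorated binary tree is a finite planar rooted tree in which every internal vertex (node) has exactly two ordered children and carries a sign $\oplus$ or $\ominus$. A positive subtree is a subtree (induced by a set of leaves, unary vertices contracted) all of whose nodes carry $\oplus$; $\mathrm{LIS}(t)$ is the maximal number of leaves of a positive subtree; $\mathcal L^{\max}_\cap(t)$ is the set of leaves contained in all positive subtrees with $\mathrm{LIS}(t)$ leaves. Fix $p\in(0,1)$. $T$ is a critical binary Bienaymé–Galton–Watson tree with i.i.d. node signs, $\mathbb P(\oplus)=p$, and $T^k$ is $T$ conditioned on $\mathrm{LIS}(T)=k$. $\alpha=\alpha(p)$ is the unique solution in $(1/2,1)$ of $\frac{1}{4^{1/(2\alpha)}\sqrt\pi}\frac{\Gamma(1/2-1/(2\alpha))}{\Gamma(1-1/(2\alpha))}=\frac{p}{p-1}$. *)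

(* Defs.v *)
From Stdlib Require Import Reals.
From mathcomp Require Import ssreflect ssrfun ssrbool eqtype ssrnat seq.
From Coquelicot Require Import Coquelicot.

Set Implicit Arguments.
Unset Strict Implicit.
Unset Printing Implicit Defensive.

(* Sign-decorated binary trees.  [Node true l r] is an internal vertex *)
(* carrying the sign (+), [Node false l r] one carrying (-).          *)
Inductive tree : Type :=
| Leaf : tree
| Node : bool -> tree -> tree -> tree.

(* Leaves are identified by their address: the path from the root,
   [false] = go to the left child, [true] = go to the right child. *)
Fixpoint leaves (t : tree) : seq (seq bool) :=
  match t with
  | Leaf => [:: [::]]
  | Node _ l r => [seq false :: a | a <- leaves l] ++ [seq true :: a | a <- leaves r]
  end.

Fixpoint meets (t : tree) (S : pred (seq bool)) : bool :=
  match t with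
  | Leaf => S [::]
  | Node _ l r => meets l (fun a => S (false :: a)) || meets r (fun a => S (true :: a))
  end.

(* The subtree induced by a leaf set S (unary vertices contracted) has as
   internal nodes exactly the vertices of t both of whose child subtrees
   contain leaves of S.  [positive_set t S] : all those nodes carry (+). *)
Fixpoint positive_set (t : tree) (S : pred (seq bool)) : bool :=
  match t with
  | Leaf => true
  | Node s l r =>
      let Sl := fun a => S (false :: a) in
      let Sr := fun a => S (true :: a) in
      [&& (meets l Sl && meets r Sr) ==> s, positive_set l Sl & positive_set r Sr]
  end.

Fixpoint subseqs {T : Type} (s : seq T) : seq (seq T) :=
  match s with
  | [::] => [:: [::]]
  | x :: s' => let r := subseqs s' in [seq x :: y | y <- r] ++ r
  end.

Definition positive_leaf_sets (t : tree) : seq (seq (seq bool)) :=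
  [seq S <- subseqs (leaves t) | positive_set t (fun a => a \in S)].

Definition LIS (t : tree) : nat :=
  foldr (fun S m => maxn (size S) m) 0%N (positive_leaf_sets t).

Definition Lmax_cap (t : tree) : seq (seq bool) :=
  [seq x <- leaves t |
     all (fun S => x \in S) [seq S <- positive_leaf_sets t | size S == LIS t]].

(* Law of the critical binary Bienayme-Galton-Watson tree with i.i.d. *)
(* signs: every vertex has 0 or 2 children with probability 1/2, and  *)
(* every internal vertex carries (+) with probability p.              *)
Fixpoint n_internal (t : tree) : nat :=
  match t with Leaf => 0 | Node _ l r => (n_internal l + n_internal r).+1 end.
Fixpoint n_plus (t : tree) : nat :=
  match t with Leaf => 0 | Node s l r => (s : nat) + n_plus l + n_plus r end.
Fixpoint n_minus (t : tree) : nat :=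
  match t with Leaf => 0 | Node s l r => (~~ s : nat) + n_minus l + n_minus r end.

Open Scope R_scope.

(* P(T = t) : 2^{-#vertices} p^{#(+)} (1-p)^{#(-)}, #vertices = 2 #internal + 1 *)
Definition bgw_weight (p : R) (t : tree) : R :=
  (/ 2) ^ (2 * n_internal t + 1) * p ^ (n_plus t) * (1 - p) ^ (n_minus t).

Fixpoint trees_le (n : nat) : seq tree :=
  match n with
  | O => [:: Leaf]
  | S m =>
      Leaf :: flatten [seq flatten [seq [seq Node s l r
                                         | r <- trees_le m & (n_internal l + n_internal r <= m)%N]
                                   | l <- trees_le m]
                      | s <- [:: true; false]]
  end.

Definition trees_eq (n : nat) : seq tree :=
  [seq t <- trees_le n | n_internal t == n].

Definition Rsum {T : Type} (s : seq T) (f : T -> R) : R :=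
  foldr (fun x acc => f x + acc) 0 s.

Definition E_on_LIS (p : R) (k : nat) (f : tree -> R) : R :=
  Series (fun n => Rsum [seq t <- trees_eq n | LIS t == k] (fun t => bgw_weight p t * f t)).

Definition E_cond_LIS (p : R) (k : nat) (f : tree -> R) : R :=
  E_on_LIS p k f / E_on_LIS p k (fun _ => 1).

(* Euler's Gamma function on (-1, +oo) \ {0}:                          *)
(*   Gamma x = int_0^oo t^(x-1) e^(-t) dt  for x > 0,                  *)
(*   Gamma x = Gamma (x+1) / x             for -1 < x <= 0             *)
(* (analytic continuation; only arguments in (-1/2, 1/2) are used).    *)
Definition Gamma_pos (x : R) : R :=
  RInt_gen (fun t => Rpower t (x - 1) * exp (- t)) (at_right 0) (Rbar_locally p_infty).

Definition Gamma (x : R) : R :=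
  if Rlt_dec 0 x then Gamma_pos x else Gamma_pos (x + 1) / x.

Definition alpha_equation (p alpha : R) : Prop :=
  / (Rpower 4 (1 / (2 * alpha)) * sqrt PI)
    * (Gamma (1/2 - 1 / (2 * alpha)) / Gamma (1 - 1 / (2 * alpha)))
  = p / (p - 1).

(* Main.v *)
(* Let q k = P(LIS = k), G k = P(LIS >= k), and let a k, b k be the first two moments of
   c = #L^max_cap on the event LIS = k.  Splitting the tree at its root gives convolution
   recursions for q, a and b.  The one for a is solved by a k = G k / 2, so that
   E[c | LIS = k] / k = G k / (2 k q k) and everything rests on the convergence, with a polynomial
   rate, of the logarithmic slope r k = k q k / G k to 1 / (2 alpha).

   The sequences G and k q k satisfy the same linear recursion up to a small source, hence r is
   almost harmonic for a Markov chain on the integers that only jumps downwards.  The minimum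
   principle bounds r away from 0 and infinity, and a Doeblin-type barrier argument makes the
   oscillation of r on [n, oo) decay like a power of n.  The recursion for b then shows that
   b k = (alpha / 2) k G k (1 + O(k^-eps)), and Chebyshev's inequality concludes.

   To identify the limit of r, the recursion for G is rewritten as
   p * sum_(1 <= i < k) (G i - G k) q (k - i) = G k ^ 2, whose left-hand side divided by G k ^ 2
   is increasing in r.  It is compared with the tails prod_(j < k) (1 - beta / j), of constant
   slope beta, for which the sum is explicit by Vandermonde's identity; Gauss' product for Gamma
   and Wallis' product turn its limit into the equation defining alpha. *)
Require Import Defs.
From Stdlib Require Import Reals Lra Lia Factorial.
From mathcomp Require Import ssreflect ssrfun ssrbool eqtype ssrnat seq.
From Coquelicot Require Import Coquelicot.
From mathcomp Require Import zify.
Open Scope R_scope.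

(** * Finite sums *)

(** Trees enter only through the verification of the record [lis_tail] and the recursions for the
    moments; all estimates on the slope use that record alone. The obstacle is memory: from a large
    [k] the chain may jump at once to a small index, where the oscillation is not yet under control.
    The remedy is that [G] sums to at most a constant times [k * G k], so that the weight of the
    indices up to [m] is at most of order [A^(-e)] times the weight at scale [A * m]. The scale
    ratio [A] is taken so large that this memory costs less than the contraction gains, and the
    exponents are limited by [/ (8 * sum_const)]. Identifying the limit only requires refuting a
    strict inequality, because convergence is known beforehand: such an inequality yields a factor
    [lam > 1] valid for all large indices, which survives in the limit of the comparison. *)

Lemma INR_addn m n : INR (m + n)%nat = INR m + INR n.
Proof. exact: plus_INR. Qed.

Lemma INR_muln m n : INR (m * n)%nat = INR m * INR n.
Proof. exact: mult_INR. Qed.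

Lemma INR_subn m n : (n <= m)%nat -> INR (m - n)%nat = INR m - INR n.
Proof. by move=> h; apply: minus_INR; lia. Qed.

Lemma INR_leq m n : (m <= n)%nat -> INR m <= INR n.
Proof. by move=> h; apply: le_INR; lia. Qed.

Lemma INR_ge1 n : (1 <= n)%nat -> 1 <= INR n.
Proof. by move=> h; apply: (INR_leq 1 n). Qed.

Lemma INR_gt0 n : (1 <= n)%nat -> 0 < INR n.
Proof. by move=> h; have := INR_ge1 n h; lra. Qed.

Section RsumTheory.
Context {T : Type}.
Implicit Types (s : seq T) (f g : T -> R).

Lemma Rsum_cat s1 s2 f : Rsum (s1 ++ s2) f = Rsum s1 f + Rsum s2 f.
Proof. elim: s1 => [|x s IH] /=; [lra | rewrite IH; lra]. Qed.

Lemma Rsum_map {U : Type} (h : U -> T) (s : seq U) f : Rsum (map h s) f = Rsum s (fun x => f (h x)).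
Proof. by elim: s => [//|x s /= ->]. Qed.

Lemma Rsum_flatten (ss : seq (seq T)) f : Rsum (flatten ss) f = Rsum ss (fun s => Rsum s f).
Proof. by elim: ss => [//|s ss IH] /=; rewrite Rsum_cat IH. Qed.

Lemma Rsum_filter (P : pred T) s f :
  Rsum [seq x <- s | P x] f = Rsum s (fun x => if P x then f x else 0).
Proof. elim: s => [//|x s IH] /=; case: (P x) => /=; rewrite IH; lra. Qed.

Lemma Rsum_ext s f g : (forall x, f x = g x) -> Rsum s f = Rsum s g.
Proof. by move=> h; elim: s => [//|x s /= ->]; rewrite h. Qed.

Lemma Rsum_plus s f g : Rsum s (fun x => f x + g x) = Rsum s f + Rsum s g.
Proof. elim: s => [|x s IH] /=; [lra | rewrite IH; lra]. Qed.

Lemma Rsum_scal c s f : Rsum s (fun x => c * f x) = c * Rsum s f.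
Proof. elim: s => [|x s IH] /=; [lra | rewrite IH; lra]. Qed.

Lemma Rsum_0 s : Rsum s (fun=> 0) = 0.
Proof. elim: s => [|x s IH] /=; lra. Qed.

Lemma Rsum_le s f g : (forall x, f x <= g x) -> Rsum s f <= Rsum s g.
Proof. move=> h; elim: s => [|x s IH] /=; [lra | have := h x; lra]. Qed.

Lemma Rsum_pos s f : (forall x, 0 <= f x) -> 0 <= Rsum s f.
Proof. by move=> h; rewrite -(Rsum_0 s); apply: Rsum_le. Qed.

Lemma Rabs_Rsum_le s f : Rabs (Rsum s f) <= Rsum s (fun x => Rabs (f x)).
Proof.
elim: s => [|x s IH] /=; first by rewrite Rabs_R0; lra.
by have := Rabs_triang (f x) (Rsum s f); lra.
Qed.

End RsumTheory.

Lemma Rsum_exchange {T U : Type} (s : seq T) (u : seq U) (f : T -> U -> R) :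
  Rsum s (fun x => Rsum u (f x)) = Rsum u (fun y => Rsum s (f^~ y)).
Proof.
elim: s => [|x s IH] /=; first by rewrite Rsum_0.
by rewrite IH -Rsum_plus.
Qed.

Definition nsum (a b : nat) (F : nat -> R) : R := Rsum (seq.iota a (b - a)) F.

Lemma nsum_geq a b F : (b <= a)%nat -> nsum a b F = 0.
Proof. by move=> h; rewrite /nsum (_ : b - a = 0)%nat //; lia. Qed.

Lemma nsum_recr a b F : (a <= b)%nat -> nsum a b.+1 F = nsum a b F + F b.
Proof.
move=> h; rewrite /nsum subSn // -addn1 iotaD Rsum_cat /=.
by rewrite subnKC // Rplus_0_r.
Qed.

Lemma nsum_recl a b F : (a < b)%nat -> nsum a b F = F a + nsum a.+1 b F.
Proof. by move=> h; rewrite /nsum (_ : b - a = (b - a.+1).+1)%nat //; lia. Qed.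

Lemma nsum_split a b c F : (a <= b <= c)%nat -> nsum a c F = nsum a b F + nsum b c F.
Proof.
move=> h; rewrite /nsum (_ : c - a = (b - a) + (c - b))%nat; last by lia.
by rewrite iotaD Rsum_cat subnKC //; lia.
Qed.

Lemma nsum_ext a b F H : (forall i, (a <= i < b)%nat -> F i = H i) -> nsum a b F = nsum a b H.
Proof.
move=> h; case: (leqP a b) => hab; last by rewrite !nsum_geq //; lia.
elim: b hab h => [|b IH] hab h; first by rewrite !nsum_geq.
case: (leqP a b) => hb; last by rewrite !nsum_geq.
rewrite !nsum_recr // IH //; first by rewrite h //; lia.
by move=> i hi; apply: h; lia.
Qed.

Lemma nsum_le a b F H : (forall i, (a <= i < b)%nat -> F i <= H i) -> nsum a b F <= nsum a b H.
Proof.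
move=> h; case: (leqP a b) => hab; last by rewrite !nsum_geq //; lia || lra.
elim: b hab h => [|b IH] hab h; first by rewrite !nsum_geq //; lra.
case: (leqP a b) => hb; last by rewrite !nsum_geq //; lra.
rewrite !nsum_recr //; have := h b ltac:(lia).
have := IH hb ltac:(by move=> i hi; apply: h; lia); lra.
Qed.

Lemma nsum_plus a b F H : nsum a b (fun i => F i + H i) = nsum a b F + nsum a b H.
Proof. exact: Rsum_plus. Qed.

Lemma nsum_scal a b c F : nsum a b (fun i => c * F i) = c * nsum a b F.
Proof. exact: Rsum_scal. Qed.

Lemma nsum_0 a b : nsum a b (fun=> 0) = 0.
Proof. exact: Rsum_0. Qed.

Lemma nsum_minus a b F H : nsum a b (fun i => F i - H i) = nsum a b F - nsum a b H.
Proof.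
rewrite (nsum_ext _ _ _ (fun i => F i + (-1) * H i)); last by move=> i _; lra.
by rewrite nsum_plus nsum_scal; lra.
Qed.

Lemma nsum_pos a b F : (forall i, (a <= i < b)%nat -> 0 <= F i) -> 0 <= nsum a b F.
Proof. by move=> h; rewrite -(nsum_0 a b); apply: nsum_le. Qed.

Lemma nsum_const a b c : nsum a b (fun=> c) = INR (b - a) * c.
Proof.
rewrite /nsum; move: (b - a)%nat => n; elim: n a => [|n IH] a; first by rewrite /=; lra.
rewrite -[seq.iota _ _]/(a :: seq.iota a.+1 n) -[Rsum _ _]/(c + Rsum _ _) IH S_INR; lra.
Qed.

Lemma nsum_widen a b c d F : (c <= a)%nat -> (b <= d)%nat ->
  (forall i, (c <= i < d)%nat -> 0 <= F i) -> nsum a b F <= nsum c d F.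
Proof.
move=> hc hd hF; case: (leqP a b) => hab; last first.
  by rewrite (@nsum_geq a b); [apply: nsum_pos | lia].
rewrite (@nsum_split c a d) ?(@nsum_split a b d); try lia.
have := @nsum_pos c a F ltac:(by move=> i hi; apply: hF; lia).
have := @nsum_pos b d F ltac:(by move=> i hi; apply: hF; lia); lra.
Qed.

Lemma nsum_shift a b F : nsum a.+1 b.+1 F = nsum a b (fun i => F i.+1).
Proof. by rewrite /nsum subSS (iotaDl 1 a) Rsum_map. Qed.

Lemma nsum_rev k F : nsum 1 k F = nsum 1 k (fun i => F (k - i)%nat).
Proof.
elim: k F => [//|k IH] F; case: (posnP k) => [->//|hk].
rewrite nsum_recr // [in RHS]nsum_recl // nsum_shift IH.
rewrite (_ : k.+1 - 1 = k)%nat; last by lia.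
rewrite (nsum_ext _ _ _ (fun i => F (k.+1 - i.+1)%nat)); last by move=> i hi; congr F; lia.
lra.
Qed.

Lemma nsum_conv k (F H : nat -> R) :
  nsum 1 k (fun i => F i * H (k - i)%nat) = nsum 1 k (fun i => H i * F (k - i)%nat).
Proof.
rewrite nsum_rev; apply: nsum_ext => i hi.
by rewrite (_ : k - (k - i) = i)%nat; [lra | lia].
Qed.

(** * Tails of the LIS: convolution equations and a priori bounds *)

Lemma exp_le_1p2x x : 0 <= x <= /2 -> exp x <= 1 + 2 * x.
Proof.
move=> hx; have h := exp_ineq1_le (- x).
rewrite exp_Ropp in h; have he := exp_pos x.
have : (1 - x) * exp x <= 1.
  apply: (Rmult_le_reg_r (/ exp x)); first by apply: Rinv_0_lt_compat.
  by rewrite Rmult_assoc Rinv_r; lra.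
nra.
Qed.

Lemma Rpower_pos x y : 0 < Rpower x y.
Proof. exact: exp_pos. Qed.

Lemma Rpower_neg_le x y e : 0 < x <= y -> 0 <= e -> Rpower y (- e) <= Rpower x (- e).
Proof.
move=> hx he; rewrite !Rpower_Ropp.
by apply: Rinv_le_contravar; [apply: Rpower_pos | apply: Rle_Rpower_l; lra].
Qed.

Lemma ln_le_sub1 x : 0 < x -> ln x <= x - 1.
Proof. by move=> hx; have := exp_ineq1_le (ln x); rewrite exp_ln //; lra. Qed.

(** Discrete derivative of [x^(-e)]: [ln (x / (x - 1)) <= 1 / (x - 1) <= 2 / x], and
    [exp y <= 1 + 2 * y] for small [y]. *)
Lemma Rpower_pred_le x e : 2 <= x -> 0 <= e <= /2 ->
  Rpower (x - 1) (- e) <= (1 + 4 * e / x) * Rpower x (- e).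
Proof.
move=> hx he.
have hl : ln x - ln (x - 1) <= 2 / x.
  rewrite -ln_div; try lra.
  apply: (Rle_trans _ _ _ (ln_le_sub1 _ _)); first by apply: Rdiv_lt_0_compat; lra.
  apply: (Rmult_le_reg_r (x * (x - 1))); first by nra.
  field_simplify; nra.
have hx0 : 0 <= 2 / x <= 1.
  split; first by apply: Rlt_le; apply: Rdiv_lt_0_compat; lra.
  by apply: (Rmult_le_reg_r x); [lra | field_simplify; lra].
rewrite /Rpower.
apply: (Rle_trans _ (exp (e * (2 / x) + - e * ln x))).
  by case: (Req_dec (- e * ln (x - 1)) (e * (2 / x) + - e * ln x)) => [->|h]; [lra|];
     apply/Rlt_le/exp_increasing; nra.
rewrite exp_plus; apply: Rmult_le_compat_r; first by apply/Rlt_le/exp_pos.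
have := exp_le_1p2x (e * (2 / x)) ltac:(nra); rewrite /Rdiv; lra.
Qed.

Definition mass (G : nat -> R) (k : nat) : R := G k - G k.+1.

(* G k plays the role of P(LIS >= k) and mass G k that of P(LIS = k). *)
Record lis_tail (p : R) (G : nat -> R) : Prop := LisTail {
  lt_one : G 1%nat = 1;
  lt_pos : forall k, 0 < G k;
  lt_mass : forall k, (1 <= k)%nat -> 0 < mass G k;
  lt_tail_conv : forall k, (2 <= k)%nat ->
    p * nsum 1 k (fun i => G i * mass G (k - i)) = G k * (p + (1 - p) * G k);
  lt_mass_conv : forall k, (2 <= k)%nat ->
    p / 2 * nsum 1 k (fun i => mass G i * mass G (k - i))
      = mass G k * (p + (1 - p) * (G k - mass G k / 2)) }.

Section LisTailTheory.
Context (p : R) (G : nat -> R) (hp : 0 < p < 1) (hG : lis_tail p G).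
Local Notation q := (mass G).

Let Gpos := lt_pos _ _ hG.
Let qpos := lt_mass _ _ hG.

(* Discrete version of - d log G / d log k; it converges to the index of regular variation of G. *)
Definition log_slope k := INR k * q k / G k.
Local Notation r := log_slope.

Lemma tail_succ k : G k.+1 = G k - q k.
Proof. rewrite /mass; lra. Qed.

Lemma tail_anti i j : (1 <= i <= j)%nat -> G j <= G i.
Proof.
elim: j => [|j IH] h; first by lia.
case: (eqVneq i j.+1) => [->|hn]; first by lra.
have := IH ltac:(lia); have := qpos j ltac:(lia); rewrite (tail_succ j); lra.
Qed.

Lemma tail_le1 k : (1 <= k)%nat -> G k <= 1.
Proof. by move=> h; rewrite -(lt_one _ _ hG); apply: tail_anti; lia. Qed.

Lemma mass_le_tail k : q k <= G k.
Proof. have := Gpos k.+1; rewrite /mass; lra. Qed.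

Lemma sum_mass k : (1 <= k)%nat -> nsum 1 k q = 1 - G k.
Proof.
elim: k => [//|k IH] _; case: (posnP k) => [->|h].
  by rewrite nsum_geq // (lt_one _ _ hG); lra.
by rewrite nsum_recr // IH // /mass; lra.
Qed.

Lemma sum_mass_rev k : (1 <= k)%nat -> nsum 1 k (fun i => q (k - i)%nat) = 1 - G k.
Proof. by move=> h; rewrite -(nsum_rev k q) sum_mass. Qed.

(** Symmetrise under [i -> k - i] and use [k = i + (k - i)]. *)
Lemma conv_weighted k (f : nat -> R) :
  INR k * nsum 1 k (fun i => f i * f (k - i)%nat)
  = 2 * nsum 1 k (fun i => INR i * f i * f (k - i)%nat).
Proof.
rewrite -!nsum_scal.
have -> : nsum 1 k (fun i => 2 * (INR i * f i * f (k - i)%nat)) =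
  nsum 1 k (fun i => INR i * f i * f (k - i)%nat + INR i * f i * f (k - i)%nat).
  by apply: nsum_ext => i _; lra.
rewrite nsum_plus {2}(nsum_conv k (fun i => INR i * f i)) -nsum_plus.
apply: nsum_ext => i hi; rewrite INR_subn; [ring | lia].
Qed.

(** This gives [k * q k] the kernel [q (k - i)] of [lt_tail_conv]; the two recursions differ only by
    [q k / 2] in the last factor, which is the source term of the slope. *)
Lemma weighted_mass_conv k : (2 <= k)%nat ->
  p * nsum 1 k (fun i => INR i * q i * q (k - i)%nat)
  = INR k * q k * (p + (1 - p) * (G k - q k / 2)).
Proof.
move=> hk; have := lt_mass_conv _ _ hG k hk; have := conv_weighted k q => h1 h2.
rewrite Rmult_assoc -h2.
have -> : INR k * (p / 2 * nsum 1 k (fun i => q i * q (k - i)%nat)) =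
  p / 2 * (INR k * nsum 1 k (fun i => q i * q (k - i)%nat)) by ring.
rewrite h1; lra.
Qed.

(** Minimum principle: the term [- q k / 2] in [weighted_mass_conv] has the favourable sign, so the
    slope never drops below its value [q 1] at 1. *)
Lemma mass_lower k : (1 <= k)%nat -> q 1%nat * G k <= INR k * q k.
Proof.
elim/ltn_ind: k => k IH hk; case: (eqVneq k 1%nat) => [->|hk1].
  by rewrite (lt_one _ _ hG) /=; lra.
have h2 : (2 <= k)%nat by lia.
have hw := weighted_mass_conv k h2; have ht := lt_tail_conv _ _ hG k h2.
have : q 1%nat * nsum 1 k (fun i => G i * q (k - i)%nat)
        <= nsum 1 k (fun i => INR i * q i * q (k - i)%nat).
  rewrite -nsum_scal; apply: nsum_le => i hi.
  rewrite -Rmult_assoc; apply: Rmult_le_compat_r; last by apply: IH; lia.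
  by apply/Rlt_le/qpos; lia.
have hq := qpos k ltac:(lia); have hg := Gpos k; have hk0 := INR_ge1 k ltac:(lia).
move=> hs; apply: (Rmult_le_reg_r (p + (1 - p) * G k)); first by nra.
have : p * (q 1%nat * nsum 1 k (fun i => G i * q (k - i)%nat))
        <= p * nsum 1 k (fun i => INR i * q i * q (k - i)%nat).
  by apply: Rmult_le_compat_l; lra.
rewrite hw.
have -> : p * (q 1%nat * nsum 1 k (fun i => G i * q (k - i)%nat)) =
  q 1%nat * (p * nsum 1 k (fun i => G i * q (k - i)%nat)) by ring.
rewrite ht => h.
have : 0 <= INR k * q k * (1 - p) * q k by repeat apply: Rmult_le_pos; lra.
nra.
Qed.

(** The source multiplies the upper bound by at most [exp (C * q k)] at step [k], where
    [C = (1 - p) / (2 * p)]; the masses [q k] sum to at most 1. *)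
Definition slope_bound := exp ((1 - p) / (2 * p)).

(** The maximum principle fails because of the source, so the bound is allowed to grow with the mass
    [1 - G k.+1] already used up. *)
Lemma mass_upper_aux k : (1 <= k)%nat ->
  INR k * q k <= exp ((1 - p) / (2 * p) * (1 - G k.+1)) * G k.
Proof.
have hC : 0 < (1 - p) / (2 * p) by apply: Rdiv_lt_0_compat; lra.
set C := (1 - p) / (2 * p) in hC *.
elim/ltn_ind: k => k IH hk; case: (eqVneq k 1%nat) => [->|hk1].
  rewrite (lt_one _ _ hG) /=.
  have := exp_ineq1_le (C * (1 - G 2%nat)).
  have h2 := tail_le1 2 ltac:(lia).
  have : 0 <= C * (1 - G 2%nat) by apply: Rmult_le_pos; lra.
  have := mass_le_tail 1; rewrite (lt_one _ _ hG); lra.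
have h2 : (2 <= k)%nat by lia.
have hw := weighted_mass_conv k h2; have ht := lt_tail_conv _ _ hG k h2.
set X := exp (C * (1 - G k)).
have hX : 0 < X by apply: exp_pos.
have : nsum 1 k (fun i => INR i * q i * q (k - i)%nat)
       <= X * nsum 1 k (fun i => G i * q (k - i)%nat).
  rewrite -nsum_scal; apply: nsum_le => i hi.
  rewrite -Rmult_assoc; apply: Rmult_le_compat_r; first by apply/Rlt_le/qpos; lia.
  apply: Rle_trans (IH i _ _) _; try lia.
  apply: Rmult_le_compat_r; first by have := Gpos i; lra.
  have hm : C * (1 - G i.+1) <= C * (1 - G k) by have := tail_anti i.+1 k ltac:(lia); nra.
  case: hm => hm; first by apply/Rlt_le/exp_increasing.
  by rewrite /X hm; lra.
move=> hs.
have hq := qpos k ltac:(lia); have hg := Gpos k; have hk0 := INR_ge1 k ltac:(lia).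
have hqg := mass_le_tail k.
have h3 : INR k * q k * (p + (1 - p) * (G k - q k / 2)) <= X * (G k * (p + (1 - p) * G k)).
  rewrite -hw -ht; have := Rmult_le_compat_l p _ _ ltac:(lra) hs; lra.
have hD : 0 < p + (1 - p) * (G k - q k / 2) by nra.
(* Since [C * p = (1 - p) / 2], the linear term of the exponential pays exactly for the missing
   [(1 - p) * q k / 2]. *)
have h4 : p + (1 - p) * G k <= exp (C * q k) * (p + (1 - p) * (G k - q k / 2)).
  have := exp_ineq1_le (C * q k) => he.
  apply: (Rle_trans _ ((1 + C * q k) * (p + (1 - p) * (G k - q k / 2)))); last by nra.
  have hCp : C * p = (1 - p) / 2 by rewrite /C; field; lra.
  have hc1 : 0 <= C * q k * ((1 - p) * (G k - q k / 2)) by apply: Rmult_le_pos; apply: Rmult_le_pos; lra.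
  have hc2 : C * p * q k = (1 - p) / 2 * q k by rewrite hCp.
  lra.
have -> : C * (1 - G k.+1) = C * (1 - G k) + C * q k by rewrite tail_succ; ring.
rewrite exp_plus -/X.
apply: (Rmult_le_reg_r _ _ _ hD); apply: Rle_trans h3 _.
have : X * G k * (p + (1 - p) * G k) <= X * G k * (exp (C * q k) * (p + (1 - p) * (G k - q k / 2))).
  by apply: Rmult_le_compat_l; nra.
lra.
Qed.

Lemma mass_upper k : (1 <= k)%nat -> INR k * q k <= slope_bound * G k.
Proof.
move=> hk; apply: Rle_trans (mass_upper_aux k hk) _.
apply: Rmult_le_compat_r; first by have := Gpos k; lra.
have hC : 0 < (1 - p) / (2 * p) by apply: Rdiv_lt_0_compat; lra.
apply/Rlt_le/exp_increasing; have := Gpos k.+1; nra.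
Qed.

(** Subtracting [G k] times the total mass [1 - G k] from [lt_tail_conv] cancels the terms of first
    order in [G k]. *)
Lemma increment_conv k : (2 <= k)%nat ->
  p * nsum 1 k (fun i => (G i - G k) * q (k - i)%nat) = G k * G k.
Proof.
move=> hk; have ht := lt_tail_conv _ _ hG k hk.
rewrite (nsum_ext _ _ _ (fun i => G i * q (k - i)%nat - G k * q (k - i)%nat)); last by move=> i _; ring.
by rewrite nsum_minus nsum_scal Rmult_minus_distr_l ht sum_mass_rev; [ring | lia].
Qed.

(* Up to a small source, log_slope is harmonic for the Markov chain that jumps from k to i < k
   with probability proportional to G i * mass G (k - i). *)
Lemma log_slope_conv k : (2 <= k)%nat ->
  nsum 1 k (fun i => G i * q (k - i)%nat * (r k - r i)) = (1 - p) / (2 * p) * (INR k * q k * q k).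
Proof.
move=> hk; have ht := lt_tail_conv _ _ hG k hk; have hw := weighted_mass_conv k hk.
rewrite (nsum_ext _ _ _ (fun i => r k * (G i * q (k - i)%nat) - INR i * q i * q (k - i)%nat)).
  rewrite nsum_minus nsum_scal; apply: (Rmult_eq_reg_l p); last by lra.
  rewrite Rmult_minus_distr_l hw.
  have -> : p * (r k * nsum 1 k (fun i => G i * q (k - i)%nat)) =
    r k * (p * nsum 1 k (fun i => G i * q (k - i)%nat)) by ring.
  by rewrite ht /log_slope; field; have := Gpos k; lra.
move=> i _; rewrite /log_slope; field; have := Gpos i; have := Gpos k; lra.
Qed.

End LisTailTheory.

(** * Doubling and summation bounds for the tail *)

Section Regularity.
Context (p : R) (G : nat -> R) (hp : 0 < p < 1) (hG : lis_tail p G).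
Local Notation q := (mass G).
Local Notation B := (slope_bound p).

Let Gpos := lt_pos _ _ hG.
Let qpos := lt_mass _ _ hG.
Let q1pos : 0 < q 1%nat := qpos 1 erefl.
Let Bpos : 0 < B := exp_pos _.
Let anti := tail_anti p G hG.

Let Gk_pos k : (1 <= k)%nat -> 0 < G k / INR k.
Proof. by move=> h; apply: Rdiv_lt_0_compat; [exact: Gpos | exact: INR_gt0]. Qed.

(** Keep only the term [i = k] of [lt_tail_conv] at [k.+1]. *)
Lemma tail_succ_lower k : (1 <= k)%nat -> p * q 1%nat * G k <= G k.+1.
Proof.
move=> hk; have ht := lt_tail_conv _ _ hG k.+1 ltac:(lia).
have h1 := tail_le1 p G hG k.+1 erefl.
have : G k * q 1%nat <= nsum 1 k.+1 (fun i => G i * q (k.+1 - i)%nat).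
  rewrite nsum_recr // subSnn.
  have : 0 <= nsum 1 k (fun i => G i * q (k.+1 - i)%nat).
    apply: nsum_pos => i hi; apply: Rmult_le_pos; first by have := Gpos i; lra.
    by have := qpos (k.+1 - i)%nat ltac:(lia); lra.
  lra.
have hg := Gpos k.+1 => hs.
have : 0 <= G k.+1 * ((1 - p) * (1 - G k.+1)) by apply: Rmult_le_pos; nra.
have := Rmult_le_compat_l p _ _ ltac:(lra) hs; lra.
Qed.

(** One step costs a factor at most [1 + D / l <= exp (D / k)], by the upper bound on [l * q l] and
    the comparability of [G l] with [G l.+1]. *)
Lemma tail_slow_exp k l : (1 <= k <= l)%nat ->
  G k <= exp (B / (p * q 1%nat) * (INR l - INR k) / INR k) * G l.
Proof.
have hpq : 0 < p * q 1%nat by apply: Rmult_lt_0_compat; lra.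
set D := B / _; have hD : 0 < D by apply: Rdiv_lt_0_compat.
elim: l => [|l IH] h; first by lia.
case: (eqVneq k l.+1) => [->|hn].
  by rewrite Rminus_diag Rmult_0_r /Rdiv Rmult_0_l exp_0; lra.
apply: Rle_trans (IH ltac:(lia)) _.
have hk := INR_gt0 k ltac:(lia); have hl := INR_gt0 l ltac:(lia).
have hkl : INR k <= INR l by apply: INR_leq; lia.
have -> : D * (INR l.+1 - INR k) / INR k = D * (INR l - INR k) / INR k + D / INR k.
  by rewrite S_INR; field; lra.
rewrite exp_plus Rmult_assoc; apply: Rmult_le_compat_l; first by apply/Rlt_le/exp_pos.
have hs := tail_succ_lower l ltac:(lia).
have hu := mass_upper p G hp hG l ltac:(lia).
have h1 : q l <= D / INR l * G l.+1.
  apply: (Rmult_le_reg_l (INR l)) => //; apply: Rle_trans hu _.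
  have -> : INR l * (D / INR l * G l.+1) = B * (G l.+1 / (p * q 1%nat)).
    by rewrite /D; field; split; lra.
  apply: Rmult_le_compat_l; first by lra.
  apply: (Rmult_le_reg_r _ _ _ hpq).
  have -> : G l.+1 / (p * q 1%nat) * (p * q 1%nat) = G l.+1 by field; lra.
  lra.
have h2 : D / INR l <= D / INR k.
  by apply: Rmult_le_compat_l; [lra | apply: Rinv_le_contravar; lra].
have := exp_ineq1_le (D / INR k); have := tail_succ G l; have := Gpos l.+1; nra.
Qed.

Lemma tail_comparable : exists D, 1 <= D /\
  forall k l, (1 <= k)%nat -> (1 <= l <= 8 * k)%nat -> G k <= D * G l.
Proof.
set E := B / (p * q 1%nat).
have hE : 0 < E by apply: Rdiv_lt_0_compat => //; apply: Rmult_lt_0_compat; lra.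
exists (exp (E * 7)); split.
  by have := exp_ineq1_le (E * 7); lra.
move=> k l hk hl.
have h1 : 1 <= exp (E * 7) by have := exp_ineq1_le (E * 7); lra.
have gl := Gpos l.
case: (leqP k l) => h.
  apply: Rle_trans (tail_slow_exp k l ltac:(lia)) _.
  apply: Rmult_le_compat_r; first by lra.
  have hk0 := INR_gt0 k hk.
  have hl8 : INR l <= 8 * INR k by have := INR_leq l (8 * k) ltac:(lia); rewrite INR_muln /=; lra.
  have : E * (INR l - INR k) / INR k <= E * 7.
    by rewrite /Rdiv Rmult_assoc; apply: Rmult_le_compat_l; [lra|];
       apply: (Rmult_le_reg_r (INR k)) => //; rewrite Rmult_assoc Rinv_l; lra.
  by case=> [h2|->]; [apply/Rlt_le/exp_increasing | rewrite /E; lra].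
have : G k <= G l by apply: anti; lia.
nra.
Qed.

Context (D : R) (hD1 : 1 <= D)
  (hD : forall k l, (1 <= k)%nat -> (1 <= l <= 8 * k)%nat -> G k <= D * G l).

(** In [increment_conv] each [q (k - i)] is at least [q 1 * G k / k]; solving for the sum of the
    [G i] produces [/ (p * q 1)]. One unit pays for subtracting [G k] from each term, the other for
    including the end point [i = k]. *)
Definition sum_const := 2 + / (p * q 1%nat).
Local Notation C0 := sum_const.

Let pq_pos : 0 < p * q 1%nat.
Proof. by apply: Rmult_lt_0_compat; lra. Qed.

Lemma sum_const_ge2 : 2 <= C0.
Proof. by have := Rinv_0_lt_compat _ pq_pos; rewrite /sum_const; lra. Qed.

Lemma mass_ge j k : (1 <= j <= k)%nat -> q 1%nat * (G k / INR k) <= q j.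
Proof.
move=> h; have hl := mass_lower p G hp hG j ltac:(lia).
have hj := INR_gt0 j ltac:(lia); have hjk := INR_leq j k ltac:(lia).
have hg := anti j k ltac:(lia).
apply: (Rle_trans _ (q 1%nat * (G j / INR j))); last first.
  apply: (Rmult_le_reg_l _ _ _ hj).
  by have -> : INR j * (q 1%nat * (G j / INR j)) = q 1%nat * G j by field; lra.
apply: Rmult_le_compat_l; first by lra.
apply: Rmult_le_compat => //; try by have := Gpos k; lra.
  by apply/Rlt_le/Rinv_0_lt_compat; lra.
by apply: Rinv_le_contravar.
Qed.

Lemma mass_le j k : (1 <= k)%nat -> (k <= 2 * j)%nat -> (j <= k)%nat -> q j <= 2 * B * D * (G k / INR k).
Proof.
move=> h1 h2 h3; have hu := mass_upper p G hp hG j ltac:(lia).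
have hj := INR_gt0 j ltac:(lia); have hk := INR_gt0 k h1.
have hkj : INR k <= 2 * INR j by have := INR_leq k (2 * j) ltac:(lia); rewrite INR_muln /=; lra.
have hg := hD j k ltac:(lia) ltac:(lia).
apply: (Rmult_le_reg_l _ _ _ hj); apply: Rle_trans hu _.
apply: (Rle_trans _ (B * (D * G k))); first by apply: Rmult_le_compat_l; lra.
have -> : INR j * (2 * B * D * (G k / INR k)) = B * D * G k * (2 * INR j / INR k) by field; lra.
have : 1 <= 2 * INR j / INR k.
  by apply: (Rmult_le_reg_r _ _ _ hk); rewrite /Rdiv Rmult_assoc Rinv_l; lra.
have : 0 < B * D * G k by repeat apply: Rmult_lt_0_compat; have := Gpos k; lra.
nra.
Qed.

Lemma sum_tail_lt k : (1 <= k)%nat -> nsum 1 k G <= (C0 - 1) * (INR k * G k).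
Proof.
move=> hk; have hg := Gpos k; have hk0 := INR_gt0 k hk.
have hC := sum_const_ge2.
case: (eqVneq k 1%nat) => [->|h1].
  by rewrite nsum_geq //=; have := Gpos 1; nra.
have he := increment_conv p G hG k ltac:(lia).
have hq : q 1%nat * (G k / INR k) * (nsum 1 k G - INR (k - 1) * G k)
          <= nsum 1 k (fun i => (G i - G k) * q (k - i)%nat).
  rewrite -(nsum_const 1 k) -nsum_minus -nsum_scal; apply: nsum_le => i hi.
  rewrite Rmult_comm; apply: Rmult_le_compat_l; first by have := anti i k ltac:(lia); lra.
  by apply: mass_ge; lia.
have hk1 : INR (k - 1) <= INR k by apply: INR_leq; lia.
have h2 : nsum 1 k G - INR (k - 1) * G k <= INR k * G k / (p * q 1%nat).
  apply: (Rmult_le_reg_l (p * q 1%nat * (G k / INR k))).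
    by apply: Rmult_lt_0_compat => //; apply: Gk_pos.
  have -> : p * q 1%nat * (G k / INR k) * (INR k * G k / (p * q 1%nat)) = G k * G k.
    by field; lra.
  rewrite -he; have := Rmult_le_compat_l p _ _ ltac:(lra) hq; lra.
have -> : (C0 - 1) * (INR k * G k) = INR k * G k + INR k * G k / (p * q 1%nat).
  by rewrite /sum_const; field; lra.
nra.
Qed.

Lemma sum_tail_le k : (1 <= k)%nat -> nsum 1 k.+1 G <= C0 * (INR k * G k).
Proof.
move=> hk; rewrite nsum_recr //; have := sum_tail_lt k hk.
have := Gpos k; have := INR_ge1 k hk; nra.
Qed.

(** Induction on [x]: passing from [x] to [x.+1] replaces [x^(-e)] by a power larger by a relative
    [4 * e / x.+1]. The factor 2 leaves one spare copy of the new term, which absorbs this loss by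
    [sum_tail_lt] as soon as [8 * e * C0 <= 1]. *)
Lemma sum_tail_power e x : 0 <= e <= / (8 * C0) -> (1 <= x)%nat ->
  nsum 1 x.+1 (fun i => G i * Rpower (INR i) (- e))
  <= 2 * Rpower (INR x) (- e) * nsum 1 x.+1 G.
Proof.
move=> he; have hC := sum_const_ge2.
have heC : e * C0 <= / 8.
  have := Rmult_le_compat_r C0 _ _ ltac:(lra) (proj2 he).
  by have -> : / (8 * C0) * C0 = / 8 by field; lra.
have he2 : e <= / 2 by nra.
elim: x => [//|x IH] _; case: (posnP x) => [->|hx].
  rewrite !(nsum_recr 1 1) // !nsum_geq //.
  by have := Gpos 1; have := Rpower_pos (INR 1) (- e); nra.
rewrite nsum_recr // [nsum 1 x.+2 G]nsum_recr //.
apply: Rle_trans (Rplus_le_compat_r _ _ _ (IH hx)) _.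
have hx1 := INR_ge1 x hx.
have hp1 := Rpower_pred_le (INR x.+1) e ltac:(rewrite S_INR; lra) ltac:(lra).
rewrite {1}S_INR (_ : INR x + 1 - 1 = INR x) in hp1; last by lra.
have hs := sum_tail_lt x.+1 erefl.
have hP := Rpower_pos (INR x.+1) (- e).
set P := Rpower (INR x.+1) (- e) in hp1 hP *.
set U := nsum 1 x.+1 G in hs *.
have hU : 0 <= U by apply: nsum_pos => i _; have := Gpos i; lra.
have hg := Gpos x.+1.
have h8 : 8 * e / INR x.+1 * U <= G x.+1.
  apply: (Rle_trans _ (8 * e / INR x.+1 * ((C0 - 1) * (INR x.+1 * G x.+1)))).
    apply: Rmult_le_compat_l => //; apply: Rmult_le_pos; first by lra.
    by apply/Rlt_le/Rinv_0_lt_compat/INR_gt0.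
  have -> : 8 * e / INR x.+1 * ((C0 - 1) * (INR x.+1 * G x.+1)) = (8 * (e * C0) - 8 * e) * G x.+1.
    by field; have := INR_gt0 x.+1 erefl; lra.
  by nra.
apply: (Rle_trans _ (2 * ((1 + 4 * e / INR x.+1) * P) * U + G x.+1 * P)).
  by apply: Rplus_le_compat_r; apply: Rmult_le_compat_r => //; lra.
have := Rmult_le_compat_r P _ _ (Rlt_le _ _ hP) h8; lra.
Qed.

(** On [i <= m] the weight [i^(-e)] is at least [m^(-e)], so [sum_tail_power] at [A * m] bounds the
    shorter sum. Partial sums of [G] thus grow polynomially. *)
Lemma sum_tail_scale e m A : 0 <= e <= / (8 * C0) -> (1 <= m)%nat -> (1 <= A)%nat ->
  nsum 1 m.+1 G <= 2 * Rpower (INR A) (- e) * nsum 1 (A * m).+1 G.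
Proof.
move=> he hm hA; have hAm : (m <= A * m)%nat by rewrite leq_pmull.
have hx := sum_tail_power e (A * m) he ltac:(lia).
have hm0 := INR_gt0 m hm; have hA0 := INR_gt0 A hA.
have hPm := Rpower_pos (INR m) (- e).
apply: (Rmult_le_reg_l _ _ _ hPm).
have -> : Rpower (INR m) (- e) * (2 * Rpower (INR A) (- e) * nsum 1 (A * m).+1 G)
   = 2 * Rpower (INR (A * m)) (- e) * nsum 1 (A * m).+1 G.
  by rewrite INR_muln -Rpower_mult_distr //; ring.
apply: Rle_trans hx; rewrite -nsum_scal.
apply: (Rle_trans _ (nsum 1 m.+1 (fun i => G i * Rpower (INR i) (- e)))).
  apply: nsum_le => i hi; rewrite Rmult_comm; apply: Rmult_le_compat_l; first by have := Gpos i; lra.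
  by apply: Rpower_neg_le; [split; [apply: INR_gt0; lia | apply: INR_leq; lia] | lra].
apply: nsum_widen; try lia.
by move=> i _; apply: Rmult_le_pos; [have := Gpos i; lra | have := Rpower_pos (INR i) (- e); lra].
Qed.

(** One of [i] and [k - i] is at least [k / 2], and there [G] is at most [D * G k]. *)
Lemma tail_conv_le k : (2 <= k)%nat ->
  nsum 1 k (fun i => G i * G (k - i)%nat) <= 2 * D * C0 * (INR k * G k * G k).
Proof.
move=> hk; have hs := sum_tail_lt k ltac:(lia); have hC := sum_const_ge2.
have hg := Gpos k; have hk0 := INR_gt0 k ltac:(lia).
apply: (Rle_trans _ (nsum 1 k (fun i => D * G k * (G i + G (k - i)%nat)))).
  apply: nsum_le => i hi; have h1 := Gpos i; have h2 := Gpos (k - i)%nat.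
  have hDk : 0 < D * G k by nra.
  case: (leqP k (2 * i)) => h.
    have := hD i k ltac:(lia) ltac:(lia); nra.
  have := hD (k - i)%nat k ltac:(lia) ltac:(lia); nra.
rewrite nsum_scal nsum_plus -nsum_rev.
have hDk : 0 < D * G k by nra.
have h1 := Rmult_le_compat_l _ _ _ (Rlt_le _ _ hDk) hs.
have : 0 < D * G k * (INR k * G k) by apply: Rmult_lt_0_compat; nra.
lra.
Qed.

End Regularity.

(** * Lower barrier and oscillation of the logarithmic slope *)

(** Piecewise linear cut-off: 0 up to [2 * H], 1 from [4 * H] on. It gives the barrier its shape. *)
Definition ramp (H k : nat) : R := Rmin 1 (Rmax 0 ((INR k - 2 * INR H) / (2 * INR H))).

Section Ramp.
Context (H : nat) (hH : (1 <= H)%nat).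
Let h0 : 0 < INR H. Proof. by have := INR_ge1 H hH; lra. Qed.

Lemma ramp_bounds k : 0 <= ramp H k <= 1.
Proof. by rewrite /ramp; split; [apply: Rmin_glb; [lra | apply: Rmax_l] | apply: Rmin_l]. Qed.

Lemma ramp_0 k : (k <= 2 * H)%nat -> ramp H k = 0.
Proof.
move=> hk; have := INR_leq k (2 * H) hk; rewrite INR_muln /= => h.
rewrite /ramp Rmax_left ?Rmin_right //; try lra.
by apply: (Rmult_le_reg_r (2 * INR H)); [lra | rewrite /Rdiv Rmult_assoc Rinv_l; lra].
Qed.

Lemma ramp_1 k : (4 * H <= k)%nat -> ramp H k = 1.
Proof.
move=> hk; have := INR_leq (4 * H) k hk; rewrite INR_muln /= => h.
rewrite /ramp Rmin_left // ; apply: Rle_trans (Rmax_r _ _).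
by apply: (Rmult_le_reg_r (2 * INR H)); [lra | rewrite /Rdiv Rmult_assoc Rinv_l; lra].
Qed.

Lemma ramp_lipschitz i k : (i <= k)%nat -> ramp H k - ramp H i <= INR (k - i) / (2 * INR H).
Proof.
move=> hik; rewrite INR_subn //; have := INR_leq i k hik => h.
have hinv : 0 < / (2 * INR H) by apply: Rinv_0_lt_compat; lra.
rewrite /ramp; set x := (INR k - _) / _; set y := (INR i - _) / _.
have -> : (INR k - INR i) / (2 * INR H) = x - y by rewrite /x /y; field; lra.
have : y <= x by rewrite /x /y; apply: Rmult_le_compat_r; lra.
rewrite /Rmin /Rmax; case: (Rle_dec 0 x) => ?; case: (Rle_dec 0 y) => ?;
  by repeat case: Rle_dec => ?; lra.
Qed.
End Ramp.

Section Barrier.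
Context (p : R) (G : nat -> R) (hp : 0 < p < 1) (hG : lis_tail p G).
Local Notation q := (mass G).
Local Notation B := (slope_bound p).
Context (D : R) (hD1 : 1 <= D)
  (hD : forall k l, (1 <= k)%nat -> (1 <= l <= 8 * k)%nat -> G k <= D * G l).
Local Notation C0 := (sum_const p G).

Let Gpos := lt_pos _ _ hG.
Let qpos := lt_mass _ _ hG.
Let q1pos : 0 < q 1%nat := qpos 1 erefl.
Let Bpos : 0 < B := exp_pos _.
Let anti := tail_anti p G hG.
Let C0ge : 2 <= C0 := sum_const_ge2 p G hp hG.

Let Gk_pos k : (1 <= k)%nat -> 0 < G k / INR k.
Proof. by move=> h; apply: Rdiv_lt_0_compat; [exact: Gpos | exact: INR_gt0]. Qed.

Let Gq_pos i k : (1 <= i < k)%nat -> 0 < G i * q (k - i)%nat.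
Proof. by move=> h; apply: Rmult_lt_0_compat; [exact: Gpos | apply: qpos; lia]. Qed.

(** The 64 is the square of the 8 in [k <= 8 * H]; the regime [k > 8 * H] would give 8. *)
Definition ramp_const := 64 * B * D * C0.

(** For [k <= 8 * H] the Lipschitz bound produces [(k - i) * q (k - i)], which is at most
    [B * G (k - i)]. For larger [k] only [i < 4 * H] contributes, and then [k - i >= k / 2] makes
    [q (k - i)] of order [G k / k]. The bound has the order of the weight of a jump from [k] into
    [[H, 2H)], hence can be beaten by the gain made there. *)
Lemma ramp_conv_le H k : (1 <= H)%nat -> (2 * H <= k)%nat ->
  nsum 1 k (fun i => G i * q (k - i)%nat * (ramp H k - ramp H i))
  <= ramp_const * (G k / INR k * (INR H * G H)).
Proof.
move=> hH hk.
have hH0 := INR_gt0 H hH; have hk0 := INR_gt0 k ltac:(lia).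
have hg := Gpos k; have gH := Gpos H; have hgH : G k <= G H by apply: anti; lia.
have hBD : 0 < B * D * C0 by repeat apply: Rmult_lt_0_compat; lra.
case: (leqP k (8 * H)) => h8.
  apply: (Rle_trans _ (nsum 1 k (fun i => B / (2 * INR H) * (G i * G (k - i)%nat)))).
    apply: nsum_le => i hi.
    have hl := ramp_lipschitz H hH i k ltac:(lia).
    have hu := mass_upper p G hp hG (k - i)%nat ltac:(lia).
    apply: (Rle_trans _ (G i * q (k - i)%nat * (INR (k - i) / (2 * INR H)))).
      by apply: Rmult_le_compat_l hl; apply/Rlt_le/Gq_pos; lia.
    have -> : G i * q (k - i)%nat * (INR (k - i) / (2 * INR H)) =
      G i * / (2 * INR H) * (INR (k - i) * q (k - i)%nat) by field; lra.
    have -> : B / (2 * INR H) * (G i * G (k - i)%nat) = G i * / (2 * INR H) * (B * G (k - i)%nat).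
      by field; lra.
    apply: Rmult_le_compat_l hu; apply: Rmult_le_pos; first by have := Gpos i; lra.
    by apply/Rlt_le/Rinv_0_lt_compat; lra.
  rewrite nsum_scal.
  have hc := tail_conv_le p G hp hG D hD1 hD k ltac:(lia).
  apply: Rle_trans (Rmult_le_compat_l _ _ _ _ hc) _.
    by apply/Rlt_le/Rdiv_lt_0_compat; lra.
  have hk8 : INR k <= 8 * INR H by have := INR_leq k (8 * H) h8; rewrite INR_muln /=; lra.
  have -> : B / (2 * INR H) * (2 * D * C0 * (INR k * G k * G k))
     = B * D * C0 * G k / (INR H * INR k) * (INR k * INR k * G k) by field; lra.
  have -> : ramp_const * (G k / INR k * (INR H * G H))
     = B * D * C0 * G k / (INR H * INR k) * (8 * INR H * (8 * INR H) * G H).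
    by rewrite /ramp_const; field; lra.
  apply: Rmult_le_compat_l.
    by apply/Rlt_le/Rdiv_lt_0_compat; apply: Rmult_lt_0_compat => //; lra.
  by apply: Rmult_le_compat; try lra; [apply: Rmult_le_pos; lra | apply: Rmult_le_compat; lra].
rewrite (@nsum_split 1 (4 * H) k); last by lia.
rewrite (nsum_ext (4 * H) k _ (fun=> 0)) ?nsum_0; last first.
  by move=> i hi; rewrite !ramp_1 //; try lia; lra.
rewrite Rplus_0_r.
apply: (Rle_trans _ (nsum 1 (4 * H) (fun i => 2 * B * D * (G k / INR k) * G i))).
  apply: nsum_le => i hi.
  have hm := mass_le p G hp hG D hD1 hD (k - i) k ltac:(lia) ltac:(lia) ltac:(lia).
  have h1 := ramp_bounds H k; have h2 := ramp_bounds H i.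
  have h3 := Gq_pos i k ltac:(lia); have h4 := Gpos i.
  apply: (Rle_trans _ (G i * q (k - i)%nat * 1)); first by apply: Rmult_le_compat_l; lra.
  by rewrite Rmult_1_r Rmult_comm; apply: Rmult_le_compat_r; lra.
rewrite nsum_scal.
have hs := sum_tail_lt p G hp hG (4 * H) ltac:(lia).
have h4H : G (4 * H)%nat <= G H by apply: anti; lia.
have hs2 : nsum 1 (4 * H) G <= C0 * (4 * INR H * G H).
  apply: Rle_trans hs _; rewrite INR_muln [INR 4]/= ; have := Gpos (4 * H)%nat => h4.
  apply: Rmult_le_compat; try lra; first by apply: Rmult_le_pos; lra.
  by apply: Rmult_le_compat; lra.
apply: (Rle_trans _ (2 * B * D * (G k / INR k) * (C0 * (4 * INR H * G H)))).
  apply: Rmult_le_compat_l => //; have := Gk_pos k ltac:(lia) => h.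
  by apply: Rmult_le_pos; [nra | lra].
have : 0 < B * D * C0 * (G k / INR k * (INR H * G H)).
  by apply: Rmult_lt_0_compat => //; apply: Rmult_lt_0_compat; [apply: Gk_pos; lia | nra].
rewrite /ramp_const; lra.
Qed.

(** Both constants are quotients by the drift [ramp_const] of the ramp. The gain is a lower bound
    for the weight of jumps into [[H, 2H)] times the mean [Delta / 2]; in the loss, [2 * B * D]
    bounds the weight of jumps below [m] and the 1 accounts for the source [S]. *)
Definition barrier_gain := q 1%nat / (2 * D * ramp_const).
Definition barrier_loss := (2 * B * D + 1) / ramp_const.

(* A jump from k >= 2H into [1, 2H) lands in [H, 2H), where u is large on average, with
   non-negligible probability; induction on k shows that u dominates eta * ramp H on [2H, oo). *)
Lemma barrier (u E : nat -> R) (m H : nat) (Delta S : R) :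
  (1 <= m <= H)%nat -> 0 <= S ->
  (forall i, (m <= i)%nat -> 0 <= u i) ->
  (forall i, (1 <= i < m)%nat -> - E i <= u i /\ 0 <= E i) ->
  INR H * Delta / 2 <= nsum H (2 * H) u ->
  (forall k, (2 <= k)%nat ->
     - (S * (G k * G k / INR k)) <= nsum 1 k (fun i => G i * q (k - i)%nat * (u k - u i))) ->
  forall k, (4 * H <= k)%nat ->
  barrier_gain * Delta - barrier_loss * (nsum 1 m (fun i => G i * E i) / (INR H * G H) + S / INR H)
  <= u k.
Proof.
move=> hmH hS hu huE hsum hharm.
set Bad := nsum 1 m _; set eta := _ - _.
have hH0 := INR_gt0 H ltac:(lia); have gH := Gpos H.
have hR : 0 < ramp_const.
  by rewrite /ramp_const; repeat apply: Rmult_lt_0_compat; lra.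
have hBad : 0 <= Bad.
  by apply: nsum_pos => i hi; have [_ ?] := huE i hi; apply: Rmult_le_pos => //; have := Gpos i; lra.
have hqD : 0 < q 1%nat / (2 * D) by apply: Rdiv_lt_0_compat; lra.
have hBD : 0 < 2 * B * D by repeat apply: Rmult_lt_0_compat; lra.
(* The height [eta] is the one at which the drift of the ramp balances gain and losses. *)
have heta : ramp_const * (eta * (INR H * G H)) =
   q 1%nat / (2 * D) * Delta * (INR H * G H) - (2 * B * D + 1) * (Bad + S * G H).
  by rewrite /eta /barrier_gain /barrier_loss; field; lra.
case: (Rlt_dec eta 0) => heta0.
  by move=> k hk; have := hu k ltac:(lia); lra.
have {}heta0 : 0 <= eta by lra.
suff key : forall k, (2 * H <= k)%nat -> eta * ramp H k <= u k.
  by move=> k hk; have := key k ltac:(lia); rewrite ramp_1 //; lra || lia.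
elim/ltn_ind => k IH hk.
have hk0 := INR_gt0 k ltac:(lia); have hg := Gpos k; have hgk := Gk_pos k ltac:(lia).
have hgH : G k <= G H by apply: anti; lia.
set gk := G k / INR k in hgk.
have hW : 0 < nsum 1 k (fun i => G i * q (k - i)%nat).
  rewrite nsum_recl; last by lia.
  have : 0 <= nsum 2 k (fun i => G i * q (k - i)%nat).
    by apply: nsum_pos => i hi; apply/Rlt_le/Gq_pos; lia.
  by have := Gq_pos 1 k ltac:(lia); lra.
suff : 0 <= nsum 1 k (fun i => G i * q (k - i)%nat) * (u k - eta * ramp H k) by nra.
have hh := hharm k ltac:(lia).
have hr := ramp_conv_le H k ltac:(lia) hk; rewrite -/gk in hr.
have -> : nsum 1 k (fun i => G i * q (k - i)%nat) * (u k - eta * ramp H k) =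
  nsum 1 k (fun i => G i * q (k - i)%nat * (u k - u i))
  + nsum 1 k (fun i => G i * q (k - i)%nat * (u i - eta * ramp H i))
  - eta * nsum 1 k (fun i => G i * q (k - i)%nat * (ramp H k - ramp H i)).
  rewrite -nsum_scal -nsum_plus -nsum_minus Rmult_comm -nsum_scal.
  by apply: nsum_ext => i _; ring.
(* Cut at [m], [H] and [2 * H]; the ramp vanishes on the first three blocks. Below [m] the loss is
   [Bad], on [[m, H)] the terms are nonnegative, [[H, 2H)] carries the gain, and the last block is
   the induction hypothesis. *)
have hmain : q 1%nat * gk * (G H / D) * (INR H * Delta / 2) - 2 * B * D * gk * Bad
    <= nsum 1 k (fun i => G i * q (k - i)%nat * (u i - eta * ramp H i)).
  rewrite (@nsum_split 1 m k); last by lia.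
  rewrite (@nsum_split m H k); last by lia.
  rewrite (@nsum_split H (2 * H) k); last by lia.
  have e1 : - (2 * B * D * gk * Bad) <= nsum 1 m (fun i => G i * q (k - i)%nat * (u i - eta * ramp H i)).
    have -> : - (2 * B * D * gk * Bad) = - (2 * B * D * gk) * Bad by ring.
    rewrite -nsum_scal; apply: nsum_le => i hi; have [h1 h2] := huE i hi.
    rewrite ramp_0; try lia.
    have hm := mass_le p G hp hG D hD1 hD (k - i) k ltac:(lia) ltac:(lia) ltac:(lia).
    rewrite -/gk in hm.
    have h3 := Gpos i; have h4 := Gq_pos i k ltac:(lia).
    apply: (Rle_trans _ (G i * q (k - i)%nat * (- E i))); last by apply: Rmult_le_compat_l; lra.
    have := Rmult_le_compat_r (G i * E i) _ _ ltac:(by apply: Rmult_le_pos; lra) hm; lra.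
  have e2 : 0 <= nsum m H (fun i => G i * q (k - i)%nat * (u i - eta * ramp H i)).
    apply: nsum_pos => i hi; rewrite ramp_0; try lia.
    have := hu i ltac:(lia) => h; apply: Rmult_le_pos; last by lra.
    by apply/Rlt_le/Gq_pos; lia.
  have e3 : q 1%nat * gk * (G H / D) * (INR H * Delta / 2) <=
     nsum H (2 * H) (fun i => G i * q (k - i)%nat * (u i - eta * ramp H i)).
    have hc : 0 < q 1%nat * gk * (G H / D).
      by apply: Rmult_lt_0_compat; [nra | apply: Rdiv_lt_0_compat; lra].
    apply: Rle_trans (Rmult_le_compat_l _ _ _ (Rlt_le _ _ hc) hsum) _.
    rewrite -nsum_scal; apply: nsum_le => i hi; rewrite ramp_0; try lia.
    rewrite Rmult_0_r Rminus_0_r; apply: Rmult_le_compat_r; first by apply: hu; lia.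
    have hm := mass_ge p G hp hG (k - i) k ltac:(lia); rewrite -/gk in hm.
    have hGi : G H / D <= G i.
      have := hD H i ltac:(lia) ltac:(lia) => h; apply: (Rmult_le_reg_r D); first by lra.
      by rewrite /Rdiv Rmult_assoc Rinv_l; lra.
    rewrite Rmult_comm; apply: Rmult_le_compat => //; first by apply/Rlt_le/Rdiv_lt_0_compat; lra.
    by nra.
  have e4 : 0 <= nsum (2 * H) k (fun i => G i * q (k - i)%nat * (u i - eta * ramp H i)).
    apply: nsum_pos => i hi; have := IH i ltac:(lia) ltac:(lia) => h.
    by apply: Rmult_le_pos; [apply/Rlt_le/Gq_pos; lia | lra].
  lra.
have hr2 := Rmult_le_compat_l _ _ _ heta0 hr.
have hgk2 : G k * G k / INR k = gk * G k by rewrite /gk; field; lra.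
rewrite hgk2 in hh.
have hfin : eta * (ramp_const * (gk * (INR H * G H))) =
   gk * (q 1%nat / (2 * D) * Delta * (INR H * G H) - (2 * B * D + 1) * (Bad + S * G H)).
  by rewrite -heta; ring.
rewrite hfin in hr2.
have hx : q 1%nat * gk * (G H / D) * (INR H * Delta / 2) = gk * (q 1%nat / (2 * D) * Delta * (INR H * G H)).
  by field; lra.
rewrite hx in hmain.
have h1 : S * (gk * G k) <= S * (gk * G H) by apply: Rmult_le_compat_l => //; nra.
have h2 : 0 <= gk * Bad by nra.
have h3 : 0 <= 2 * B * D * (gk * (S * G H)).
  by apply: Rmult_le_pos; [lra | apply: Rmult_le_pos; [lra | nra]].
lra.
Qed.

End Barrier.

(** * Contraction of the oscillation and convergence of the slope *)

Section Oscillation.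
Context (p : R) (G : nat -> R) (hp : 0 < p < 1) (hG : lis_tail p G).
Local Notation q := (mass G).
Local Notation r := (log_slope G).
Local Notation B := (slope_bound p).
Local Notation C0 := (sum_const p G).

Let Gpos := lt_pos _ _ hG.
Let qpos := lt_mass _ _ hG.
Let q1pos : 0 < q 1%nat := qpos 1 erefl.
Let Bpos : 0 < B := exp_pos _.
Let C0ge : 2 <= C0 := sum_const_ge2 p G hp hG.

Definition osc_le n d := forall i j, (n <= i)%nat -> (n <= j)%nat -> r i - r j <= d.

Lemma log_slope_bounds k : (1 <= k)%nat -> 0 < r k <= B.
Proof.
move=> hk; have hk0 := INR_gt0 k hk; have hg := Gpos k; have hq := qpos k hk.
split; first by apply: Rdiv_lt_0_compat => //; nra.
apply: (Rmult_le_reg_r _ _ _ hg); rewrite /log_slope /Rdiv Rmult_assoc Rinv_l; last by lra.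
by have := mass_upper p G hp hG k hk; lra.
Qed.

(** With [M] the supremum of the slope on [[m, oo)], the functions [M - r] and [r - (M - d)] are
    nonnegative there and add up to [d], so one of them has mean at least [d / 2] on [[H, 2H)]. The
    barrier applied to that one cuts the oscillation from above or from below. Before [m] both are
    at least [- E i]. *)
Lemma osc_step : exists eta C, 0 < eta /\ 0 < C /\
  forall m H d (E : nat -> R), (1 <= m <= H)%nat -> osc_le m d ->
  (forall i, (1 <= i < m)%nat -> osc_le i (E i)) ->
  osc_le (4 * H) (d - eta * d + C * (nsum 1 m (fun i => G i * E i) / (INR H * G H) + / INR H)).
Proof.
have [D [hD1 hD]] := tail_comparable p G hp hG.
have hR : 0 < ramp_const p G D by rewrite /ramp_const; repeat apply: Rmult_lt_0_compat; lra.
have hBD : 0 < B * D by nra.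
have hp2 : 0 < (1 - p) / (2 * p) by apply: Rdiv_lt_0_compat; lra.
set S := (1 - p) / (2 * p) * (B * B).
have hS : 0 < S by apply: Rmult_lt_0_compat => //; nra.
have hbl : 0 < barrier_loss p G D by apply: Rdiv_lt_0_compat; lra.
exists (barrier_gain p G D), (barrier_loss p G D * (1 + S)); split.
  by apply: Rdiv_lt_0_compat => //; nra.
split; first by nra.
move=> m H d E hm hosc hE.
have [M [hM1 hM2]] : {M | is_lub (fun x => exists i, (m <= i)%nat /\ x = r i) M}.
  apply: completeness; last by exists (r m), m.
  by exists (r m + d) => x [i [hi ->]]; have := hosc i m hi (leqnn m); lra.
have up i : (m <= i)%nat -> r i <= M by move=> hi; apply: hM1; exists i.
have lo i : (m <= i)%nat -> M - d <= r i.
  move=> hi; suff : M <= r i + d by lra.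
  by apply: hM2 => x [j [hj ->]]; have := hosc j i hj hi; lra.
have hsk k : (2 <= k)%nat ->
    0 <= nsum 1 k (fun i => G i * q (k - i)%nat * (r k - r i)) <= S * (G k * G k / INR k).
  move=> hk; rewrite (log_slope_conv p G hp hG k hk).
  have hk0 := INR_gt0 k ltac:(lia); have hq := qpos k ltac:(lia).
  have hg := Gpos k; have hu := mass_upper p G hp hG k ltac:(lia).
  split; first by apply: Rmult_le_pos; [lra | apply: Rmult_le_pos; nra].
  rewrite [S * _](_ : _ = (1 - p) / (2 * p) * (B * B * (G k * G k / INR k))); last by rewrite /S; ring.
  apply: Rmult_le_compat_l; first by lra.
  apply: (Rmult_le_reg_r _ _ _ hk0).
  have -> : B * B * (G k * G k / INR k) * INR k = (B * G k) * (B * G k) by field; lra.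
  have -> : INR k * q k * q k * INR k = (INR k * q k) * (INR k * q k) by ring.
  by apply: Rmult_le_compat; nra.
have hEpos i : (1 <= i < m)%nat -> 0 <= E i.
  by move=> hi; have := hE i hi i i (leqnn i) (leqnn i); lra.
have hH0 := INR_gt0 H ltac:(lia); have hgH := Gpos H.
set Bad := nsum 1 m _.
have hBad : 0 <= Bad / (INR H * G H).
  apply: Rmult_le_pos; last by apply/Rlt_le/Rinv_0_lt_compat; nra.
  by apply: nsum_pos => i hi; apply: Rmult_le_pos; [have := Gpos i; lra | exact: hEpos].
have hloss : barrier_loss p G D * (Bad / (INR H * G H) + S / INR H)
   <= barrier_loss p G D * (1 + S) * (Bad / (INR H * G H) + / INR H).
  have hi := Rinv_0_lt_compat _ hH0.
  rewrite Rmult_assoc; apply: Rmult_le_compat_l; first by lra.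
  by rewrite /Rdiv -/(Bad / _); nra.
have hsum : nsum H (2 * H) (fun i => M - r i) + nsum H (2 * H) (fun i => r i - (M - d)) = INR H * d.
  rewrite -nsum_plus (nsum_ext _ _ _ (fun=> d)); last by move=> i _; ring.
  by rewrite nsum_const (_ : 2 * H - H = H)%nat //; lia.
case: (Rle_dec (INR H * d / 2) (nsum H (2 * H) (fun i => M - r i))) => hcase.
  have hb := barrier p G hp hG D hD1 hD (fun i => M - r i) E m H d S hm (Rlt_le _ _ hS).
  move=> i j hi hj; have := lo j ltac:(lia).
  suff : barrier_gain p G D * d - barrier_loss p G D * (Bad / (INR H * G H) + S / INR H) <= M - r i by lra.
  apply: hb => //.
  - by move=> l hl; have := up l hl; lra.
  - move=> l hl; split; last exact: hEpos.
    by have := hE l hl l m (leqnn l) ltac:(lia); have := up m (leqnn m); lra.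
  - move=> k hk; have [h1 h2] := hsk k hk.
    rewrite (nsum_ext _ _ _ (fun i => -1 * (G i * q (k - i)%nat * (r k - r i)))); last by move=> ? _; ring.
    by rewrite nsum_scal; lra.
have hb := barrier p G hp hG D hD1 hD (fun i => r i - (M - d)) E m H d S hm (Rlt_le _ _ hS).
move=> i j hi hj; have := up i ltac:(lia).
suff : barrier_gain p G D * d - barrier_loss p G D * (Bad / (INR H * G H) + S / INR H) <= r j - (M - d) by lra.
apply: hb => //.
- by move=> l hl; have := lo l hl; lra.
- move=> l hl; split; last exact: hEpos.
  by have := hE l hl m l ltac:(lia) (leqnn l); have := lo m (leqnn m); lra.
- by lra.
- move=> k hk; have [h1 h2] := hsk k hk.
  rewrite (nsum_ext _ _ _ (fun i => G i * q (k - i)%nat * (r k - r i))); last by move=> ? _; ring.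
  by lra.
Qed.

Lemma Rpower_small e x : 0 < e -> 0 < x -> exists A, (1 <= A)%nat /\ Rpower (INR A) (- e) <= x.
Proof.
move=> he hx; have [A hA] := INR_unbounded (exp (- ln x / e)).
have h0 := exp_pos (- ln x / e).
exists A; split.
  by case: A hA => // /= hA; lra.
have hl : - ln x / e <= ln (INR A) by rewrite -[X in X <= _]ln_exp; apply/Rlt_le/ln_increasing; lra.
rewrite /Rpower -[X in _ <= X](exp_ln x) //.
have : - e * ln (INR A) <= ln x.
  have := Rmult_le_compat_l e _ _ (Rlt_le _ _ he) hl.
  have -> : e * (- ln x / e) = - ln x by field; lra.
  lra.
by case=> [h|->]; [apply/Rlt_le/exp_increasing | lra].
Qed.

(** Strong induction over scales, with [m] the integer part of [n / (4 * A)] and [H = A * m], so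
    that [4 * H <= n < 8 * A * m]. The contraction budget is [1 - eta + eta / 2 + eta / 4]: memory
    of [[1, m)] takes [eta / 2], the source takes [eta / 4], and [1 - eta / 4] is what [e] has to
    match. *)
Lemma osc_decay : exists e K, 0 < e <= / (8 * C0) /\ 0 < K /\
  forall n, (1 <= n)%nat -> osc_le n (K * Rpower (INR n) (- e)).
Proof.
have [eta [C [heta [hC hstep]]]] := osc_step.
set e0 := / (8 * C0).
have he0 : 0 < e0 by apply: Rinv_0_lt_compat; lra.
have he01 : e0 <= / 16 by apply: Rinv_le_contravar; lra.
(* The memory is damped with the fixed exponent [e0], because [e] itself depends on [A]. *)
have [A [hA hAe]] := Rpower_small e0 (eta / (8 * C * C0)) he0 ltac:(apply: Rdiv_lt_0_compat; nra).
have hA1 := INR_ge1 A hA.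
have hl8 : 0 < ln (8 * INR A) by rewrite -ln_1; apply: ln_increasing; lra.
(* Small enough for [(8 * A)^(-e) >= 1 - eta / 4], the loss of the power between [m] and [n]. *)
set e := Rmin e0 (eta / (4 * ln (8 * INR A))).
have he : 0 < e by apply: Rmin_glb_lt => //; apply: Rdiv_lt_0_compat; lra.
have hee0 : e <= e0 by apply: Rmin_l.
have hA8 : 1 - eta / 4 <= Rpower (8 * INR A) (- e).
  apply: Rle_trans (exp_ineq1_le _).
  have : e * ln (8 * INR A) <= eta / 4.
    have := Rmult_le_compat_r _ _ _ (Rlt_le _ _ hl8) (Rmin_r e0 (eta / (4 * ln (8 * INR A)))).
    have -> : eta / (4 * ln (8 * INR A)) * ln (8 * INR A) = eta / 4 by field; lra.
    by rewrite -/e.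
  lra.
(* The first summand covers [n < 4 * A] by the trivial bound [B]; the second absorbs the source
   [C / H]. *)
set K := B * (4 * INR A) + 4 * C / eta.
have hCe : 0 < 4 * C / eta by apply: Rdiv_lt_0_compat; lra.
have hK : 0 < K by rewrite /K; nra.
exists e, K; split => //; split => //.
have pow1 n : (1 <= n)%nat -> / INR n <= Rpower (INR n) (- e).
  move=> hn; have h1 := INR_ge1 n hn.
  rewrite Rpower_Ropp; apply: Rinv_le_contravar; first exact: Rpower_pos.
  by rewrite -{2}(Rpower_1 (INR n)); [apply: Rle_Rpower; lra | lra].
elim/ltn_ind => n IH hn.
case: (ltnP n (4 * A)) => hnA.
  move=> i j hi hj; have := log_slope_bounds i ltac:(lia); have := log_slope_bounds j ltac:(lia).
  have hn0 := INR_gt0 n hn.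
  have h4 : INR n <= 4 * INR A by have := INR_leq n (4 * A) ltac:(lia); rewrite INR_muln /=; lra.
  suff : B <= K * Rpower (INR n) (- e) by lra.
  apply: (Rle_trans _ (K * / INR n)); last by apply: Rmult_le_compat_l; [lra | exact: pow1].
  apply: (Rmult_le_reg_r _ _ _ hn0); rewrite Rmult_assoc Rinv_l ?Rmult_1_r; last by lra.
  rewrite /K; nra.
set m := Nat.div n (4 * A).
have hm : (4 * A * m <= n < 4 * A * m.+1)%nat.
  have := Nat.div_mod_eq n (4 * A); have := Nat.mod_upper_bound n (4 * A).
  rewrite -/m; nia.
have hm1 : (1 <= m)%nat by case: (m) hm => //; lia.
set P := Rpower (INR m) (- e).
have hP : 0 < P by apply: Rpower_pos.
have hmH : (1 <= m <= A * m)%nat by rewrite hm1 leq_pmull.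
have hmn : (m < n)%nat by nia.
have hst := hstep m (A * m)%nat (K * P) (fun i => K * Rpower (INR i) (- e)) hmH
   (IH m hmn hm1) ltac:(by move=> i hi; apply: IH; lia).
set H := (A * m)%nat in hst hmH.
have hH0 := INR_gt0 H ltac:(lia); have hgH := Gpos H; have hm0 := INR_gt0 m hm1.
have hHG : 0 < INR H * G H by nra.
have hBad : nsum 1 m (fun i => G i * (K * Rpower (INR i) (- e))) / (INR H * G H)
     <= K * P * (eta / (2 * C)).
  rewrite (nsum_ext _ _ _ (fun i => K * (G i * Rpower (INR i) (- e)))); last by move=> i _; ring.
  rewrite nsum_scal.
  have h1 : nsum 1 m (fun i => G i * Rpower (INR i) (- e)) <= nsum 1 m.+1 (fun i => G i * Rpower (INR i) (- e)).
    apply: nsum_widen => // i _; apply: Rmult_le_pos; first by have := Gpos i; lra.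
    exact/Rlt_le/Rpower_pos.
  have h2 := sum_tail_power p G hp hG e m ltac:(split; [lra | exact: hee0]) hm1.
  have h3 := sum_tail_scale p G hp hG e0 m A ltac:(split; [lra | exact: Rle_refl]) hm1 hA.
  have h4 := sum_tail_le p G hp hG H ltac:(lia).
  have hx : 0 <= nsum 1 m.+1 G by apply: nsum_pos => i _; have := Gpos i; lra.
  have h5 : nsum 1 m.+1 G <= 2 * (eta / (8 * C * C0)) * (C0 * (INR H * G H)).
    apply: Rle_trans h3 _; apply: Rmult_le_compat => //; last by lra.
      by have := Rpower_pos (INR A) (- e0); lra.
    by apply: nsum_pos => i _; have := Gpos i; lra.
  apply: (Rmult_le_reg_r _ _ _ hHG).
  rewrite /Rdiv Rmult_assoc Rinv_l ?Rmult_1_r; last by lra.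
  rewrite [K * P * _ * _](_ : _ = K * (2 * P * (2 * (eta / (8 * C * C0)) * (C0 * (INR H * G H))))); last by field; lra.
  apply: Rmult_le_compat_l; first by lra.
  apply: Rle_trans h1 _; apply: Rle_trans h2 _; rewrite -/P.
  by apply: Rmult_le_compat_l; lra.
have hinvH : / INR H <= P.
  apply: (Rle_trans _ (/ INR m)); last exact: pow1.
  by apply: Rinv_le_contravar => //; apply: INR_leq; lia.
have hnP : (1 - eta / 4) * P <= Rpower (INR n) (- e).
  apply: (Rle_trans _ (Rpower (8 * INR A) (- e) * P)); first by apply: Rmult_le_compat_r; lra.
  rewrite Rpower_mult_distr; try lra.
  apply: Rpower_neg_le; last by lra.
  split; first by apply: INR_gt0.
  have := INR_leq n (8 * A * m) ltac:(nia); rewrite !INR_muln /=; lra.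
move=> i j hi hj.
have hij := hst i j ltac:(nia) ltac:(nia).
apply: Rle_trans hij _.
apply: (Rle_trans _ (K * ((1 - eta / 4) * P))); last by apply: Rmult_le_compat_l; lra.
have hCP : C * (K * P * (eta / (2 * C)) + P) <= K * P * (eta / 2) + K * P * (eta / 4).
  have -> : C * (K * P * (eta / (2 * C)) + P) = K * P * (eta / 2) + C * P by field; lra.
  have : C * P <= K * P * (eta / 4).
    have -> : K * P * (eta / 4) = (B * (4 * INR A) * (eta / 4) + C) * P by rewrite /K; field; lra.
    apply: Rmult_le_compat_r; first by lra.
    have : 0 <= B * (4 * INR A) * (eta / 4) by apply: Rmult_le_pos; nra.
    lra.
  lra.
have := Rmult_le_compat_l C _ _ (Rlt_le _ _ hC) (Rplus_le_compat _ _ _ _ hBad hinvH).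
lra.
Qed.

Lemma log_slope_limit : exists rho e K, 0 < e <= / (8 * C0) /\ 0 < K /\
  forall k, (1 <= k)%nat -> Rabs (r k - rho) <= K * Rpower (INR k) (- e).
Proof.
have [e [K [he [hK hosc]]]] := osc_decay.
have hc : ex_finite_lim_seq r.
  apply/ex_lim_seq_cauchy_corr => eps.
  have [N [hN hNe]] := Rpower_small e (eps / (2 * K)) ltac:(lra) ltac:(apply: Rdiv_lt_0_compat; [exact: cond_pos | lra]).
  exists N => n m hn hm.
  have h1 := hosc N hN n m ltac:(lia) ltac:(lia); have h2 := hosc N hN m n ltac:(lia) ltac:(lia).
  have h3 := Rmult_le_compat_l K _ _ (Rlt_le _ _ hK) hNe.
  have h4 : K * (eps / (2 * K)) = eps / 2 by field; lra.
  have h5 := cond_pos eps.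
  apply: Rabs_def1; lra.
have [rho hrho] := hc.
exists rho, e, K; split => //; split => // k hk.
have hle : Rbar_le (r k - rho) (K * Rpower (INR k) (- e)).
  apply: (is_lim_seq_le_loc (fun n => r k - r n) (fun=> K * Rpower (INR k) (- e))).
  - by exists k => n hn; apply: hosc => //; lia.
  - by apply: is_lim_seq_minus'; [exact: is_lim_seq_const | exact: hrho].
  - exact: is_lim_seq_const.
have hge : Rbar_le (rho - r k) (K * Rpower (INR k) (- e)).
  apply: (is_lim_seq_le_loc (fun n => r n - r k) (fun=> K * Rpower (INR k) (- e))).
  - by exists k => n hn; apply: hosc => //; lia.
  - by apply: is_lim_seq_minus'; [exact: hrho | exact: is_lim_seq_const].
  - exact: is_lim_seq_const.
simpl in hle, hge.
by apply: Rabs_le; lra.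
Qed.

End Oscillation.

(** * The second-moment recursion *)

(** Bernoulli's inequality: average [ln u <= u - 1] at [u = x / t] and [u = 1 / t] with weights [s]
    and [1 - s]; the right-hand sides cancel. *)
Lemma Rpower_le_affine x s : 0 < x -> 0 <= s <= 1 -> Rpower x s <= 1 + s * (x - 1).
Proof.
move=> hx hs; set t := 1 + s * (x - 1).
have ht : 0 < t by rewrite /t; nra.
have h1 := ln_le_sub1 (x / t) (Rdiv_lt_0_compat _ _ hx ht).
have h2 := ln_le_sub1 (/ t) (Rinv_0_lt_compat _ ht).
rewrite ln_div // in h1; rewrite ln_Rinv // in h2.
have h3 : s * (x / t - 1) + (1 - s) * (/ t - 1) = 0 by rewrite /t; field; rewrite -/t; lra.
have h4 : s * ln x <= ln t by nra.
rewrite /Rpower -[X in _ <= X](exp_ln t) //.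
by case: h4 => [h|->]; [apply/Rlt_le/exp_increasing | lra].
Qed.

Lemma Rpower_one_sub x e : 0 < x -> Rpower x (1 - e) = x * Rpower x (- e).
Proof. by move=> hx; rewrite /Rminus Rpower_plus Rpower_1. Qed.

(** The concave function [t^(1 - e)] lies below its tangent at [y]. *)
Lemma Rpower_concave x y e : 0 < x <= y -> 0 <= e <= 1 ->
  (1 - e) * Rpower y (- e) * (y - x) <= Rpower y (1 - e) - Rpower x (1 - e).
Proof.
move=> hx he.
have hxy : 0 < x / y by apply: Rdiv_lt_0_compat; lra.
have := Rpower_le_affine (x / y) (1 - e) hxy ltac:(lra).
have -> : Rpower x (1 - e) = Rpower y (1 - e) * Rpower (x / y) (1 - e).
  rewrite Rpower_mult_distr //; last by lra.
  by congr Rpower; field; lra.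
rewrite (Rpower_one_sub y); last by lra.
move=> h; have hP := Rpower_pos y (- e).
have := Rmult_le_compat_l (y * Rpower y (- e)) _ _ ltac:(nra) h.
have -> : y * Rpower y (- e) * (1 + (1 - e) * (x / y - 1)) =
  y * Rpower y (- e) + Rpower y (- e) * (1 - e) * (x - y) by field; lra.
lra.
Qed.

Section SecondMoment.
Context (p : R) (G : nat -> R) (hp : 0 < p < 1) (hG : lis_tail p G).
Local Notation q := (mass G).
Local Notation r := (log_slope G).
Local Notation C0 := (sum_const p G).

Let Gpos := lt_pos _ _ hG.
Let qpos := lt_mass _ _ hG.
Let q1pos : 0 < q 1%nat := qpos 1 erefl.
Let anti := tail_anti p G hG.
Let C0ge : 2 <= C0 := sum_const_ge2 p G hp hG.

(** If [k - i >= k / 2] the power is at most [2 * k^(-e)]. Otherwise [G i <= D * G k], and the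
    remaining weighted sum of [G] is handled by [sum_tail_power] and the bound
    [G k * nsum 1 k G <= GG]. *)
Lemma tail_conv_power_le : exists C, 0 < C /\ forall e k, 0 <= e <= / (8 * C0) -> (2 <= k)%nat ->
  nsum 1 k (fun i => G i * G (k - i)%nat * Rpower (INR (k - i)) (- e))
  <= C * Rpower (INR k) (- e) * nsum 1 k (fun i => G i * G (k - i)%nat).
Proof.
have [D [hD1 hD]] := tail_comparable p G hp hG.
exists (2 + 4 * D); split; first by lra.
move=> e k he hk.
have he1 : e <= 1.
  apply: Rle_trans (proj2 he) _; rewrite -[X in _ <= X]Rinv_1; apply: Rinv_le_contravar; lra.
have hk0 := INR_gt0 k ltac:(lia); have hg := Gpos k.
set P := Rpower (INR k) (- e).
have hP : 0 < P by apply: Rpower_pos.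
have half j : (1 <= j)%nat -> (k <= 2 * j)%nat -> Rpower (INR j) (- e) <= 2 * P.
  move=> hj hkj; have hj0 := INR_gt0 j hj.
  have h2 : INR k <= 2 * INR j by have := INR_leq k (2 * j) hkj; rewrite INR_muln /=; lra.
  apply: (Rle_trans _ (Rpower (INR k / 2) (- e))); first by apply: Rpower_neg_le; lra.
  rewrite /Rdiv -Rpower_mult_distr; try lra.
  rewrite -/P Rmult_comm; apply: Rmult_le_compat_r; first by lra.
  rewrite Rpower_Ropp -[X in _ <= X]Rinv_inv; apply: Rinv_le_contravar; first by lra.
  rewrite /Rpower -{1}(exp_ln (/ 2)); last by lra.
  have : ln (/ 2) <= e * ln (/ 2) by have := ln_le_sub1 (/ 2) ltac:(lra); nra.
  by case=> [h|<-]; [apply/Rlt_le/exp_increasing | lra].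
set GG := nsum 1 k (fun i => G i * G (k - i)%nat).
have hGG : G k * nsum 1 k G <= GG.
  rewrite /GG -nsum_scal; apply: nsum_le => i hi; rewrite Rmult_comm.
  by apply: Rmult_le_compat_l; [have := Gpos i; lra | apply: anti; lia].
apply: (Rle_trans _ (nsum 1 k (fun i => 2 * P * (G i * G (k - i)%nat)
     + D * G k * (G (k - i)%nat * Rpower (INR (k - i)) (- e))))).
  apply: nsum_le => i hi.
  have h1 := Gpos i; have h2 := Gpos (k - i)%nat; have h3 := Rpower_pos (INR (k - i)) (- e).
  have h4 : 0 < G i * G (k - i)%nat by apply: Rmult_lt_0_compat.
  have h5 : 0 < G (k - i)%nat * Rpower (INR (k - i)) (- e) by apply: Rmult_lt_0_compat.
  case: (leqP k (2 * (k - i))) => h.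
    have h6 := half (k - i)%nat ltac:(lia) h.
    have := Rmult_le_compat_l _ _ _ (Rlt_le _ _ h4) h6.
    have : 0 <= D * G k * (G (k - i)%nat * Rpower (INR (k - i)) (- e)) by apply: Rmult_le_pos; nra.
    lra.
  have h6 := hD i k ltac:(lia) ltac:(lia).
  have := Rmult_le_compat_r _ _ _ (Rlt_le _ _ h5) h6; have : 0 < P * (G i * G (k - i)%nat) by nra.
  lra.
rewrite nsum_plus !nsum_scal -/GG -(nsum_rev k (fun j => G j * Rpower (INR j) (- e))).
have [j hj] : exists j, k = j.+1 by exists k.-1; lia.
have hs := sum_tail_power p G hp hG e j he ltac:(lia); rewrite -hj in hs.
have h6 := half j ltac:(lia) ltac:(lia).
have hU : 0 <= nsum 1 k G by apply: nsum_pos => i _; have := Gpos i; lra.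
have h7 : nsum 1 k (fun i => G i * Rpower (INR i) (- e)) <= 4 * P * nsum 1 k G by nra.
have h8 := Rmult_le_compat_l (D * G k) _ _ ltac:(nra) h7.
have h9 := Rmult_le_compat_l (4 * D * P) _ _ ltac:(nra) hGG.
lra.
Qed.

(** The deviation [z] satisfies the recursion of [b] with the source weighted by
    [/ (2 * alpha) - r (k - i)], which is small. The function [y k = k^(1 - e) * G k] is a strict
    supersolution, with a margin of the order of that source, so [K' * y] dominates the absolute
    value of [z]. *)
Lemma second_moment_asymp (alpha e K : R) (b : nat -> R) :
  0 < alpha -> 0 < e <= / (8 * C0) -> 0 < K ->
  (forall k, (1 <= k)%nat -> Rabs (r k - / (2 * alpha)) <= K * Rpower (INR k) (- e)) ->
  (forall k, (2 <= k)%nat -> b k * (p + (1 - p) * G k) =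
     p * nsum 1 k (fun i => b i * q (k - i)%nat)
     + p * nsum 1 k (fun i => G i / 2 * (G (k - i)%nat / 2))) ->
  exists K', forall k, (1 <= k)%nat ->
    Rabs (b k - alpha / 2 * (INR k * G k)) <= K' * (INR k * Rpower (INR k) (- e) * G k).
Proof.
move=> ha he hK hr hb.
have [C [hC hconv]] := tail_conv_power_le.
have he1 : e <= / 16 by apply: Rle_trans (proj2 he) _; apply: Rinv_le_contravar; lra.
set z := fun k => b k - alpha / 2 * (INR k * G k).
set y := fun k => INR k * Rpower (INR k) (- e) * G k.
(* The first summand starts the induction at 1; the second is the source divided by the margin in
   [hy]. *)
set K' := Rabs (z 1%nat) + alpha / 2 * K * C / ((1 - e) * q 1%nat).
have heq : 0 < (1 - e) * q 1%nat by nra.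
exists K'; elim/ltn_ind => k IH hk; rewrite -/(z k) -/(y k).
case: (eqVneq k 1%nat) => [->|hk1].
  rewrite /y /= Rpower_Ropp /Rpower ln_1 Rmult_0_r exp_0 Rinv_1 (lt_one _ _ hG) !Rmult_1_r.
  have : 0 <= alpha / 2 * K * C / ((1 - e) * q 1%nat).
    by apply/Rlt_le/Rdiv_lt_0_compat => //; repeat apply: Rmult_lt_0_compat; lra.
  by rewrite /K'; lra.
have h2 : (2 <= k)%nat by lia.
have ht := lt_tail_conv _ _ hG k h2; have hg := Gpos k; have hk0 := INR_gt0 k hk.
set P := Rpower (INR k) (- e).
have hP : 0 < P by apply: Rpower_pos.
set W := p + (1 - p) * G k.
have hW : 0 < W by rewrite /W; nra.
set GG := nsum 1 k (fun i => G i * G (k - i)%nat).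
(* Writing [k = i + (k - i)] in [lt_tail_conv], the part [(k - i) * q (k - i)] equals
   [r (k - i) * G (k - i)]. *)
have hz : z k * W = p * nsum 1 k (fun i => z i * q (k - i)%nat)
    + p * nsum 1 k (fun i => alpha / 2 * (G i * G (k - i)%nat * (/ (2 * alpha) - r (k - i)%nat))).
  have ht2 : nsum 1 k (fun i => INR k * (G i * q (k - i)%nat)) = INR k * G k * W / p.
    by rewrite nsum_scal -[nsum _ _ _](Rmult_1_l) -(Rinv_l p) ?[_ * _ * nsum _ _ _]Rmult_assoc ?ht /W; [field|]; lra.
  rewrite /z Rmult_minus_distr_r {1}/W hb //.
  have -> : alpha / 2 * (INR k * G k) * W = p * (alpha / 2 * nsum 1 k (fun i => INR k * (G i * q (k - i)%nat))).
    by rewrite ht2; field; lra.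
  rewrite -!Rmult_plus_distr_l -Rmult_minus_distr_l -nsum_scal -!nsum_plus -nsum_minus.
  congr (_ * _); apply: nsum_ext => i hi.
  have := INR_gt0 (k - i)%nat ltac:(lia); have := Gpos (k - i)%nat => h3 h4.
  have -> : r (k - i)%nat = INR (k - i) * q (k - i)%nat / G (k - i)%nat by [].
  by rewrite INR_subn; [field; lra | lia].
have hsrc : Rabs (nsum 1 k (fun i => alpha / 2 * (G i * G (k - i)%nat * (/ (2 * alpha) - r (k - i)%nat))))
    <= alpha / 2 * K * (C * P * GG).
  apply: Rle_trans (Rabs_Rsum_le _ _) _.
  apply: (Rle_trans _ (nsum 1 k (fun i => alpha / 2 * K * (G i * G (k - i)%nat * Rpower (INR (k - i)) (- e))))).
    apply: nsum_le => i hi.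
    have h3 := Gpos i; have h4 := Gpos (k - i)%nat.
    have h5 := hr (k - i)%nat ltac:(lia); rewrite Rabs_minus_sym in h5.
    rewrite Rabs_mult (Rabs_pos_eq (alpha / 2)); last by lra.
    rewrite Rabs_mult (Rabs_pos_eq (G i * _)); last by nra.
    have h6 : 0 <= alpha / 2 * (G i * G (k - i)%nat) by apply: Rmult_le_pos; nra.
    have := Rmult_le_compat_l _ _ _ h6 h5; lra.
  rewrite nsum_scal; apply: Rmult_le_compat_l; first by nra.
  by apply: hconv => //; lra.
(* The margin comes from concavity of [t^(1 - e)] and from
   [(k - i) * q (k - i) >= q 1 * G (k - i)]. *)
have hy : (1 - e) * q 1%nat * P * GG <= y k * W / p - nsum 1 k (fun i => y i * q (k - i)%nat).
  have -> : y k * W / p = INR k * P * nsum 1 k (fun i => G i * q (k - i)%nat).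
    apply: (Rmult_eq_reg_l p); last by lra.
    have -> : p * (INR k * P * nsum 1 k (fun i => G i * q (k - i)%nat))
      = INR k * P * (p * nsum 1 k (fun i => G i * q (k - i)%nat)) by ring.
    by rewrite ht /y -/P /W; field; lra.
  rewrite -!nsum_scal -nsum_minus; apply: nsum_le => i hi.
  have hi0 := INR_gt0 i ltac:(lia); have hik := INR_leq i k ltac:(lia).
  have hc := Rpower_concave (INR i) (INR k) e ltac:(lra) ltac:(lra).
  rewrite !Rpower_one_sub // -/P in hc.
  have hl := mass_lower p G hp hG (k - i)%nat ltac:(lia).
  have h3 := Gpos i; have h4 := qpos (k - i)%nat ltac:(lia).
  have h5 : 0 < G i * q (k - i)%nat by nra.
  have h6 := Rmult_le_compat_l _ _ _ (Rlt_le _ _ h5) hc.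
  have h7 := Rmult_le_compat_l ((1 - e) * P * G i) _ _ ltac:(apply: Rmult_le_pos; nra) hl.
  rewrite INR_subn in h7; last by lia.
  by rewrite /y; lra.
have hGG : 0 <= GG by apply: nsum_pos => i _; have := Gpos i; have := Gpos (k - i)%nat; nra.
have hK' : alpha / 2 * K * C <= K' * ((1 - e) * q 1%nat).
  have -> : K' * ((1 - e) * q 1%nat) = Rabs (z 1%nat) * ((1 - e) * q 1%nat) + alpha / 2 * K * C.
    by rewrite /K'; field; split; lra.
  by have := Rabs_pos (z 1%nat); nra.
have hzq : Rabs (nsum 1 k (fun i => z i * q (k - i)%nat)) <= K' * nsum 1 k (fun i => y i * q (k - i)%nat).
  apply: Rle_trans (Rabs_Rsum_le _ _) _; rewrite -nsum_scal; apply: nsum_le => i hi.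
  have h4 := qpos (k - i)%nat ltac:(lia).
  rewrite Rabs_mult (Rabs_pos_eq (q _)); last by lra.
  have := Rmult_le_compat_r _ _ _ (Rlt_le _ _ h4) (IH i ltac:(lia) ltac:(lia)).
  rewrite -/(z i) -/(y i); lra.
apply: (Rmult_le_reg_r _ _ _ hW).
rewrite -{1}(Rabs_pos_eq W); last by lra.
rewrite -Rabs_mult hz -Rmult_plus_distr_l Rabs_mult (Rabs_pos_eq p); last by lra.
have h8 := Rabs_triang (nsum 1 k (fun i => z i * q (k - i)%nat))
  (nsum 1 k (fun i => alpha / 2 * (G i * G (k - i)%nat * (/ (2 * alpha) - r (k - i)%nat)))).
have hK0 : 0 < K'.
  have : 0 < alpha / 2 * K * C by repeat apply: Rmult_lt_0_compat; lra.
  by nra.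
have h9 := Rmult_le_compat_l _ _ _ (Rlt_le _ _ hK0) hy.
have h10 := Rmult_le_compat_r (P * GG) _ _ ltac:(nra) hK'.
have -> : K' * y k * W = p * (K' * (y k * W / p)) by field; lra.
apply: Rmult_le_compat_l; first by lra.
lra.
Qed.

End SecondMoment.

(** * Comparison with binomial tails *)

(* Divided by F k ^ 2, this sum is increasing in the logarithmic slope of F, and it equals 1 / p
   on the range 1 <= i < k when F is the tail of the LIS. *)
Definition increment_conv_sum (F : nat -> R) (a b k : nat) : R :=
  nsum a b (fun i => (F i - F k) * mass F (k - i)).

Section Comparison.
Context (F1 F2 : nat -> R) (i0 : nat) (lam : R).
Hypotheses (hi0 : (1 <= i0)%nat) (hlam : 1 <= lam).
Hypotheses (hF1 : forall k, (1 <= k)%nat -> 0 < F1 k) (hF2 : forall k, (1 <= k)%nat -> 0 < F2 k).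
Hypothesis hm2 : forall k, (1 <= k)%nat -> 0 < mass F2 k.
Hypothesis hcmp : forall k, (i0 <= k)%nat -> lam * log_slope F2 k <= log_slope F1 k.

Let relmass k : (i0 <= k)%nat -> lam * (mass F2 k / F2 k) <= mass F1 k / F1 k.
Proof.
move=> hk; have h0 : 0 < INR k by have := INR_ge1 k ltac:(lia); lra.
apply: (Rmult_le_reg_l _ _ _ h0); have := hcmp k hk; rewrite /log_slope /Rdiv; lra.
Qed.

(** A larger slope means a larger relative drop at each index; multiply the one-step ratios. *)
Lemma ratio_mono j k : (i0 <= j <= k)%nat -> F2 j / F2 k <= F1 j / F1 k.
Proof.
elim: k => [|k IH] h; first by lia.
case: (eqVneq j k.+1) => [->|hn].
  by rewrite !Rdiv_diag; [lra | have := hF1 k.+1 erefl; lra | have := hF2 k.+1 erefl; lra].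
have {}IH := IH ltac:(lia).
have h1 := hF1 k ltac:(lia); have h2 := hF2 k ltac:(lia).
have h1' := hF1 k.+1 erefl; have h2' := hF2 k.+1 erefl.
have hr := relmass k ltac:(lia); have hm := hm2 k ltac:(lia).
have hrat : F2 k / F2 k.+1 <= F1 k / F1 k.+1.
  have e1 : mass F1 k / F1 k = 1 - F1 k.+1 / F1 k by rewrite /mass; field; lra.
  have e2 : mass F2 k / F2 k = 1 - F2 k.+1 / F2 k by rewrite /mass; field; lra.
  have hp : 0 < mass F2 k / F2 k by apply: Rdiv_lt_0_compat.
  have hx : F1 k.+1 / F1 k <= F2 k.+1 / F2 k by nra.
  have := Rinv_le_contravar _ _ (Rdiv_lt_0_compat _ _ h1' h1) hx.
  by rewrite !Rinv_div.
have -> : F2 j / F2 k.+1 = (F2 j / F2 k) * (F2 k / F2 k.+1) by field; lra.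
have -> : F1 j / F1 k.+1 = (F1 j / F1 k) * (F1 k / F1 k.+1) by field; lra.
apply: Rmult_le_compat => //; apply: Rlt_le; apply: Rdiv_lt_0_compat => //.
by apply: hF2; lia.
Qed.

(** Each normalised term factors as [(F i / F k - 1)] times the relative mass at [k - i] times
    [F (k - i) / F k]. All three factors increase with the slope, and the relative mass contributes
    [lam]. The range keeps [i] and [k - i] above [i0], where the slopes compare. *)
Lemma increment_conv_sum_mono k : (2 * i0 <= k)%nat ->
  lam * (increment_conv_sum F2 i0 (k - i0).+1 k / (F2 k * F2 k))
  <= increment_conv_sum F1 i0 (k - i0).+1 k / (F1 k * F1 k).
Proof.
move=> hk; have h1 := hF1 k ltac:(lia); have h2 := hF2 k ltac:(lia).
rewrite /increment_conv_sum /Rdiv ![nsum _ _ _ * _]Rmult_comm -!nsum_scal; apply: nsum_le => i hi.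
have hq2 := hm2 (k - i)%nat ltac:(lia).
have r1 := ratio_mono i k ltac:(lia); have r2 := ratio_mono (k - i) k ltac:(lia).
have hs := relmass (k - i)%nat ltac:(lia).
have f1 := hF1 (k - i)%nat ltac:(lia); have f2 := hF2 (k - i)%nat ltac:(lia).
have hge : 1 <= F2 i / F2 k.
  have hanti : forall n, F2 (i + n)%nat <= F2 i.
    elim=> [|n IH]; first by rewrite addn0; lra.
    by have := hm2 (i + n)%nat ltac:(lia); rewrite addnS /mass; lra.
  have := hanti (k - i)%nat; rewrite subnKC; last by lia.
  by move=> h; apply: (Rmult_le_reg_r (F2 k)) => //; rewrite /Rdiv Rmult_assoc Rinv_l; lra.
have -> : lam * (/ (F2 k * F2 k) * ((F2 i - F2 k) * mass F2 (k - i)%nat))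
   = (F2 i / F2 k - 1) * ((lam * (mass F2 (k - i)%nat / F2 (k - i)%nat)) * (F2 (k - i)%nat / F2 k)).
  by field; lra.
have -> : / (F1 k * F1 k) * ((F1 i - F1 k) * mass F1 (k - i)%nat)
   = (F1 i / F1 k - 1) * ((mass F1 (k - i)%nat / F1 (k - i)%nat) * (F1 (k - i)%nat / F1 k)).
  by field; lra.
have p1 : 0 <= lam * (mass F2 (k - i)%nat / F2 (k - i)%nat).
  by apply: Rmult_le_pos; [lra | apply/Rlt_le/Rdiv_lt_0_compat].
have p2 : 0 <= F2 (k - i)%nat / F2 k by apply/Rlt_le/Rdiv_lt_0_compat.
apply: Rmult_le_compat => //; try lra; first by apply: Rmult_le_pos.
by apply: Rmult_le_compat.
Qed.

End Comparison.

(** For [i < i0] the mass at [k - i], and for [i > k - i0] the increment [F i - F k], is of order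
    [F k / k]. After division by [F k ^ 2] the error vanishes, since [k * F k] tends to infinity in
    the applications. *)
Lemma increment_conv_sum_ends (F : nat -> R) (i0 : nat) (M : R) :
  (1 <= i0)%nat -> 0 < M -> F 1%nat = 1 ->
  (forall k, (1 <= k)%nat -> 0 < F k) -> (forall k, (1 <= k)%nat -> 0 < mass F k) ->
  (forall j k, (1 <= k)%nat -> (k <= 2 * j)%nat -> (j <= k)%nat -> mass F j <= M * (F k / INR k)) ->
  exists C, forall k, (2 * i0 <= k)%nat ->
    increment_conv_sum F 1 k k / (F k * F k)
    <= increment_conv_sum F i0 (k - i0).+1 k / (F k * F k) + C / (INR k * F k).
Proof.
move=> hi0 hM h1 hF hm hup.
have anti : forall i n, (1 <= i)%nat -> F (i + n)%nat <= F i.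
  move=> i n hi; elim: n => [|n IH]; first by rewrite addn0; lra.
  by have := hm (i + n)%nat ltac:(lia); rewrite addnS /mass; lra.
exists (INR i0 * M + INR i0 * (INR i0 * M)) => k hk.
have hFk := hF k ltac:(lia); have hk0 : 0 < INR k by have := INR_ge1 k ltac:(lia); lra.
have hi0' := INR_ge1 i0 hi0.
have hA : 0 < F k / INR k by apply: Rdiv_lt_0_compat.
have F1b i : (1 <= i)%nat -> F i <= 1.
  by move=> hi; have := anti 1%nat (i - 1)%nat erefl; rewrite h1 subnKC.
have e1 : increment_conv_sum F 1 i0 k <= INR i0 * M * (F k / INR k).
  apply: (Rle_trans _ (nsum 1 i0 (fun=> M * (F k / INR k)))).
    apply: nsum_le => i hi.
    have u := hup (k - i)%nat k ltac:(lia) ltac:(lia) ltac:(lia).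
    have v := hm (k - i)%nat ltac:(lia); have w := F1b i ltac:(lia).
    have x : F k <= F i by have := anti i (k - i)%nat ltac:(lia); rewrite subnKC //; lia.
    by nra.
  rewrite nsum_const Rmult_assoc; apply: Rmult_le_compat_r; first by nra.
  by apply: INR_leq; lia.
have e2 : increment_conv_sum F (k - i0).+1 k k <= INR i0 * (INR i0 * M) * (F k / INR k).
  apply: (Rle_trans _ (nsum (k - i0).+1 k (fun=> INR i0 * M * (F k / INR k)))).
    apply: nsum_le => i hi.
    have v := hm (k - i)%nat ltac:(lia).
    have w : mass F (k - i)%nat <= 1.
      by have := F1b (k - i)%nat ltac:(lia); have := hF (k - i).+1 ltac:(lia); rewrite /mass; lra.
    have x : F i - F k <= INR i0 * M * (F k / INR k).
      have tel : forall n, (i + n <= k)%nat -> F i - F (i + n)%nat <= INR n * (M * (F k / INR k)).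
        elim=> [|n IH] hn; first by rewrite addn0 /=; lra.
        have := IH ltac:(lia); have := hup (i + n)%nat k ltac:(lia) ltac:(lia) ltac:(lia).
        by rewrite addnS S_INR /mass; lra.
      have := tel (k - i)%nat ltac:(lia); rewrite subnKC; last by lia.
      move=> h; apply: Rle_trans h _; rewrite Rmult_assoc; apply: Rmult_le_compat_r; first by nra.
      by apply: INR_leq; lia.
    have y : 0 <= F i - F k by have := anti i (k - i)%nat ltac:(lia); rewrite subnKC; [lra | lia].
    by nra.
  rewrite nsum_const [INR i0 * (INR i0 * M) * _]Rmult_assoc; apply: Rmult_le_compat_r.
    by apply: Rmult_le_pos; [nra | lra].
  by apply: INR_leq; lia.
have -> : increment_conv_sum F 1 k k = increment_conv_sum F 1 i0 k
   + increment_conv_sum F i0 (k - i0).+1 k + increment_conv_sum F (k - i0).+1 k k.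
  rewrite /increment_conv_sum (@nsum_split 1 i0 k); last by lia.
  by rewrite (@nsum_split i0 (k - i0).+1 k); [lra | lia].
have hFF : 0 < F k * F k by nra.
apply: (Rmult_le_reg_r _ _ _ hFF).
rewrite Rmult_plus_distr_r /Rdiv !Rmult_assoc !Rinv_l; try lra.
have -> : (INR i0 * M + INR i0 * (INR i0 * M)) * (/ (INR k * F k) * (F k * F k))
   = INR i0 * M * (F k / INR k) + INR i0 * (INR i0 * M) * (F k / INR k) by field; lra.
lra.
Qed.

(** * The products of [1 - b / j]: convolution, duplication and shift *)

Section BinomialProduct.

(** For [b < 1] this is [Gamma (n + 1 - b) / (Gamma (1 - b) * n!)], asymptotic to
    [n^(-b) / Gamma (1 - b)]. *)
Fixpoint bprod (b : R) (n : nat) : R :=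
  match n with O => 1 | S m => bprod b m * (1 - b / INR n) end.

Lemma bprodS b n : bprod b n.+1 = bprod b n * (1 - b / INR n.+1).
Proof. by []. Qed.

Lemma bprod_pos b n : b < 1 -> 0 < bprod b n.
Proof.
move=> hb; elim: n => [|n IH]; first by rewrite /=; lra.
rewrite bprodS; apply: Rmult_lt_0_compat => //.
have h := INR_ge1 n.+1 erefl.
have : b / INR n.+1 < 1; last by lra.
by apply: (Rmult_lt_reg_r (INR n.+1)); [lra | rewrite /Rdiv Rmult_assoc Rinv_l; lra].
Qed.

(* Coefficients of (1 - z)^(b - 1) against those of 1 - (1 - z)^b. *)
Lemma bprod_conv b k : (1 <= k)%nat ->
  nsum 1 k (fun i => bprod b i.-1 * (bprod b (k - i).-1 * (b / INR (k - i))))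
  = bprod b k.-1 - bprod (2 * b) k.-1.
Proof.
pose u j := bprod b j.-1 * (b / INR j).
change ((1 <= k)%nat -> nsum 1 k (fun i => bprod b i.-1 * u (k - i)%nat) = bprod b k.-1 - bprod (2 * b) k.-1).
elim: k => [//|k IH] _; case: (posnP k) => [->|hk].
  by rewrite nsum_geq //=; lra.
have {}IH := IH hk.
have hk0 : 0 < INR k by have := INR_ge1 k hk; lra.
have usucc j : (1 <= j)%nat -> INR j.+1 * u j.+1 = (INR j - b) * u j.
  case: j => // j _; rewrite /u -!pred_Sn bprodS; have := INR_ge1 j.+1 erefl => h.
  by rewrite (S_INR j.+1); field; lra.
have bsucc j : (1 <= j)%nat -> INR j * bprod b j = (INR j - b) * bprod b j.-1.
  case: j => // j _; rewrite bprodS -pred_Sn; have := INR_ge1 j.+1 erefl => h.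
  by field; lra.
(* Splitting [k] as [(i - 1) + (k + 1 - i)] and using the first-order recursions of both sequences
   is the coefficient form of differentiating the product of the generating functions. *)
suff key : INR k * nsum 1 k.+1 (fun i => bprod b i.-1 * u (k.+1 - i)%nat)
    = b * bprod b k.-1 + (INR k - 2 * b) * nsum 1 k (fun i => bprod b i.-1 * u (k - i)%nat).
  apply: (Rmult_eq_reg_l (INR k)); last by lra.
  rewrite key IH -pred_Sn [RHS]Rmult_minus_distr_l bsucc //.
  have -> : INR k * bprod (2 * b) k = (INR k - 2 * b) * bprod (2 * b) k.-1.
    by case: (k) hk0 => [|j] h; [rewrite /= in h; lra | rewrite bprodS -pred_Sn; field; lra].
  ring.
have split : INR k * nsum 1 k.+1 (fun i => bprod b i.-1 * u (k.+1 - i)%nat) =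
   nsum 1 k.+1 (fun i => INR i.-1 * bprod b i.-1 * u (k.+1 - i)%nat)
   + nsum 1 k.+1 (fun i => bprod b i.-1 * (INR (k.+1 - i) * u (k.+1 - i)%nat)).
  rewrite -nsum_scal -nsum_plus; apply: nsum_ext => i hi.
  have -> : INR k = INR i.-1 + INR (k.+1 - i) by rewrite -INR_addn; congr INR; lia.
  ring.
rewrite split nsum_recl // [INR _]/= !Rmult_0_l Rplus_0_l nsum_shift.
rewrite [X in _ + X]nsum_recr // subSnn.
rewrite (nsum_ext 1 k _ (fun i => (INR i - b) * (bprod b i.-1 * u (k - i)%nat))); last first.
  by move=> i hi; rewrite subSS -pred_Sn bsucc; [ring | lia].
rewrite [X in _ + (X + _)](nsum_ext 1 k _ (fun i => (INR (k - i) - b) * (bprod b i.-1 * u (k - i)%nat)) ); last first.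
  move=> i hi; rewrite subSn; last by lia.
  by rewrite usucc; [ring | lia].
rewrite -Rplus_assoc -nsum_plus Rplus_comm; congr (_ + _); first by rewrite /u /=; field.
rewrite -nsum_scal; apply: nsum_ext => i hi; rewrite INR_subn; [ring | lia].
Qed.

(** Finite form of Legendre's duplication formula: consecutive odd and even factors of the left
    product give the parameters [b + / 2] and [b]. *)
Lemma bprod_split b m :
  bprod (2 * b) (2 * m) * bprod (/ 2) m = bprod b m * bprod (b + / 2) m.
Proof.
elim: m => [|m IH]; first by rewrite muln0 /=; lra.
rewrite (_ : 2 * m.+1 = (2 * m).+2)%nat; last by lia.
have h1 : INR (2 * m).+1 = 2 * INR m + 1 by rewrite S_INR INR_muln.
have h2 : INR (2 * m).+2 = 2 * INR m + 2 by rewrite S_INR h1; lra.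
have h3 := pos_INR m.
rewrite !bprodS h2 h1 S_INR.
have -> : bprod (2 * b) (2 * m) * (1 - 2 * b / (2 * INR m + 1)) * (1 - 2 * b / (2 * INR m + 2)) *
   (bprod (/ 2) m * (1 - / 2 / (INR m + 1))) =
  (bprod (2 * b) (2 * m) * bprod (/ 2) m) * ((1 - 2 * b / (2 * INR m + 1)) *
   (1 - 2 * b / (2 * INR m + 2)) * (1 - / 2 / (INR m + 1))) by ring.
rewrite IH; field; lra.
Qed.

(** The quotient of the two products telescopes. This brings a parameter in [(1, 2)] back to
    [(0, 1)], the range of [gauss_limit]. *)
Lemma bprod_shift b n : 1 < b < 2 -> bprod b n = (1 - b) / (INR n + 1 - b) * bprod (b - 1) n.
Proof.
move=> hb; elim: n => [|n IH]; first by rewrite /=; field; lra.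
rewrite !bprodS IH S_INR.
have h3 := pos_INR n.
have h5 : INR n + 1 - b <> 0.
  by case: (n) => [|j]; [rewrite /=; lra | have := INR_ge1 j.+1 erefl; lra].
by field; lra.
Qed.

End BinomialProduct.

(** * Gamma integrals and the Gauss product *)

Notation is_RInt_pos f l := (is_RInt_gen f (at_right 0) (Rbar_locally p_infty) l).

Lemma filter_prod_pos_infty (P : R * R -> Prop) a0 b0 : 0 < a0 ->
  (forall a b, 0 < a < a0 -> b0 < b -> P (a, b)) ->
  filter_prod (at_right 0) (Rbar_locally p_infty) P.
Proof.
move=> h0 h; apply: (Filter_prod _ _ _ (fun a => 0 < a < a0) (fun b => b0 < b)).
- exists (mkposreal a0 h0) => y /= hy hy0; split => //.
  move: hy; rewrite /ball /= /AbsRing_ball /abs /minus /plus /opp /= => hy.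
  by have := Rle_abs (y + - 0); lra.
- by exists b0.
- by move=> a b ha hb; apply: h.
Qed.

Lemma filter_prod_pos_infty_inv (P : R * R -> Prop) :
  filter_prod (at_right 0) (Rbar_locally p_infty) P ->
  exists a0 b0, 0 < a0 /\ forall a b, 0 < a < a0 -> b0 < b -> P (a, b).
Proof.
case=> Q S [eps hQ] [b0 hS] h; exists eps, b0; split; first exact: cond_pos.
move=> a b ha hb; apply: h; last exact: hS.
apply: hQ; last by lra.
rewrite /ball /= /AbsRing_ball /abs /minus /plus /opp /=.
by rewrite Rabs_pos_eq; lra.
Qed.

Lemma is_RInt_pos_plus (f g : R -> R) lf lg :
  is_RInt_pos f lf -> is_RInt_pos g lg -> is_RInt_pos (fun t => f t + g t) (lf + lg).
Proof. exact: is_RInt_gen_plus. Qed.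

Lemma is_RInt_pos_minus (f g : R -> R) lf lg :
  is_RInt_pos f lf -> is_RInt_pos g lg -> is_RInt_pos (fun t => f t - g t) (lf - lg).
Proof. exact: is_RInt_gen_minus. Qed.

Lemma is_RInt_pos_scal (f : R -> R) c lf :
  is_RInt_pos f lf -> is_RInt_pos (fun t => c * f t) (c * lf).
Proof. exact: is_RInt_gen_scal. Qed.

Lemma is_RInt_pos_le (f g : R -> R) lf lg : (forall t, 0 < t -> f t <= g t) ->
  is_RInt_pos f lf -> is_RInt_pos g lg -> lf <= lg.
Proof.
move=> h hf hg.
have hm := is_RInt_pos_minus _ _ _ _ hg hf.
have h0 := is_RInt_pos_scal _ 0 _ hg.
suff : norm (0 * lg) <= lg - lf by rewrite /norm /= /abs /= Rmult_0_l Rabs_R0; lra.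
apply: (RInt_gen_norm _ _ _ _ _ _ h0 hm); apply: (@filter_prod_pos_infty _ 1 1); try lra.
  by move=> a b ha hb /=; lra.
move=> a b ha hb x /= hx; rewrite /norm /= /abs /= Rmult_0_l Rabs_R0.
by have := h x ltac:(lra); lra.
Qed.

Lemma is_RInt_pos_ext (f g : R -> R) l : (forall t, 0 < t -> f t = g t) ->
  is_RInt_pos f l -> is_RInt_pos g l.
Proof.
move=> h; apply: is_RInt_gen_ext.
apply: (@filter_prod_pos_infty _ 1 1); first by lra.
move=> a b ha hb x /=; rewrite Rmin_left; last by lra.
by move=> hx; apply: h; lra.
Qed.

(** For nonnegative [f] the integral over [[a, b]] increases as the interval grows, so it converges
    to its supremum over admissible intervals. The bound [lg + 1] holds once the integral of [g] is
    within 1 of its limit. *)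
Lemma ex_RInt_pos_dominated (f g : R -> R) lg :
  (forall t, 0 < t -> 0 <= f t <= g t) -> (forall t, 0 < t -> continuous f t) ->
  is_RInt_pos g lg -> exists l, is_RInt_pos f l.
Proof.
move=> hfg hc hg.
have exf a b : 0 < a <= b -> ex_RInt f a b.
  move=> hab; apply: ex_RInt_continuous => z; rewrite Rmin_left ?Rmax_right; try lra.
  by move=> hz; apply: hc; lra.
have [a0 [b0 [ha0 hab]]] := filter_prod_pos_infty_inv _ (hg _ (locally_ball lg (mkposreal 1 Rlt_0_1))).
have bnd a b : 0 < a < Rmin a0 1 -> Rmax b0 1 < b -> RInt f a b <= lg + 1.
  move=> ha hb; have h1 := Rmin_l a0 1; have h2 := Rmin_r a0 1.
  have h3 := Rmax_l b0 1; have h4 := Rmax_r b0 1.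
  have [y [hy hy2]] := hab a b ltac:(lra) ltac:(lra).
  apply: (Rle_trans _ y).
    apply: (is_RInt_le f g a b) => //; [lra | exact: (RInt_correct _ _ _ (exf a b ltac:(lra))) |].
    by move=> x hx; have := hfg x ltac:(lra); lra.
  move: hy2; rewrite /ball /= /AbsRing_ball /abs /minus /plus /opp /= => hy2.
  by have := Rle_abs (y + - lg); lra.
have hmin : 0 < Rmin a0 1 by apply: Rmin_glb_lt; lra.
set E := fun x => exists a b, 0 < a < Rmin a0 1 /\ Rmax b0 1 < b /\ x = RInt f a b.
have [L [hL1 hL2]] : {L | is_lub E L}.
  apply: completeness; first by exists (lg + 1) => x [a [b [ha [hb ->]]]]; apply: bnd.
  by exists (RInt f (Rmin a0 1 / 2) (Rmax b0 1 + 1)), (Rmin a0 1 / 2), (Rmax b0 1 + 1); split; [lra | split; [lra|]].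
exists L => P [eps hP].
have [a1 [b1 [ha1 [hb1 hgt]]]] : exists a b, 0 < a < Rmin a0 1 /\ Rmax b0 1 < b /\ L - eps < RInt f a b.
  apply: Classical_Prop.NNPP => hn.
  have : L <= L - eps.
    apply: hL2 => x [a [b [ha [hb ->]]]].
    apply: Rnot_lt_le => hlt; apply: hn; by exists a, b.
  by have := cond_pos eps; lra.
apply: (@filter_prod_pos_infty _ a1 b1); first by lra.
move=> a b ha hb /=; exists (RInt f a b).
have h2 := Rmin_r a0 1; have h4 := Rmax_r b0 1.
split; first by apply: RInt_correct; apply: exf; lra.
apply: hP; rewrite /ball /= /AbsRing_ball /abs /minus /plus /opp /=.
have hup : RInt f a b <= L by apply: hL1; exists a, b; split; [lra | split; [lra|]].
have c1 := RInt_Chasles f a a1 b (exf a a1 ltac:(lra)) (exf a1 b ltac:(lra)).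
have c2 := RInt_Chasles f a1 b1 b (exf a1 b1 ltac:(lra)) (exf b1 b ltac:(lra)).
rewrite /plus /= in c1 c2.
have p1 : 0 <= RInt f a a1.
  by apply: RInt_ge_0; [lra | apply: exf; lra | move=> x hx; have := hfg x ltac:(lra); lra].
have p2 : 0 <= RInt f b1 b.
  by apply: RInt_ge_0; [lra | apply: exf; lra | move=> x hx; have := hfg x ltac:(lra); lra].
by have he := cond_pos eps; apply: Rabs_def1; lra.
Qed.

Section GammaIntegral.

Definition gamma_density (s t : R) : R := Rpower t (s - 1) * exp (- t).
Notation is_gamma s l := (is_RInt_pos (gamma_density s) l).

Lemma Rpower_exp_lim_0 s : 0 < s -> filterlim (fun t => Rpower t s * exp (- t)) (at_right 0) (locally 0).
Proof.
move=> hs; apply/filterlim_locally => eps; have he := cond_pos eps.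
exists (mkposreal (exp (ln eps / s)) (exp_pos _)) => t /= ht ht0.
move: ht; rewrite /ball /= /AbsRing_ball /abs /minus /plus /opp /= Ropp_0 Rplus_0_r => ht.
have h1 : t < exp (ln eps / s) by have := Rle_abs t; lra.
have hP := Rpower_pos t s.
have hE : exp (- t) <= 1 by rewrite -exp_0; apply/Rlt_le/exp_increasing; lra.
have hE0 := exp_pos (- t).
rewrite Rabs_pos_eq; last by nra.
have : Rpower t s < eps; last by nra.
rewrite -(exp_ln eps) // /Rpower; apply: exp_increasing.
have := ln_increasing _ _ ht0 h1; rewrite ln_exp => h2.
have := Rmult_lt_compat_l s _ _ hs h2.
by have -> : s * (ln eps / s) = ln eps by field; lra.
Qed.

Lemma Rpower_exp_lim_infty s : 0 < s ->
  filterlim (fun t => Rpower t s * exp (- t)) (Rbar_locally p_infty) (locally 0).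
Proof.
move=> hs; apply/filterlim_locally => eps; have he := cond_pos eps.
(* With this [C], [ln u <= u - 1] at [u = t / (2 * s)] gives [s * ln t <= t / 2 - s + C], so half of
   the exponential decay remains. *)
set C := s * ln (2 * s).
exists (Rmax 1 (2 * (C - ln eps))) => t ht.
have h1 := Rmax_l 1 (2 * (C - ln eps)); have h2 := Rmax_r 1 (2 * (C - ln eps)).
rewrite /ball /= /AbsRing_ball /abs /minus /plus /opp /= Ropp_0 Rplus_0_r.
have hP := Rpower_pos t s; have hE0 := exp_pos (- t).
rewrite Rabs_pos_eq; last by nra.
rewrite /Rpower -exp_plus -(exp_ln eps) //; apply: exp_increasing.
have hl := ln_le_sub1 (t / (2 * s)) ltac:(apply: Rdiv_lt_0_compat; lra).
rewrite ln_div in hl; try lra.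
have := Rmult_le_compat_l s _ _ (Rlt_le _ _ hs) hl.
have -> : s * (t / (2 * s) - 1) = t / 2 - s by field; lra.
rewrite Rmult_minus_distr_l -/C; lra.
Qed.

Lemma gamma_density_deriv s t : 0 < t ->
  is_derive (fun t => Rpower t s * exp (- t)) t (s * gamma_density s t - gamma_density (s + 1) t).
Proof.
move=> ht; rewrite /gamma_density.
have -> : Rpower t (s - 1) = Rpower t s / t.
  by rewrite /Rminus Rpower_plus Rpower_Ropp Rpower_1.
rewrite (_ : s + 1 - 1 = s); last by ring.
rewrite /Rpower; auto_derive; first by [].
by field; lra.
Qed.

Lemma gamma_density_continuous s t : 0 < t -> continuous (gamma_density s) t.
Proof.
move=> ht; apply: ex_derive_continuous; rewrite /gamma_density /Rpower.
by auto_derive.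
Qed.

Lemma is_RInt_pos_derive (F f : R -> R) la lb :
  (forall t, 0 < t -> is_derive F t (f t)) -> (forall t, 0 < t -> continuous f t) ->
  filterlim F (at_right 0) (locally la) -> filterlim F (Rbar_locally p_infty) (locally lb) ->
  is_RInt_pos f (lb - la).
Proof.
move=> hd hc ha hb.
have hD t : 0 < t -> Derive F t = f t by move=> ht; apply: is_derive_unique; apply: hd.
apply: (@is_RInt_pos_ext (Derive F)) => //.
apply: is_RInt_gen_Derive => //.
- apply: (@filter_prod_pos_infty _ 1 1); first by lra.
  move=> a b h1 h2 x /=; rewrite Rmin_left; last by lra.
  by move=> hx; exists (f x); apply: hd; lra.
- apply: (@filter_prod_pos_infty _ 1 1); first by lra.
  move=> a b h1 h2 x /=; rewrite Rmin_left; last by lra.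
  move=> hx; apply: (continuous_ext_loc _ f); last by apply: hc; lra.
  exists (mkposreal a (proj1 h1)) => y /= hy; rewrite hD //.
  move: hy; rewrite /ball /= /AbsRing_ball /abs /minus /plus /opp /= => hy.
  by have := Rle_abs (- (y + - x)); rewrite Rabs_Ropp; lra.
Qed.

(** The integrand is the derivative of [t^s * exp (- t)], which vanishes at both ends. *)
Lemma is_gamma_parts s : 0 < s ->
  is_RInt_pos (fun t => s * gamma_density s t - gamma_density (s + 1) t) 0.
Proof.
move=> hs; rewrite -[X in is_RInt_gen _ _ _ X](Rminus_0_r 0).
apply: (is_RInt_pos_derive (fun t => Rpower t s * exp (- t))).
- by move=> t; apply: gamma_density_deriv.
- move=> t ht; apply: (continuous_minus (fun t => s * gamma_density s t)).
    by apply: (continuous_scal_r s); apply: gamma_density_continuous.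
  exact: gamma_density_continuous.
- exact: Rpower_exp_lim_0.
- exact: Rpower_exp_lim_infty.
Qed.

Lemma is_gamma_succ s l : 0 < s -> is_gamma s l -> is_gamma (s + 1) (s * l).
Proof.
move=> hs hl; have h1 := is_RInt_pos_scal _ s _ hl; have h2 := is_gamma_parts s hs.
have h3 := is_RInt_pos_minus _ _ _ _ h1 h2.
rewrite -(Rplus_0_r (s * l)) -{2}Ropp_0; apply: is_RInt_pos_ext h3 => t _; ring.
Qed.

Lemma is_gamma_pred s l : 0 < s -> is_gamma (s + 1) l -> is_gamma s (l / s).
Proof.
move=> hs hl; have h2 := is_gamma_parts s hs.
have h3 := is_RInt_pos_scal _ (/ s) _ (is_RInt_pos_plus _ _ _ _ hl h2).
rewrite (_ : l / s = / s * (l + 0)); last by field; lra.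
by apply: is_RInt_pos_ext h3 => t _; field; lra.
Qed.

Lemma is_gamma_1 : is_gamma 1 1.
Proof.
rewrite -[X in is_RInt_gen _ _ _ X](_ : 0 - -1 = 1); last by ring.
apply: (is_RInt_pos_ext (fun t => exp (- t))).
  by move=> t ht; rewrite /gamma_density Rminus_diag Rpower_O // Rmult_1_l.
apply: (is_RInt_pos_derive (fun t => - exp (- t))).
- by move=> t ht; auto_derive => //; ring.
- by move=> t _; apply: ex_derive_continuous; auto_derive.
- apply: (filterlim_filter_le_1 (F := locally 0)); first exact: filter_le_within.
  have : continuous (fun t => - exp (- t)) 0 by apply: ex_derive_continuous; auto_derive.
  by rewrite /continuous Ropp_0 exp_0.
- apply/filterlim_locally => eps; have he := cond_pos eps.
  exists (- ln eps) => t ht.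
  rewrite /ball /= /AbsRing_ball /abs /minus /plus /opp /= Ropp_0 Rplus_0_r Rabs_Ropp.
  rewrite Rabs_pos_eq; last by apply/Rlt_le/exp_pos.
  by rewrite -(exp_ln eps) //; apply: exp_increasing; lra.
Qed.

Lemma is_gamma_fact n : is_gamma (INR n + 1) (INR (fact n)).
Proof.
elim: n => [|n IH]; first by rewrite /= Rplus_0_l; exact: is_gamma_1.
rewrite S_INR; have := is_gamma_succ _ _ _ IH.
by rewrite fact_simpl mult_INR S_INR; apply; have := pos_INR n; lra.
Qed.

(** Convergence is proved at [x + 1], where [t^x <= 1 - x + x * t] dominates without a singularity
    at 0, and transferred to [x] by integration by parts. *)
Lemma ex_gamma x : 0 < x < 1 -> exists l : R, is_gamma x l.
Proof.
move=> hx.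
have g2 : is_gamma (1 + 1) 1 by have := is_gamma_succ 1 1 ltac:(lra) is_gamma_1; rewrite Rmult_1_l.
have h := is_RInt_pos_plus _ _ _ _ (is_RInt_pos_scal _ (1 - x) _ is_gamma_1) (is_RInt_pos_scal _ x _ g2).
have [l hl] : exists l, is_gamma (x + 1) l.
  apply: (ex_RInt_pos_dominated _ _ _ _ _ h); last by move=> t; apply: gamma_density_continuous.
  move=> t ht; rewrite /gamma_density.
  rewrite Rminus_diag Rpower_O // (_ : 1 + 1 - 1 = 1); last by ring.
  rewrite (_ : x + 1 - 1 = x) ?Rpower_1 //; last by ring.
  have hE := exp_pos (- t); have hP := Rpower_pos t x.
  have := Rpower_le_affine t x ht ltac:(lra); nra.
by exists (l / x); apply: is_gamma_pred => //; lra.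
Qed.

(** [bprod (1 - x) m * m!] is the rising factorial [x * (x + 1) * ... * (x + m - 1)]. *)
Lemma is_gamma_shift x (l : R) m : 0 < x -> is_gamma x l ->
  is_gamma (INR m + x) (l * bprod (1 - x) m * INR (fact m)).
Proof.
move=> hx hl; elim: m => [|m IH]; first by rewrite /= Rplus_0_l !Rmult_1_r.
have hm := pos_INR m.
rewrite S_INR (_ : INR m + 1 + x = INR m + x + 1); last by ring.
have := is_gamma_succ (INR m + x) _ ltac:(lra) IH.
rewrite fact_simpl mult_INR bprodS S_INR.
have -> : l * (bprod (1 - x) m * (1 - (1 - x) / (INR m + 1))) * ((INR m + 1) * INR (fact m))
  = (INR m + x) * (l * bprod (1 - x) m * INR (fact m)) by field; lra.
by [].
Qed.

(* Tangent-line bounds for t^x and t^(x-1) at t = m squeeze Gamma(m + x) between multiples of m!. *)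
Lemma gauss_bounds x (l : R) m : 0 < x < 1 -> is_gamma x l -> (1 <= m)%nat ->
  1 - (1 - x) / INR m <= l * (bprod (1 - x) m * Rpower (INR m) (1 - x)) <= 1.
Proof.
move=> hx hl; case: m => [//|n] _.
set M := INR n.+1; have hM : 1 <= M by apply: INR_ge1.
have hs := is_gamma_shift x l n.+1 ltac:(lra) hl; rewrite -/M in hs.
have g0 : is_gamma M (INR (fact n)) by have := is_gamma_fact n; rewrite -S_INR.
have g1 := is_gamma_succ M _ ltac:(lra) g0.
have g2 := is_gamma_succ (M + 1) _ ltac:(lra) g1.
have hf : INR (fact n.+1) = M * INR (fact n) by rewrite fact_simpl mult_INR.
have hf0 : 0 < INR (fact n) by apply: INR_fact_lt_0.
rewrite hf in hs.
have hPx := Rpower_pos M x.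
have e1 : Rpower M (1 - x) = M / Rpower M x.
  by rewrite /Rminus Rpower_plus Rpower_Ropp Rpower_1 //; lra.
have pM t : 0 < t -> Rpower t M = t * Rpower t (M - 1).
  by move=> ht; rewrite -{2}(Rpower_1 t) // -Rpower_plus; congr Rpower; ring.
split.
(* Integrated against [t^M * exp (- t)], the tangent [M^(x - 1) * (2 - x - (1 - x) * t / M)] yields
   a combination of [M!] and [(M + 1)!]. *)
- have hlow := is_RInt_pos_plus _ _ _ _ (is_RInt_pos_scal _ (Rpower M x / M * (2 - x)) _ g1)
      (is_RInt_pos_scal _ (- (Rpower M x / M * ((1 - x) / M))) _ g2).
  have := is_RInt_pos_le _ _ _ _ _ hlow hs.
  move=> H.
  have {}H : Rpower M x / M * (2 - x) * (M * INR (fact n)) +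
    - (Rpower M x / M * ((1 - x) / M)) * ((M + 1) * (M * INR (fact n))) <=
    l * bprod (1 - x) n.+1 * (M * INR (fact n)).
    apply: H => t ht; rewrite /gamma_density.
    rewrite (_ : M + 1 - 1 = M); last by ring.
    rewrite (_ : M + 1 + 1 - 1 = M + 1); last by ring.
    rewrite (_ : M + x - 1 = M + (x - 1)); last by ring.
    rewrite (Rpower_plus M 1) (Rpower_plus M (x - 1)) Rpower_1 //.
    have hE := exp_pos (- t); have hP := Rpower_pos t M.
    have ht2 : Rpower M x / M * (1 + (x - 1) * (t / M - 1)) <= Rpower t (x - 1).
      have -> : Rpower t (x - 1) = Rpower M x / M * Rpower (t / M) (x - 1).
        have -> : Rpower M x / M = Rpower M (x - 1).
          by rewrite /Rminus Rpower_plus Rpower_Ropp Rpower_1 //; lra.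
        rewrite Rpower_mult_distr; [| lra | by apply: Rdiv_lt_0_compat; lra].
        by congr Rpower; field; lra.
      apply: Rmult_le_compat_l; first by apply/Rlt_le/Rdiv_lt_0_compat; lra.
      have htM : 0 < t / M by apply: Rdiv_lt_0_compat; lra.
      apply: Rle_trans (exp_ineq1_le _).
      have := ln_le_sub1 _ htM; nra.
    have := Rmult_le_compat_r (Rpower t M * exp (- t)) _ _ ltac:(nra) ht2.
    have -> : Rpower M x / M * (1 + (x - 1) * (t / M - 1)) * (Rpower t M * exp (- t)) =
      Rpower M x / M * (2 - x) * (Rpower t M * exp (- t)) +
      - (Rpower M x / M * ((1 - x) / M)) * (Rpower t M * t * exp (- t)) by field; lra.
    lra.
  have hk : 0 < M / (Rpower M x * (M * INR (fact n))).
    by apply: Rdiv_lt_0_compat; [lra | apply: Rmult_lt_0_compat; nra].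
  have := Rmult_le_compat_r _ _ _ (Rlt_le _ _ hk) H.
  rewrite e1.
  have -> : l * bprod (1 - x) n.+1 * (M * INR (fact n)) * (M / (Rpower M x * (M * INR (fact n)))) =
    l * (bprod (1 - x) n.+1 * (M / Rpower M x)) by field; lra.
  suff -> : (Rpower M x / M * (2 - x) * (M * INR (fact n)) +
    - (Rpower M x / M * ((1 - x) / M)) * ((M + 1) * (M * INR (fact n)))) *
    (M / (Rpower M x * (M * INR (fact n)))) = 1 - (1 - x) / M by [].
  by field; lra.
- have hup := is_RInt_pos_plus _ _ _ _ (is_RInt_pos_scal _ (Rpower M x * (1 - x)) _ g0)
      (is_RInt_pos_scal _ (Rpower M x * (x / M)) _ g1).
  have := is_RInt_pos_le _ _ _ _ _ hs hup.
  move=> H.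
  have {}H : l * bprod (1 - x) n.+1 * (M * INR (fact n)) <=
    Rpower M x * (1 - x) * INR (fact n) + Rpower M x * (x / M) * (M * INR (fact n)).
    apply: H => t ht; rewrite /gamma_density.
    rewrite (_ : M + 1 - 1 = M); last by ring.
    rewrite (_ : M + x - 1 = (M - 1) + x); last by ring.
    rewrite Rpower_plus pM //.
    have hE := exp_pos (- t); have hP := Rpower_pos t (M - 1).
    have ht2 : Rpower t x <= Rpower M x * (1 + x * (t / M - 1)).
      have htM : 0 < t / M by apply: Rdiv_lt_0_compat; lra.
      have -> : Rpower t x = Rpower M x * Rpower (t / M) x.
        rewrite Rpower_mult_distr //; last by lra.
        by congr Rpower; field; lra.
      by apply: Rmult_le_compat_l; [lra | apply: Rpower_le_affine; lra].
    have := Rmult_le_compat_r (Rpower t (M - 1) * exp (- t)) _ _ ltac:(nra) ht2.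
    have -> : Rpower M x * (1 + x * (t / M - 1)) * (Rpower t (M - 1) * exp (- t)) =
      Rpower M x * (1 - x) * (Rpower t (M - 1) * exp (- t)) +
      Rpower M x * (x / M) * (t * Rpower t (M - 1) * exp (- t)) by field; lra.
    lra.
  have hk : 0 < / (Rpower M x * INR (fact n)) by apply/Rinv_0_lt_compat; nra.
  have := Rmult_le_compat_r _ _ _ (Rlt_le _ _ hk) H.
  rewrite e1.
  have -> : l * bprod (1 - x) n.+1 * (M * INR (fact n)) * / (Rpower M x * INR (fact n)) =
    l * (bprod (1 - x) n.+1 * (M / Rpower M x)) by field; lra.
  suff -> : (Rpower M x * (1 - x) * INR (fact n) + Rpower M x * (x / M) * (M * INR (fact n))) *
    / (Rpower M x * INR (fact n)) = 1 by [].
  by field; lra.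
Qed.

Lemma Gamma_pos_eq x (l : R) : is_gamma x l -> Gamma_pos x = l.
Proof.
move=> h; rewrite /Gamma_pos.
apply (is_RInt_gen_unique (V := R_CompleteNormedModule) (fun t => Rpower t (x - 1) * exp (- t)) l).
exact h.
Qed.

Lemma gauss_limit b : 0 < b < 1 -> 0 < Gamma_pos (1 - b) /\
  is_lim_seq (fun m => bprod b m * Rpower (INR m) b) (/ Gamma_pos (1 - b)).
Proof.
move=> hb; have [l hl] := ex_gamma (1 - b) ltac:(lra).
rewrite (Gamma_pos_eq _ _ hl).
have hg m : (1 <= m)%nat -> 1 - b / INR m <= l * (bprod b m * Rpower (INR m) b) <= 1.
  by move=> hm; have := gauss_bounds (1 - b) l m ltac:(lra) hl hm; rewrite (_ : 1 - (1 - b) = b) //; ring.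
(* The lower bound at [m = 1] reads [1 - b], which is positive. *)
have hl0 : 0 < l.
  have [h1 _] := hg 1%nat erefl; rewrite /= Rdiv_1_r in h1.
  have hP : 0 < bprod b 1 * Rpower 1 b by apply: Rmult_lt_0_compat; [apply: bprod_pos; lra | exact: Rpower_pos].
  rewrite /= Rdiv_1_r in hP; nra.
split => //.
apply: (is_lim_seq_ext_loc (fun m => / l * (l * (bprod b m * Rpower (INR m) b)))).
  by exists 0%nat => m _; field; lra.
rewrite -[X in is_lim_seq _ (Finite X)](Rmult_1_r (/ l)).
apply: is_lim_seq_mult'; first exact: is_lim_seq_const.
apply: (is_lim_seq_le_le_loc (fun m => 1 - b / INR m) _ (fun=> 1)).
- by exists 1%nat => m hm; apply: hg; lia.
- rewrite -[X in is_lim_seq _ (Finite X)](_ : 1 - b * 0 = 1); last by ring.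
  apply: is_lim_seq_minus'; first exact: is_lim_seq_const.
  apply: is_lim_seq_mult'; first exact: is_lim_seq_const.
  apply: (is_lim_seq_inv _ p_infty) => //; exact: is_lim_seq_INR.
- exact: is_lim_seq_const.
Qed.

End GammaIntegral.

(** * Wallis' product *)

Definition sin_int (n : nat) : R := RInt (fun t => sin t ^ n) 0 (PI / 2).

Lemma ex_RInt_sin_pow n a b : ex_RInt (fun t => sin t ^ n) a b.
Proof.
apply: ex_RInt_continuous => z _; apply: ex_derive_continuous; auto_derive => //.
Qed.

(** Integrate the derivative of [- cos t * sin t ^ n.+1], whose boundary values vanish. *)
Lemma sin_int_rec n : INR n.+2 * sin_int n.+2 = INR n.+1 * sin_int n.
Proof.
have h : is_RInt (fun t => INR n.+2 * sin t ^ n.+2 - INR n.+1 * sin t ^ n) 0 (PI / 2)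
   (- cos (PI / 2) * sin (PI / 2) ^ n.+1 - - cos 0 * sin 0 ^ n.+1).
  apply: (is_RInt_derive (fun t => - cos t * sin t ^ n.+1)).
    move=> t _; auto_derive; first by [].
    rewrite (S_INR n.+1); change (match n with 0%N => 1 | _.+1 => INR n + 1 end) with (INR n.+1).
    change (sin t ^ n.+2) with (sin t * (sin t * sin t ^ n)); set N := INR n.+1.
    have := sin2_cos2 t; rewrite /Rsqr => h.
    have hc : cos t * cos t = 1 - sin t * sin t by lra.
    transitivity (sin t * (sin t * sin t ^ n) - N * sin t ^ n * (cos t * cos t)); first by ring.
    rewrite hc; ring.
  move=> t _; apply: ex_derive_continuous; auto_derive => //.
have h2 := is_RInt_minus _ _ _ _ _ _
  (is_RInt_scal _ _ _ (INR n.+2) _ (RInt_correct _ _ _ (ex_RInt_sin_pow n.+2 0 (PI / 2))))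
  (is_RInt_scal _ _ _ (INR n.+1) _ (RInt_correct _ _ _ (ex_RInt_sin_pow n 0 (PI / 2)))).
have e1 := is_RInt_unique _ _ _ _ h; have e2 := is_RInt_unique _ _ _ _ h2.
rewrite /minus /plus /opp /scal /= /mult /= -/(INR n.+1) in e1 e2.
rewrite cos_PI2 sin_0 in e1.
move: e1 e2; rewrite /Rminus => -> .
rewrite /sin_int; simpl; lra.
Qed.

Lemma sin_int_0 : sin_int 0 = PI / 2.
Proof.
rewrite /sin_int (RInt_ext _ (fun=> 1)); last by move=> x _.
by rewrite RInt_const /scal /= /mult /=; ring.
Qed.

Lemma sin_int_1 : sin_int 1 = 1.
Proof.
have h : is_RInt (fun t => sin t ^ 1) 0 (PI / 2) (- cos (PI / 2) - - cos 0).
  apply: (is_RInt_derive (fun t => - cos t)).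
    by move=> t _; auto_derive => //; ring.
  by move=> t _; apply: ex_derive_continuous; auto_derive.
rewrite /sin_int (is_RInt_unique _ _ _ _ h) cos_PI2 cos_0; ring.
Qed.

Lemma sin_int_anti n : sin_int n.+1 <= sin_int n.
Proof.
have hpi := PI_RGT_0.
apply: RInt_le; [lra | exact: ex_RInt_sin_pow | exact: ex_RInt_sin_pow |].
move=> x hx.
have hs : 0 <= sin x by apply/Rlt_le/sin_gt_0; lra.
have h1 : sin x <= 1 by have := SIN_bound x; lra.
have := pow_le _ n hs; rewrite /=; nra.
Qed.

(** [bprod (/ 2) m] is the quotient of double factorials accumulated by [sin_int_rec] over even
    indices. *)
Lemma sin_int_even m : sin_int (2 * m) = bprod (/ 2) m * (PI / 2).
Proof.
elim: m => [|m IH]; first by rewrite muln0 sin_int_0 /=; ring.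
rewrite (_ : 2 * m.+1 = (2 * m).+2)%nat; last by lia.
have h := sin_int_rec (2 * m); rewrite IH !S_INR INR_muln [INR 2]/= in h.
have h3 := pos_INR m.
rewrite bprodS S_INR; apply: (Rmult_eq_reg_l (2 * INR m + 1 + 1)); last by lra.
by rewrite h; field; lra.
Qed.

Lemma sin_int_odd m : sin_int (2 * m).+1 * ((2 * INR m + 1) * bprod (/ 2) m) = 1.
Proof.
elim: m => [|m IH]; first by rewrite muln0 sin_int_1 /=; ring.
rewrite (_ : 2 * m.+1 = (2 * m).+2)%nat; last by lia.
have h := sin_int_rec (2 * m).+1; rewrite !S_INR INR_muln [INR 2]/= in h.
have h3 := pos_INR m.
rewrite bprodS S_INR -[RHS]IH.
transitivity ((2 * INR m + 1 + 1 + 1) * sin_int (2 * m).+3 * ((2 * INR m + 1) / (2 * INR m + 2) * bprod (/ 2) m)).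
  by field; lra.
by rewrite h; field; lra.
Qed.

(** The integral of index [2 * m] lies between those of indices [2 * m + 1] and [2 * m - 1];
    inserting the explicit values squeezes [bprod (/ 2) m ^ 2 * m] towards [/ PI]. *)
Lemma wallis_limit :
  is_lim_seq (fun m => bprod (/ 2) m * Rpower (INR m) (/ 2)) (/ sqrt PI).
Proof.
have hpi := PI_RGT_0.
have hw m : 0 < bprod (/ 2) m by apply: bprod_pos; lra.
have hbd m : (1 <= m)%nat -> / PI * (1 - / 2 * / INR m) <= bprod (/ 2) m ^ 2 * INR m <= / PI.
  move=> hm; have hm1 := INR_ge1 m hm; have hwm := hw m.
  have ho := sin_int_odd m; have he := sin_int_even m.
  have h1 := sin_int_anti (2 * m).
  rewrite he in h1.
  have hinv : / PI * (1 - / 2 * / INR m) = (2 * INR m - 1) / (2 * PI * INR m) by field; lra.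
  split.
    rewrite hinv.
    have h2 : 1 <= bprod (/ 2) m ^ 2 * (PI / 2) * (2 * INR m + 1).
      rewrite -[X in X <= _]ho.
      have := Rmult_le_compat_r ((2 * INR m + 1) * bprod (/ 2) m) _ _ ltac:(nra) h1.
      by rewrite /=; lra.
    apply: (Rmult_le_reg_r (2 * PI * INR m)); first by nra.
    rewrite /Rdiv Rmult_assoc Rinv_l; last by nra.
    rewrite Rmult_1_r.
    have h4 : 2 * INR m / (2 * INR m + 1) <= bprod (/ 2) m ^ 2 * PI * INR m.
      apply: (Rmult_le_reg_r (2 * INR m + 1)); first by lra.
      rewrite /Rdiv Rmult_assoc Rinv_l; last by lra.
      by have := Rmult_le_compat_r (2 * INR m) _ _ ltac:(lra) h2; lra.
    have h5 : 2 * INR m - 1 <= 2 * INR m * (2 * INR m / (2 * INR m + 1)).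
      apply: (Rmult_le_reg_r (2 * INR m + 1)); first by lra.
      have -> : 2 * INR m * (2 * INR m / (2 * INR m + 1)) * (2 * INR m + 1) = 2 * INR m * (2 * INR m) by field; lra.
      by nra.
    by have := Rmult_le_compat_r (2 * INR m) _ _ ltac:(lra) h4; lra.
  case: m hm hm1 hwm ho he h1 hinv => [//|n] _ hm1 hwm _ _ _ _.
  have h1 := sin_int_anti (2 * n).+1.
  rewrite (_ : (2 * n).+2 = 2 * n.+1)%nat in h1; last by lia.
  rewrite sin_int_even in h1.
  have ho := sin_int_odd n; have hn := hw n; have hn0 := pos_INR n.
  have hrel : 2 * INR n.+1 * bprod (/ 2) n.+1 = (2 * INR n + 1) * bprod (/ 2) n.
    by rewrite bprodS S_INR; field; lra.
  have h2 : bprod (/ 2) n.+1 * (PI / 2) * (2 * INR n.+1 * bprod (/ 2) n.+1) <= 1.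
    by rewrite -[X in _ <= X]ho hrel; apply: Rmult_le_compat_r => //; nra.
  apply: (Rmult_le_reg_l PI) => //; rewrite Rinv_r; last by lra.
  by rewrite /= in h2 *; lra.
have hsq : is_lim_seq (fun m => bprod (/ 2) m ^ 2 * INR m) (/ PI).
  apply: (is_lim_seq_le_le_loc (fun m => / PI * (1 - / 2 * / INR m)) _ (fun=> / PI)).
  - by exists 1%nat => m hm; apply: hbd; lia.
  - rewrite -[X in is_lim_seq _ (Finite X)](_ : / PI * (1 - / 2 * 0) = / PI); last by field; lra.
    apply: is_lim_seq_mult'; first exact: is_lim_seq_const.
    apply: is_lim_seq_minus'; first exact: is_lim_seq_const.
    apply: is_lim_seq_mult'; first exact: is_lim_seq_const.
    apply: (is_lim_seq_inv _ p_infty) => //; exact: is_lim_seq_INR.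
  - exact: is_lim_seq_const.
have := is_lim_seq_continuous sqrt _ (/ PI) ltac:(apply: continuity_pt_sqrt; apply/Rlt_le/Rinv_0_lt_compat; lra) hsq.
rewrite sqrt_inv; apply: is_lim_seq_ext_loc; exists 1%nat => m hm.
have hm0 : 0 < INR m by have := INR_ge1 m ltac:(lia); lra.
rewrite sqrt_mult; [|by apply: pow2_ge_0| lra].
by rewrite sqrt_pow2 ?Rpower_sqrt //; apply/Rlt_le.
Qed.

(** * The value of the limiting slope *)

Lemma is_lim_seq_Rpower_neg e : 0 < e -> is_lim_seq (fun n => Rpower (INR n) (- e)) 0.
Proof.
move=> he; apply/is_lim_seq_spec => eps.
have [A [hA hAe]] := Rpower_small e (eps / 2) he ltac:(have := cond_pos eps; lra).
exists A => n hn; rewrite Rminus_0_r Rabs_pos_eq; last by apply/Rlt_le/Rpower_pos.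
have h1 := INR_ge1 A hA; have h2 := INR_leq A n ltac:(lia).
have := Rpower_neg_le (INR A) (INR n) e ltac:(lra) ltac:(lra).
by have := cond_pos eps; lra.
Qed.

Lemma is_lim_seq_double (u : nat -> R) (l : R) : is_lim_seq u l -> is_lim_seq (fun m => u (2 * m)%nat) l.
Proof.
move=> h; apply: (is_lim_seq_subseq u l (fun m => 2 * m)%nat) => //.
by apply: eventually_subseq => n; lia.
Qed.

(** Duplication and shift reduce [bprod (2 * beta)] to the parameters [beta] and [beta - / 2],
    covered by Gauss' limit. Wallis supplies [sqrt PI], the two denominators at [2 * m] supply
    [4^beta], and the factor [/ 2 - beta] of the shift is the one in the continuation of [Gamma] to
    negative arguments. *)
Lemma bprod_ratio_limit beta : / 2 < beta < 1 ->
  is_lim_seq (fun m => bprod (2 * beta) (2 * m) / (bprod beta (2 * m) * bprod beta (2 * m)))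
    (Rpower 4 beta * sqrt PI * (Gamma (1 - beta) / Gamma (/ 2 - beta))).
Proof.
move=> hb.
have [g1 l1] := gauss_limit beta ltac:(lra).
have [g2 l2] := gauss_limit (beta - / 2) ltac:(lra).
have hpi : 0 < sqrt PI by apply: sqrt_lt_R0; exact: PI_RGT_0.
have l1' := is_lim_seq_double _ _ l1.
have -> : Gamma (1 - beta) = Gamma_pos (1 - beta) by rewrite /Gamma; case: Rlt_dec => // h; lra.
have -> : Gamma (/ 2 - beta) = Gamma_pos (1 - (beta - / 2)) / (/ 2 - beta).
  rewrite /Gamma; case: Rlt_dec => h; first by lra.
  by congr (Gamma_pos _ / _); lra.
set A := Gamma_pos (1 - beta) in g1 l1 l1' *; set B := Gamma_pos _ in g2 l2 *.
have lq : is_lim_seq (fun m => INR m / (INR m + (/ 2 - beta))) 1.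
  apply: (is_lim_seq_ext_loc (fun m => / (1 + (/ 2 - beta) * / INR m))).
    exists 1%nat => m hm; have := INR_ge1 m ltac:(lia) => h; field; lra.
  rewrite -[X in is_lim_seq _ (Finite X)]Rinv_1.
  apply: (is_lim_seq_inv _ 1); last by case; lra.
  rewrite -[X in is_lim_seq _ (Finite X)](_ : 1 + (/ 2 - beta) * 0 = 1); last by ring.
  apply: is_lim_seq_plus'; first exact: is_lim_seq_const.
  apply: is_lim_seq_mult'; first exact: is_lim_seq_const.
  apply: (is_lim_seq_inv _ p_infty) => //; exact: is_lim_seq_INR.
have l3 := is_lim_seq_inv _ _ wallis_limit ltac:(by case; have := Rinv_0_lt_compat _ hpi; lra).
have l4 := is_lim_seq_inv _ _ (is_lim_seq_mult' _ _ _ _ l1' l1') ltac:(by case; have := Rinv_0_lt_compat _ g1; nra).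
have l5 := is_lim_seq_mult' _ _ _ _ l1 (is_lim_seq_mult' _ _ _ _ lq l2).
have l6 := is_lim_seq_mult' _ _ _ _ l5 (is_lim_seq_mult' _ _ _ _ l3 l4).
have l7 := is_lim_seq_mult' _ _ _ _ (is_lim_seq_const (Rpower 4 beta * (/ 2 - beta))) l6.
set L := (X in is_lim_seq _ (Finite X)) in l7.
have -> : Rpower 4 beta * sqrt PI * (A / (B / (/ 2 - beta))) = L.
  by rewrite /L; field; lra.
apply: is_lim_seq_ext_loc l7; exists 1%nat => m hm.
have hm0 : 0 < INR m by have := INR_ge1 m ltac:(lia); lra.
have w1 := bprod_pos beta m ltac:(lra); have w2 := bprod_pos beta (2 * m) ltac:(lra).
have w3 := bprod_pos (/ 2) m ltac:(lra).
have hs := bprod_split beta m.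
have -> : bprod (2 * beta) (2 * m) = bprod beta m * bprod (beta + / 2) m / bprod (/ 2) m.
  by rewrite -hs; field; lra.
rewrite (bprod_shift (beta + / 2)); last by lra.
rewrite (_ : beta + / 2 - 1 = beta - / 2); last by lra.
rewrite INR_muln -Rpower_mult_distr //; last by rewrite /=; lra.
have -> : Rpower 4 beta = Rpower (INR 2) beta * Rpower (INR 2) beta.
  rewrite -Rpower_plus (_ : 4 = Rpower (INR 2) 2); first by rewrite Rpower_mult; congr Rpower; lra.
  by rewrite (Rpower_pow 2) /=; [ring | lra].
have hP2 := Rpower_pos (INR 2) beta; have hPb := Rpower_pos (INR m) beta.
have hPh := Rpower_pos (INR m) (/ 2).
have -> : Rpower (INR m) (beta - / 2) = Rpower (INR m) beta / Rpower (INR m) (/ 2).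
  by rewrite /Rminus Rpower_plus Rpower_Ropp.
have e : Rpower (INR m) (/ 2) * Rpower (INR m) (/ 2) = INR m.
  by rewrite -Rpower_plus (_ : / 2 + / 2 = 1) ?Rpower_1 //; lra.
have hm2 : 1 <= INR m by apply: INR_ge1; lia.
move: e hP2 hPb hPh hm2; clear - w1 w2 w3 hb.
move: (INR m) (Rpower (INR 2) beta) (Rpower (INR m) beta) (Rpower (INR m) (/ 2)).
by move=> M P2 P Q <- hP2 hP hQ hm2; field; repeat split; lra.
Qed.

(** * Binomial tails of constant slope *)

Section BinomialTail.
Context (beta : R) (hb : / 2 < beta < 1).

(** The shift by one gives [btail 1 = 1] and makes the slope exactly [beta] at every index. *)
Definition btail (k : nat) : R := bprod beta k.-1.

Lemma btail_pos k : 0 < btail k.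
Proof. by apply: bprod_pos; lra. Qed.

Lemma btail_mass k : (1 <= k)%nat -> mass btail k = btail k * (beta / INR k).
Proof. by case: k => // k _; rewrite /mass /btail -!pred_Sn bprodS; ring. Qed.

Lemma btail_mass_pos k : (1 <= k)%nat -> 0 < mass btail k.
Proof.
move=> hk; rewrite btail_mass //; apply: Rmult_lt_0_compat; first exact: btail_pos.
by apply: Rdiv_lt_0_compat; [lra | have := INR_ge1 k hk; lra].
Qed.

Lemma btail_log_slope k : (1 <= k)%nat -> log_slope btail k = beta.
Proof.
move=> hk; rewrite /log_slope btail_mass //; have := btail_pos k; have := INR_ge1 k hk => h1 h2.
by field; lra.
Qed.

Lemma btail_increment_conv k : (1 <= k)%nat ->
  increment_conv_sum btail 1 k k = btail k * btail k - bprod (2 * beta) k.-1.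
Proof.
move=> hk; have hc := bprod_conv beta k hk.
have hs : nsum 1 k (fun i => mass btail (k - i)%nat) = 1 - btail k.
  rewrite -(nsum_rev k (mass btail)).
  elim: k hk {hc} => [//|k IH] _; case: (posnP k) => [->|hk]; first by rewrite nsum_geq // /btail /=; lra.
  by rewrite nsum_recr // IH // /mass; lra.
rewrite /increment_conv_sum.
rewrite (nsum_ext _ _ _ (fun i => bprod beta i.-1 * (bprod beta (k - i).-1 * (beta / INR (k - i)))
   - btail k * mass btail (k - i)%nat)); last first.
  by move=> i hi; rewrite btail_mass; [rewrite /btail; ring | lia].
by rewrite nsum_minus nsum_scal hs hc /btail; ring.
Qed.

(** One step multiplies [(k - 1) * btail k] by [(k - beta) / (k - 1)], which exceeds 1 for
    [k >= 2]. *)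
Lemma btail_pred_mono j k : (1 <= j <= k)%nat -> INR j.-1 * btail j <= INR k.-1 * btail k.
Proof.
elim: k => [|k IH] h; first by lia.
case: (eqVneq j k.+1) => [->|hn]; first by lra.
apply: Rle_trans (IH ltac:(lia)) _.
case: k {IH} h hn => [|k] h hn; first by lia.
rewrite /btail -!pred_Sn bprodS; have hP := bprod_pos beta k ltac:(lra).
have h3 := pos_INR k.
have -> : INR k.+1 * (bprod beta k * (1 - beta / INR k.+1)) = (INR k + 1 - beta) * bprod beta k.
  by rewrite S_INR; field; lra.
nra.
Qed.

(** For [j >= 2], [k - 1 <= 2 * j - 1 <= 3 * (j - 1)] turns [btail_pred_mono] into
    [btail j <= 3 * btail k]. The case [j = 1] leaves [k <= 2], and [btail 2 = 1 - beta] is the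
    origin of the denominator. *)
Lemma btail_mass_le j k : (1 <= k)%nat -> (k <= 2 * j)%nat -> (j <= k)%nat ->
  mass btail j <= 6 * beta / (1 - beta) * (btail k / INR k).
Proof.
move=> hk h1 h2; rewrite btail_mass; last by lia.
have hk0 := INR_ge1 k hk; have hj0 := INR_ge1 j ltac:(lia).
have gk := btail_pos k; have gj := btail_pos j.
have h6 : 6 * beta <= 6 * beta / (1 - beta).
  apply: (Rmult_le_reg_r (1 - beta)); first by lra.
  have -> : 6 * beta / (1 - beta) * (1 - beta) = 6 * beta by field; lra.
  by nra.
case: (leqP 2 j) => hj.
  have hm := btail_pred_mono j k ltac:(lia).
  rewrite -!subn1 !INR_subn in hm; try lia.
  have hj2 := INR_leq 2 j hj; have hkj := INR_leq k (2 * j) h1.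
  rewrite INR_muln in hkj; rewrite [INR 2]/= in hj2 hkj; rewrite [INR 1]/= in hm.
  have h3 : btail j <= 3 * btail k.
    apply: (Rmult_le_reg_l (INR j - 1)); first by lra.
    by apply: Rle_trans hm _; nra.
  have h4 : / INR j <= 2 / INR k.
    by rewrite -Rinv_div; apply: Rinv_le_contravar; lra.
  apply: (Rle_trans _ (6 * beta * (btail k / INR k))).
    have -> : 6 * beta * (btail k / INR k) = (3 * btail k) * (beta * (2 / INR k)) by field; lra.
    apply: Rmult_le_compat; try lra; last by apply: Rmult_le_compat_l; lra.
    by apply/Rlt_le/Rdiv_lt_0_compat; lra.
  by apply: Rmult_le_compat_r; [apply/Rlt_le/Rdiv_lt_0_compat; lra | lra].
have hj1 : j = 1%nat by lia.
rewrite hj1 [INR 1]/= /btail /=.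
have hk2 : k = 1%nat \/ k = 2%nat by lia.
case: hk2 => ->; rewrite /=; first by lra.
have -> : 6 * beta / (1 - beta) * (1 * (1 - beta / 1) / (1 + 1)) = 3 * beta by field; lra.
lra.
Qed.

Lemma btail_inv_limit : is_lim_seq (fun m => / (INR (2 * m).+1 * btail (2 * m).+1)) 0.
Proof.
have [g1 l1] := gauss_limit beta ltac:(lra).
have l2 := is_lim_seq_inv _ _ l1 ltac:(by case; have := Rinv_0_lt_compat _ g1; lra).
have l3 := is_lim_seq_mult' _ _ _ _ (is_lim_seq_Rpower_neg (1 - beta) ltac:(lra)) l2.
rewrite Rmult_0_l in l3; have l4 := is_lim_seq_double _ _ l3.
apply: (is_lim_seq_le_le_loc (fun=> 0) _ _ _ _ (is_lim_seq_const 0) l4).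
exists 1%nat => m hm; rewrite /btail -pred_Sn.
have hw := bprod_pos beta (2 * m) ltac:(lra); have hm0 := INR_ge1 (2 * m) ltac:(lia).
have hP := Rpower_pos (INR (2 * m)) beta.
split; first by apply/Rlt_le/Rinv_0_lt_compat; rewrite S_INR; nra.
have -> : Rpower (INR (2 * m)) (- (1 - beta)) = Rpower (INR (2 * m)) beta / INR (2 * m).
  have -> : - (1 - beta) = beta + - 1 by ring.
  by rewrite Rpower_plus Rpower_Ropp Rpower_1; [|lra].
have -> : Rpower (INR (2 * m)) beta / INR (2 * m) * / (bprod beta (2 * m) * Rpower (INR (2 * m)) beta)
   = / (INR (2 * m) * bprod beta (2 * m)) by field; lra.
apply: Rinv_le_contravar; first by nra.
by rewrite S_INR; nra.
Qed.

End BinomialTail.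

(** * Identification of the limiting slope *)

Section SlopeValue.
Context (p : R) (G : nat -> R) (hp : 0 < p < 1) (hG : lis_tail p G).
Context (alpha : R) (halpha : 1/2 < alpha < 1) (heq : alpha_equation p alpha).
Local Notation C0 := (sum_const p G).
Local Notation beta := (/ (2 * alpha)).

Let Gpos := lt_pos _ _ hG.
Let C0ge : 2 <= C0 := sum_const_ge2 p G hp hG.

Let hbeta : / 2 < beta < 1.
Proof.
split; first by apply: Rinv_lt_contravar; nra.
by rewrite -Rinv_1; apply: Rinv_lt_contravar; lra.
Qed.

Lemma btail_full_limit :
  is_lim_seq (fun m => increment_conv_sum (btail beta) 1 (2 * m).+1 (2 * m).+1
     / (btail beta (2 * m).+1 * btail beta (2 * m).+1)) (/ p).
Proof.
have hl := bprod_ratio_limit beta hbeta.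
have hv : Rpower 4 beta * sqrt PI * (Gamma (1 - beta) / Gamma (/ 2 - beta)) = 1 - / p.
  move: heq; rewrite /alpha_equation /Rdiv !Rmult_1_l.
  set X := Gamma (/ 2 - _); set Y := Gamma (1 - _).
  have hpi : 0 < sqrt PI by apply: sqrt_lt_R0; exact: PI_RGT_0.
  have hP := Rpower_pos 4 beta; set Z := Rpower _ _ * _.
  have hZ : 0 < Z by apply: Rmult_lt_0_compat.
  move=> h.
  (* Division is total and [/ 0 = 0], so the nonzero right-hand side of the equation is what shows
     that both Gamma values are nonzero. *)
  have hne : / Z * (X * / Y) <> 0 by rewrite h; apply: Rmult_integral_contrapositive_currified; [lra | apply: Rinv_neq_0_compat; lra].
  have hX : X <> 0 by move=> h0; apply: hne; rewrite h0; ring.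
  have hY : Y <> 0 by move=> h0; apply: hne; rewrite h0 Rinv_0; ring.
  have := f_equal Rinv h.
  have -> : / (/ Z * (X * / Y)) = Z * (Y * / X) by field; split; [|split]; try lra.
  by move=> ->; field; lra.
rewrite hv in hl.
have := is_lim_seq_minus' _ _ _ _ (is_lim_seq_const 1) hl.
rewrite (_ : 1 - (1 - / p) = / p); last by ring.
apply: is_lim_seq_ext => m.
rewrite btail_increment_conv // /btail -!pred_Sn.
by have := bprod_pos beta (2 * m) ltac:(lra) => h; field; lra.
Qed.

(** [sum_tail_scale] started at [m = 1], where the sum is [G 1 = 1], gives
    [1 <= 2 * C0 * k^(-e) * (k * G k)]. *)
Lemma tail_inv_limit : is_lim_seq (fun k => / (INR k * G k)) 0.
Proof.
set e := / (8 * C0).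
have he : 0 < e by apply: Rinv_0_lt_compat; lra.
have l := is_lim_seq_mult' _ _ _ _ (is_lim_seq_const (2 * C0)) (is_lim_seq_Rpower_neg e he).
rewrite Rmult_0_r in l.
apply: (is_lim_seq_le_le_loc (fun=> 0) _ _ _ _ (is_lim_seq_const 0) l).
exists 1%nat => k hk; have hk0 := INR_ge1 k ltac:(lia); have hg := Gpos k.
split; first by apply/Rlt_le/Rinv_0_lt_compat; nra.
have hs := sum_tail_scale p G hp hG e 1 k ltac:(split; [lra | exact: Rle_refl]) erefl ltac:(lia).
have hU := sum_tail_le p G hp hG k ltac:(lia).
rewrite muln1 nsum_recr // nsum_geq // Rplus_0_l (lt_one _ _ hG) in hs.
have hP := Rpower_pos (INR k) (- e).
apply: (Rmult_le_reg_r (INR k * G k)); first by nra.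
rewrite Rinv_l; last by nra.
apply: Rle_trans hs _.
have := Rmult_le_compat_l (2 * Rpower (INR k) (- e)) _ _ ltac:(lra) hU; lra.
Qed.

Let tail_full k : (2 <= k)%nat -> increment_conv_sum G 1 k k / (G k * G k) = / p.
Proof.
move=> hk; have he := increment_conv p G hG k hk; have hg := Gpos k.
rewrite /increment_conv_sum -he.
have hS : 0 < nsum 1 k (fun i => (G i - G k) * mass G (k - i)%nat).
  by apply: (Rmult_lt_reg_l p); [lra | rewrite he Rmult_0_r; nra].
by field; lra.
Qed.

(** If [rho < b], the slope of [btail b] eventually exceeds [lam] times that of [G] for some
    [lam > 1]. Both normalised sums tend to [/ p] and the ends are negligible, so the comparison
    would give [lam / p <= / p]; the case [rho > b] is symmetric. Odd indices are used because
    [bprod_split] concerns even arguments of [bprod]. *)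
Lemma slope_value (rho : R) : is_lim_seq (log_slope G) rho -> rho = beta.
Proof.
move=> hrho; move: btail_full_limit hbeta; move: (/ (2 * alpha)) => b hbl hb.
have hpinv : 0 < / p by apply: Rinv_0_lt_compat; lra.
have hbt k : (1 <= k)%nat -> 0 < btail b k by move=> _; apply: btail_pos.
have hbm := btail_mass_pos b hb.
have hGp k : (1 <= k)%nat -> 0 < G k by move=> _; apply: Gpos.
have hGm := lt_mass _ _ hG.
have hrho0 : 0 <= rho.
  have : Rbar_le 0 rho; last by [].
  apply: (is_lim_seq_le_loc (fun=> 0) (log_slope G)) => //; last exact: is_lim_seq_const.
  by exists 1%nat => k hk; have := log_slope_bounds p G hp hG k ltac:(lia); lra.
have hodd := is_lim_seq_subseq _ _ (fun m => (2 * m).+1) ltac:(by apply: eventually_subseq => n; lia).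
have part_le F i0 k : (1 <= i0)%nat -> (2 * i0 <= k)%nat -> (forall k, (1 <= k)%nat -> 0 < F k) ->
    (forall k, (1 <= k)%nat -> 0 < mass F k) ->
    increment_conv_sum F i0 (k - i0).+1 k / (F k * F k) <= increment_conv_sum F 1 k k / (F k * F k).
  move=> h1 h2 hF hm; apply: Rmult_le_compat_r.
    by apply/Rlt_le/Rinv_0_lt_compat; have := hF k ltac:(lia); nra.
  apply: nsum_widen; try lia; move=> i hi; apply: Rmult_le_pos; last by apply/Rlt_le/hm; lia.
  suff : forall n, F (i + n)%nat <= F i by move/(_ (k - i)%nat); rewrite subnKC; [lra | lia].
  elim=> [|n IH]; first by rewrite addn0; lra.
  by have := hm (i + n)%nat ltac:(lia); rewrite addnS /mass; lra.
have [D [hD1 hD]] := tail_comparable p G hp hG.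
case: (Rtotal_order rho b) => [hlt|[//|hgt]]; exfalso.
(* The quotient of [b] by the midpoint of [rho] and [b], which eventually separates the two
   slopes. *)
- set lam := 2 * b / (rho + b).
  have hl : 1 < lam.
    by apply: (Rmult_lt_reg_r (rho + b)); [lra | rewrite /lam /Rdiv Rmult_assoc Rinv_l; lra].
  have [N hN] : eventually (fun k => log_slope G k < (rho + b) / 2).
    have /is_lim_seq_spec h := hrho.
    have [N hN] := h (mkposreal ((b - rho) / 2) ltac:(lra)).
    by exists N => k hk; have := hN k hk; rewrite /= => /Rabs_def2; lra.
  set i0 := N.+1.
  have hM : 0 < 2 * slope_bound p * D.
    by apply: Rmult_lt_0_compat; [have := exp_pos ((1 - p) / (2 * p)); rewrite /slope_bound; lra | lra].
  have [C hC] := increment_conv_sum_ends G i0 _ erefl hM (lt_one _ _ hG) hGp hGm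
     (fun j k => mass_le p G hp hG D hD1 hD j k).
  have hcmp k : (i0 <= k)%nat -> lam * log_slope G k <= log_slope (btail b) k.
    move=> hk; rewrite (btail_log_slope b hb); last by lia.
    have := hN k ltac:(lia) => h.
    have -> : lam * log_slope G k = b * (log_slope G k / ((rho + b) / 2)) by rewrite /lam; field; lra.
    have : log_slope G k / ((rho + b) / 2) <= 1.
      apply: (Rmult_le_reg_r ((rho + b) / 2)); first by lra.
      have -> : log_slope G k / ((rho + b) / 2) * ((rho + b) / 2) = log_slope G k by field; lra.
      by lra.
    nra.
  have l1 := is_lim_seq_mult' _ _ _ _ (is_lim_seq_const C) (hodd _ _ tail_inv_limit).
  have l2 := is_lim_seq_mult' _ _ _ _ (is_lim_seq_const lam) (is_lim_seq_minus' _ _ _ _ (is_lim_seq_const (/ p)) l1).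
  have : Rbar_le (lam * (/ p - C * 0)) (/ p).
    apply: (is_lim_seq_le_loc _ _ _ _ _ l2 hbl); exists (i0) => m hm.
    have [k hkm] : exists k, k = (2 * m).+1 by exists (2 * m).+1.
    rewrite -hkm.
    have hk : (2 * i0 <= k)%nat by lia.
    have c1 := increment_conv_sum_mono _ _ i0 lam erefl (Rlt_le _ _ hl) hbt hGp hGm hcmp k hk.
    have c2 := hC k hk; have c3 := part_le (btail b) i0 k erefl hk hbt hbm.
    rewrite tail_full in c2; last by lia.
    apply: Rle_trans c3; apply: Rle_trans c1; apply: Rmult_le_compat_l; first by lra.
    rewrite /Rdiv in c2 *; lra.
  rewrite /= Rmult_0_r Rminus_0_r; nra.
- set lam := (rho + b) / (2 * b).
  have hb0 : 0 < b by lra.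
  have hl : 1 < lam.
    by apply: (Rmult_lt_reg_r (2 * b)); [lra | rewrite /lam /Rdiv Rmult_assoc Rinv_l; lra].
  have [N hN] : eventually (fun k => (rho + b) / 2 < log_slope G k).
    have /is_lim_seq_spec h := hrho.
    have [N hN] := h (mkposreal ((rho - b) / 2) ltac:(lra)).
    by exists N => k hk; have := hN k hk; rewrite /= => /Rabs_def2; lra.
  set i0 := N.+1.
  have hM : 0 < 6 * b / (1 - b) by apply: Rdiv_lt_0_compat; lra.
  have [C hC] := increment_conv_sum_ends (btail b) i0 _ erefl hM erefl hbt hbm
     (fun j k => btail_mass_le b hb j k).
  have hcmp k : (i0 <= k)%nat -> lam * log_slope (btail b) k <= log_slope G k.
    move=> hk; rewrite (btail_log_slope b hb); last by lia.
    have := hN k ltac:(lia); have -> : lam * b = (rho + b) / 2 by rewrite /lam; field; lra.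
    lra.
  have l1 := is_lim_seq_mult' _ _ _ _ (is_lim_seq_const C) (btail_inv_limit b hb).
  have l2 := is_lim_seq_mult' _ _ _ _ (is_lim_seq_const lam) (is_lim_seq_minus' _ _ _ _ hbl l1).
  have : Rbar_le (lam * (/ p - C * 0)) (/ p).
    apply: (is_lim_seq_le_loc _ _ _ _ _ l2 (is_lim_seq_const (/ p))); exists (i0) => m hm.
    have [k hkm] : exists k, k = (2 * m).+1 by exists (2 * m).+1.
    rewrite -hkm.
    have hk : (2 * i0 <= k)%nat by lia.
    have c1 := increment_conv_sum_mono _ _ i0 lam erefl (Rlt_le _ _ hl) hGp hbt hbm hcmp k hk.
    have c2 := hC k hk; have c3 := part_le G i0 k erefl hk hGp hGm.
    rewrite tail_full in c3; last by lia.
    apply: Rle_trans c3; apply: Rle_trans c1; apply: Rmult_le_compat_l; first by lra.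
    rewrite /Rdiv in c2 *; lra.
  rewrite /= Rmult_0_r Rminus_0_r; nra.
Qed.

End SlopeValue.

(** * Positive leaf sets of a node *)

Lemma mem_subseqs (T : eqType) (s S : seq T) : (S \in subseqs s) = subseq S s.
Proof.
elim: s S => [|x s IH] S; first by rewrite /= inE; case: S.
rewrite /= mem_cat IH; case: S => [|y S]; first by rewrite sub0seq orbT.
have -> : (y :: S \in [seq x :: z | z <- subseqs s]) = (y == x) && subseq S s.
  apply/mapP/andP => [[z hz [-> ->]]|[/eqP -> hS]]; first by rewrite eqxx -IH.
  by exists S => //; rewrite IH.
case: eqVneq => [->|//] /=; apply/orP/idP => [[//|h]|h]; last by left.
by apply: subseq_trans h; apply: subseq_cons.
Qed.

Lemma subseq_catP (T : eqType) (S s1 s2 : seq T) : subseq S (s1 ++ s2) ->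
  exists S1 S2, [/\ S = S1 ++ S2, subseq S1 s1 & subseq S2 s2].
Proof.
case/subseqP => m hm ->; exists (mask (take (size s1) m) s1), (mask (drop (size s1) m) s2).
split; [|exact: mask_subseq|exact: mask_subseq].
rewrite -mask_cat ?cat_take_drop // size_take hm size_cat.
by case: ltngtP => //; lia.
Qed.

Lemma subseq_mapP (T U : eqType) (f : T -> U) (S : seq U) (s : seq T) :
  subseq S (map f s) -> exists2 S', S = map f S' & subseq S' s.
Proof.
case/subseqP => m hm ->; exists (mask m s); first by rewrite map_mask.
exact: mask_subseq.
Qed.

Lemma meets_has t (P : pred (seq bool)) : meets t P = has P (leaves t).
Proof.
elim: t P => [|s l IHl r IHr] P /=; first by rewrite orbF.
by rewrite has_cat !has_map IHl IHr.
Qed.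

Lemma positive_set_ext t (P Q : pred (seq bool)) : P =1 Q -> positive_set t P = positive_set t Q.
Proof.
elim: t P Q => [//|s l IHl r IHr] P Q h /=.
rewrite !meets_has (eq_has (a2 := fun a => Q (false :: a))); last by move=> a; exact: h.
rewrite [has (fun a => P (true :: a)) _](eq_has (a2 := fun a => Q (true :: a))); last by move=> a; exact: h.
by rewrite (IHl _ (fun a => Q (false :: a))) ?(IHr _ (fun a => Q (true :: a))) // => a; exact: h.
Qed.

Definition pos_leaf_set (t : tree) (S : seq (seq bool)) : bool :=
  subseq S (leaves t) && positive_set t (fun a => a \in S).

Lemma mem_positive_leaf_sets t S : (S \in positive_leaf_sets t) = pos_leaf_set t S.
Proof. by rewrite /positive_leaf_sets mem_filter mem_subseqs andbC. Qed.

Definition node_set (S1 S2 : seq (seq bool)) : seq (seq bool) :=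
  [seq false :: a | a <- S1] ++ [seq true :: a | a <- S2].

Lemma size_node_set S1 S2 : size (node_set S1 S2) = (size S1 + size S2)%N.
Proof. by rewrite size_cat !size_map. Qed.

Lemma mem_node_set_l S1 S2 a : (false :: a \in node_set S1 S2) = (a \in S1).
Proof.
rewrite mem_cat mem_map; last by move=> x y [].
by rewrite (introF mapP) ?orbF // => -[].
Qed.

Lemma mem_node_set_r S1 S2 a : (true :: a \in node_set S1 S2) = (a \in S2).
Proof.
rewrite mem_cat orbC mem_map; last by move=> x y [].
by rewrite (introF mapP) ?orbF // => -[].
Qed.

Lemma meets_subseq t S : subseq S (leaves t) -> meets t (fun a => a \in S) = (S != [::]).
Proof.
move=> h; rewrite meets_has; apply/hasP/idP => [[x _]|]; first by case: S {h}.
case: S h => [//|x S] h _; exists x; last by rewrite inE eqxx.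
by apply: (mem_subseq h); rewrite inE eqxx.
Qed.

Lemma pos_node_set s l r S1 S2 : pos_leaf_set l S1 -> pos_leaf_set r S2 ->
  [|| s, S1 == [::] | S2 == [::]] -> pos_leaf_set (Node s l r) (node_set S1 S2).
Proof.
case/andP=> h1 p1 /andP[h2 p2] hs; apply/andP; split.
  by apply: cat_subseq; apply: map_subseq.
have e1 : (fun a => false :: a \in node_set S1 S2) =1 (fun a => a \in S1).
  by move=> a; exact: mem_node_set_l.
have e2 : (fun a => true :: a \in node_set S1 S2) =1 (fun a => a \in S2).
  by move=> a; exact: mem_node_set_r.
rewrite /= (positive_set_ext _ _ _ e1) (positive_set_ext _ _ _ e2) p1 p2 !andbT.
rewrite !meets_has (eq_has e1) (eq_has e2) -!meets_has !meets_subseq //.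
by case/or3P: hs => [->|/eqP ->|/eqP ->] /=; rewrite ?implybT ?andbF.
Qed.

(** With [pos_node_set], this identifies the positive sets of a node with pairs of positive sets of
    its children, one of them being empty if the sign is negative. *)
Lemma pos_node_inv s l r S : pos_leaf_set (Node s l r) S -> exists S1 S2,
  [/\ S = node_set S1 S2, pos_leaf_set l S1, pos_leaf_set r S2 & [|| s, S1 == [::] | S2 == [::]]].
Proof.
case/andP => /subseq_catP[S1' [S2' [-> /subseq_mapP[S1 -> h1] /subseq_mapP[S2 -> h2]]]].
rewrite -/(node_set S1 S2) => hp; exists S1, S2.
have e1 : (fun a => false :: a \in node_set S1 S2) =1 (fun a => a \in S1).
  by move=> a; exact: mem_node_set_l.
have e2 : (fun a => true :: a \in node_set S1 S2) =1 (fun a => a \in S2).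
  by move=> a; exact: mem_node_set_r.
move: hp; rewrite /= (positive_set_ext _ _ _ e1) (positive_set_ext _ _ _ e2).
rewrite !meets_has (eq_has e1) (eq_has e2) -!meets_has !meets_subseq //.
case/and3P => hs p1 p2; split=> //; rewrite /pos_leaf_set ?h1 ?h2 //.
by move: hs; case: s => //=; case: S1 {h1 p1 e1 e2} => //=; case: S2 {h2 p2}.
Qed.

Lemma pos_nil t : pos_leaf_set t [::].
Proof. by elim: t => [//|s l IHl r IHr]; apply: (pos_node_set s l r [::] [::]) => //=; rewrite orbT. Qed.

Lemma LIS_ub t S : pos_leaf_set t S -> (size S <= LIS t)%N.
Proof.
rewrite -mem_positive_leaf_sets /LIS; elim: (positive_leaf_sets t) => [//|S' s IH] /=.
rewrite inE => /orP[/eqP ->|/IH h]; first exact: leq_maxl.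
by rewrite leq_max h orbT.
Qed.

Lemma LIS_attained t : exists2 S, pos_leaf_set t S & size S = LIS t.
Proof.
have := pos_nil t; rewrite -mem_positive_leaf_sets.
suff : forall s : seq (seq (seq bool)), s != [::] ->
    exists2 S, S \in s & size S = foldr (fun S m => maxn (size S) m) 0%N s.
  move=> h hn; have [|S hS1 hS2] := h (positive_leaf_sets t).
    by case: (positive_leaf_sets t) hn.
  by exists S => //; rewrite -mem_positive_leaf_sets.
elim=> [//|S s IH] _; rewrite [foldr _ _ _]/=; set m := foldr _ _ s in IH *.
case: (leqP m (size S)) => h; first by exists S => //; rewrite inE eqxx.
case: (eqVneq s [::]) => hs; first by rewrite /m hs in h.
by have [S' h1 h2] := IH hs; exists S' => //; rewrite inE h1 orbT.
Qed.

Lemma LIS_eq t n : (forall S, pos_leaf_set t S -> (size S <= n)%N) ->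
  (exists2 S, pos_leaf_set t S & size S = n) -> LIS t = n.
Proof.
move=> hub [S hS hn]; apply/eqP; rewrite eqn_leq -{2}hn LIS_ub // andbT.
by have [S' h' <-] := LIS_attained t; apply: hub.
Qed.

Lemma LIS_plus l r : LIS (Node true l r) = (LIS l + LIS r)%N.
Proof.
apply: LIS_eq => [S /pos_node_inv[S1 [S2 [-> h1 h2 _]]]|].
  by rewrite size_node_set leq_add ?LIS_ub.
have [S1 h1 e1] := LIS_attained l; have [S2 h2 e2] := LIS_attained r.
by exists (node_set S1 S2); [apply: pos_node_set | rewrite size_node_set e1 e2].
Qed.

Lemma LIS_minus l r : LIS (Node false l r) = maxn (LIS l) (LIS r).
Proof.
apply: LIS_eq => [S /pos_node_inv[S1 [S2 [-> h1 h2 /= /orP[/eqP h|/eqP h]]]]|].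
- by rewrite size_node_set h leq_max (LIS_ub r) ?orbT.
- by rewrite size_node_set h addn0 leq_max LIS_ub.
have [S1 h1 e1] := LIS_attained l; have [S2 h2 e2] := LIS_attained r.
case: (leqP (LIS r) (LIS l)) => h.
  exists (node_set S1 [::]); first by apply: pos_node_set => //; [exact: pos_nil | rewrite orbT].
  by rewrite size_node_set e1 addn0.
exists (node_set [::] S2); first by apply: pos_node_set => //; exact: pos_nil.
by rewrite size_node_set e2.
Qed.

(** * Leaves common to all maximum positive sets *)

Definition in_cap (t : tree) (a : seq bool) : bool :=
  all (fun S => a \in S) [seq S <- positive_leaf_sets t | size S == LIS t].

Lemma in_capP t a :
  reflect (forall S, pos_leaf_set t S -> size S = LIS t -> a \in S) (in_cap t a).
Proof.
apply: (iffP allP) => h S.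
  by move=> hS hn; apply: h; rewrite mem_filter hn eqxx mem_positive_leaf_sets.
by rewrite mem_filter mem_positive_leaf_sets => /andP[/eqP hn hS]; apply: h.
Qed.

Lemma size_Lmax_cap t : size (Lmax_cap t) = count (in_cap t) (leaves t).
Proof. by rewrite size_filter. Qed.

Lemma count_cap_node s l r (P Q : pred (seq bool)) :
  (forall a, in_cap (Node s l r) (false :: a) = P a) ->
  (forall a, in_cap (Node s l r) (true :: a) = Q a) ->
  size (Lmax_cap (Node s l r)) = (count P (leaves l) + count Q (leaves r))%N.
Proof.
by move=> hP hQ; rewrite size_Lmax_cap /= count_cat !count_map; congr (_ + _)%N; apply: eq_count.
Qed.

(** The maximum sets of a positive node are exactly the pairs of maximum sets of its children, so a
    leaf is tested on its own side after completing by any maximum set of the other. *)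
Lemma cap_plus l r :
  size (Lmax_cap (Node true l r)) = (size (Lmax_cap l) + size (Lmax_cap r))%N.
Proof.
rewrite !size_Lmax_cap -size_Lmax_cap; apply: count_cap_node => a; apply/in_capP/in_capP => h S.
- move=> h1 e1; have [S2 h2 e2] := LIS_attained r.
  rewrite -(mem_node_set_l S S2); apply: h; first exact: pos_node_set.
  by rewrite size_node_set LIS_plus e1 e2.
- case/pos_node_inv => S1 [S2 [-> h1 h2 _]]; rewrite size_node_set LIS_plus => e.
  by rewrite mem_node_set_l; apply: h => //; have := LIS_ub _ _ h1; have := LIS_ub _ _ h2; lia.
- move=> h1 e1; have [S2 h2 e2] := LIS_attained l.
  rewrite -(mem_node_set_r S2 S); apply: h; first exact: pos_node_set.
  by rewrite size_node_set LIS_plus e1 e2.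
- case/pos_node_inv => S1 [S2 [-> h1 h2 _]]; rewrite size_node_set LIS_plus => e.
  by rewrite mem_node_set_r; apply: h => //; have := LIS_ub _ _ h1; have := LIS_ub _ _ h2; lia.
Qed.

Lemma not_in_cap t a S : pos_leaf_set t S -> size S = LIS t -> a \notin S -> in_cap t a = false.
Proof. by move=> h e; apply: contraNF => /in_capP; apply. Qed.

Lemma pos_minus_l l r S : pos_leaf_set l S -> pos_leaf_set (Node false l r) (node_set S [::]).
Proof. by move=> h; apply: pos_node_set => //; [exact: pos_nil | rewrite orbT]. Qed.

Lemma pos_minus_r l r S : pos_leaf_set r S -> pos_leaf_set (Node false l r) (node_set [::] S).
Proof. by move=> h; apply: pos_node_set => //; exact: pos_nil. Qed.

(** If one child has a larger [LIS], all maximum sets live in it. At a tie each side has maximum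
    sets of its own, and these are disjoint. *)
Lemma cap_minus l r : size (Lmax_cap (Node false l r)) =
  if (LIS r < LIS l)%N then size (Lmax_cap l)
  else if (LIS l < LIS r)%N then size (Lmax_cap r) else 0%N.
Proof.
have [S1 h1 e1] := LIS_attained l; have [S2 h2 e2] := LIS_attained r.
case: (ltnP (LIS r) (LIS l)) => hlr; last case: (ltnP (LIS l) (LIS r)) => hrl.
- rewrite [RHS]size_Lmax_cap -[RHS]addn0 -(count_pred0 (leaves r)); apply: count_cap_node => a.
    apply/in_capP/in_capP => h S.
      move=> hS e; rewrite -(mem_node_set_l S [::]); apply: h; first exact: pos_minus_l.
      by rewrite size_node_set LIS_minus e addn0; lia.
    case/pos_node_inv => T1 [T2 [-> k1 k2 /= hT]]; rewrite size_node_set LIS_minus => e.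
    rewrite mem_node_set_l; apply: h => //.
    have b1 := LIS_ub _ _ k1; have b2 := LIS_ub _ _ k2.
    by case/orP: hT => /eqP hT; rewrite hT /= in e b1 b2; lia.
  apply: (not_in_cap _ _ _ (pos_minus_l l r S1 h1)); last by rewrite mem_node_set_r.
  by rewrite size_node_set LIS_minus e1 addn0; lia.
- rewrite [RHS]size_Lmax_cap -[RHS]add0n -(count_pred0 (leaves l)); apply: count_cap_node => a.
    apply: (not_in_cap _ _ _ (pos_minus_r l r S2 h2)); last by rewrite mem_node_set_l.
    by rewrite size_node_set LIS_minus e2 add0n; lia.
  apply/in_capP/in_capP => h S.
    move=> hS e; rewrite -(mem_node_set_r [::] S); apply: h; first exact: pos_minus_r.
    by rewrite size_node_set LIS_minus e add0n; lia.
  case/pos_node_inv => T1 [T2 [-> k1 k2 /= hT]]; rewrite size_node_set LIS_minus => e.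
  rewrite mem_node_set_r; apply: h => //.
  have b1 := LIS_ub _ _ k1; have b2 := LIS_ub _ _ k2.
  by case/orP: hT => /eqP hT; rewrite hT /= in e b1 b2; lia.
- rewrite -[RHS]addn0 -{1}(count_pred0 (leaves l)) -(count_pred0 (leaves r)).
  apply: count_cap_node => a.
    apply: (not_in_cap _ _ _ (pos_minus_r l r S2 h2)); last by rewrite mem_node_set_l.
    by rewrite size_node_set LIS_minus e2 add0n; lia.
  apply: (not_in_cap _ _ _ (pos_minus_l l r S1 h1)); last by rewrite mem_node_set_r.
  by rewrite size_node_set LIS_minus e1 addn0; lia.
Qed.

Lemma cap_le_LIS t : (size (Lmax_cap t) <= LIS t)%N.
Proof.
elim: t => [//|[] l IHl r IHr]; first by rewrite cap_plus LIS_plus leq_add.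
by rewrite cap_minus LIS_minus; case: ltnP => h; [|case: ltnP => h']; lia.
Qed.

Lemma LIS_gt0 t : (0 < LIS t)%N.
Proof. by elim: t => [//|[] l IHl r IHr]; rewrite ?LIS_plus ?LIS_minus; lia. Qed.

(** * Expectations over the tree law *)

Definition treesum (n : nat) (F : tree -> R) : R := Rsum (trees_eq n) F.

(** * Enumeration of trees by number of internal vertices *)

Section Enumeration.

(** The enumeration bound [m] is separated from the size [n], since [trees_le m.+1] draws both
    subtrees from [trees_le m] whatever their sizes; by [T_stable] the sum does not depend on
    [m >= n]. *)
Let T (m n : nat) (F : tree -> R) := Rsum (trees_le m) (fun t => if n_internal t == n then F t else 0).

Lemma nsum_pick a n (H : nat -> R) :
  nsum 0 n (fun i => if a == i then H i else 0) = if (a < n)%nat then H a else 0.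
Proof.
elim: n => [//|n IH]; rewrite nsum_recr // IH ltnS.
case: (ltngtP a n) => h; try lra.
by rewrite h; lra.
Qed.

Let T_node m (g : tree -> R) : Rsum (trees_le m.+1) g = g Leaf +
  Rsum (trees_le m) (fun l => Rsum (trees_le m) (fun r =>
    if (n_internal l + n_internal r <= m)%nat then g (Node true l r) + g (Node false l r) else 0)).
Proof.
rewrite /= cats0 Rsum_cat !Rsum_flatten !Rsum_map -Rsum_plus.
congr (_ + _); apply: Rsum_ext => l; rewrite !Rsum_map !Rsum_filter -Rsum_plus.
by apply: Rsum_ext => r; case: ifP => _; lra.
Qed.

Let T_0 m F : T m 0 F = F Leaf.
Proof.
rewrite /T; case: m => [|m]; first by rewrite /=; lra.
rewrite T_node /= (Rsum_ext _ _ (fun=> 0)) ?Rsum_0; first by lra.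
move=> l; rewrite (Rsum_ext _ _ (fun=> 0)) ?Rsum_0 // => r; case: ifP => _; lra.
Qed.

Let T_S m n F : (n <= m)%nat -> T m.+1 n.+1 F =
  nsum 0 n.+1 (fun i => T m i (fun l => T m (n - i) (fun r => F (Node true l r) + F (Node false l r)))).
Proof.
move=> hnm; rewrite {1}/T T_node /= Rplus_0_l /nsum /T [RHS]Rsum_exchange.
apply: Rsum_ext => l.
apply: etrans (esym (nsum_pick (n_internal l) n.+1 (fun i => Rsum (trees_le m) (fun r =>
  if n_internal r == (n - i)%nat then F (Node true l r) + F (Node false l r) else 0)))).
rewrite ltnS.
case: leqP => hl.
  apply: Rsum_ext => r; rewrite eqSS.
  have -> : (n_internal r == n - n_internal l)%nat = (n_internal l + n_internal r == n)%nat by lia.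
  by case: eqP => h; [rewrite ifT //; lia | case: ifP => _; lra].
rewrite (Rsum_ext _ _ (fun=> 0)) ?Rsum_0 // => r; rewrite eqSS.
by rewrite (_ : _ == n = false)%nat; [case: ifP => _; lra | lia].
Qed.

Let T_stable n m F : (n <= m)%nat -> T m n F = T n n F.
Proof.
elim/ltn_ind: n m F => n IH m F hnm.
case: n IH hnm => [|n] IH hnm; first by rewrite !T_0.
case: m hnm => [//|m] hnm; rewrite !T_S //.
apply: nsum_ext => i hi; rewrite (IH i _ m) ?(IH i _ n); try lia.
apply: Rsum_ext => l; case: ifP => // _.
by rewrite (IH (n - i)%nat _ m) ?(IH (n - i)%nat _ n) //; lia.
Qed.

Let treesum_T n m F : (n <= m)%nat -> treesum n F = T m n F.
Proof. by move=> h; rewrite T_stable // /treesum /trees_eq Rsum_filter. Qed.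

Lemma treesum_0 F : treesum 0 F = F Leaf.
Proof. by rewrite (treesum_T _ 0) // T_0. Qed.

Lemma treesum_S n F : treesum n.+1 F =
  nsum 0 n.+1 (fun i => treesum i (fun l => treesum (n - i) (fun r => F (Node true l r) + F (Node false l r)))).
Proof.
rewrite (treesum_T _ n.+1) // T_S //; apply: nsum_ext => i hi.
rewrite (treesum_T _ n); last by lia.
apply: Rsum_ext => l; case: ifP => // _.
by rewrite (treesum_T _ n) //; lia.
Qed.

End Enumeration.

Lemma treesum_ext n F H : (forall t, F t = H t) -> treesum n F = treesum n H.
Proof. exact: Rsum_ext. Qed.

Lemma treesum_scal n c F : treesum n (fun t => c * F t) = c * treesum n F.
Proof. exact: Rsum_scal. Qed.

Lemma treesum_plus n F H : treesum n (fun t => F t + H t) = treesum n F + treesum n H.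
Proof. exact: Rsum_plus. Qed.

Lemma treesum_le n F H : (forall t, F t <= H t) -> treesum n F <= treesum n H.
Proof. exact: Rsum_le. Qed.

Lemma sum_n_nsum (u : nat -> R) n : sum_n u n = nsum 0 n.+1 u.
Proof.
elim: n => [|n IH]; first by rewrite sum_O /nsum /=; lra.
by rewrite sum_Sn IH [in RHS]nsum_recr.
Qed.

Lemma sum_f_R0_nsum (u : nat -> R) n : sum_f_R0 u n = nsum 0 n.+1 u.
Proof. by rewrite -sum_n_Reals sum_n_nsum. Qed.

Section Expectation.
Context (p : R) (hp : 0 < p < 1).
Local Notation w := (bgw_weight p).

Lemma weight_pos t : 0 < w t.
Proof.
rewrite /bgw_weight; apply: Rmult_lt_0_compat; last by apply: pow_lt; lra.
by apply: Rmult_lt_0_compat; apply: pow_lt; lra.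
Qed.

Lemma weight_leaf : w Leaf = / 2.
Proof. by rewrite /bgw_weight /=; lra. Qed.

Lemma weight_node s l r : w (Node s l r) = (if s then p else 1 - p) / 2 * (w l * w r).
Proof.
have pow_addn (x : R) m n : x ^ (m + n)%nat = x ^ m * x ^ n by exact: pow_add.
rewrite /bgw_weight (_ : 2 * n_internal (Node s l r) + 1 =
  (2 * n_internal l + 1) + (2 * n_internal r + 1) + 1)%nat; last by rewrite /=; lia.
by case: s; rewrite /= ?add0n ?add1n /= !pow_addn /=; field.
Qed.

Definition tree_term (f : tree -> R) (n : nat) : R := treesum n (fun t => w t * f t).
Definition tree_E (f : tree -> R) : R := Series (tree_term f).
(** Pairs are grouped by their total number of internal vertices: products become Cauchy products,
    and cutting a tree at its root shifts the index by one. *)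
Definition pair_term (g : tree -> tree -> R) (n : nat) : R :=
  nsum 0 n.+1 (fun i => treesum i (fun l => treesum (n - i) (fun r => w l * w r * g l r))).
Definition pair_E (g : tree -> tree -> R) : R := Series (pair_term g).

Definition tree_bounded (f : tree -> R) : Prop := exists C, forall x, Rabs (f x) <= C.
Definition pair_bounded (g : tree -> tree -> R) : Prop := exists C, forall l r, Rabs (g l r) <= C.

Lemma tree_term_S f n : tree_term f n.+1 =
  p / 2 * pair_term (fun l r => f (Node true l r)) n
  + (1 - p) / 2 * pair_term (fun l r => f (Node false l r)) n.
Proof.
rewrite /tree_term treesum_S /pair_term -!nsum_scal -nsum_plus; apply: nsum_ext => i _.
rewrite -!treesum_scal -treesum_plus; apply: treesum_ext => l.
rewrite -!treesum_scal -treesum_plus; apply: treesum_ext => r.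
rewrite !weight_node; ring.
Qed.

Lemma tree_term_0 f : tree_term f 0 = f Leaf / 2.
Proof. by rewrite /tree_term treesum_0 weight_leaf; lra. Qed.

Lemma tree_term_pos f n : (forall t, 0 <= f t) -> 0 <= tree_term f n.
Proof.
by move=> h; apply: Rsum_pos => t; apply: Rmult_le_pos; [apply/Rlt_le/weight_pos | exact: h].
Qed.

Lemma pair_term_prod x y n :
  pair_term (fun l r => x l * y r) n = nsum 0 n.+1 (fun i => tree_term x i * tree_term y (n - i)).
Proof.
apply: nsum_ext => i _; rewrite Rmult_comm /tree_term -treesum_scal; apply: treesum_ext => l.
rewrite Rmult_comm -treesum_scal; apply: treesum_ext => r; ring.
Qed.

Local Notation mass1 := (tree_term (fun=> 1)).

Lemma mass1_pos n : 0 <= mass1 n.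
Proof. by apply: tree_term_pos => t; lra. Qed.

Lemma mass1_S n : mass1 n.+1 = / 2 * nsum 0 n.+1 (fun i => mass1 i * mass1 (n - i)).
Proof.
rewrite tree_term_S -pair_term_prod.
have -> : pair_term (fun _ _ => 1 * 1) n = pair_term (fun _ _ => 1) n.
  by apply: nsum_ext => i _; apply: treesum_ext => l; apply: treesum_ext => r; ring.
lra.
Qed.

Lemma nsum_triangle (u : nat -> R) N :
  nsum 0 N (fun n => nsum 0 n.+1 (fun i => u i * u (n - i)%nat)) = nsum 0 N (fun i => u i * nsum 0 (N - i) u).
Proof.
elim: N => [//|N IH]; rewrite [LHS]nsum_recr // IH [RHS]nsum_recr // [nsum 0 N.+1 (fun i => u i * u _)]nsum_recr //.
rewrite subSnn subnn [X in _ = X + _](nsum_ext 0 N _ (fun i => u i * nsum 0 (N - i) u + u i * u (N - i)%nat)).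
  have -> : nsum 0 1 u = u 0%nat by rewrite nsum_recr // nsum_geq //; lra.
  by rewrite nsum_plus; lra.
by move=> i hi; rewrite subSn ?nsum_recr //; [ring | lia].
Qed.

(** The partial sums satisfy [s_(N+1) <= (1 + s_N ^ 2) / 2], and 1 is a fixed point of this
    increasing map. *)
Lemma mass1_sum_le N : nsum 0 N mass1 <= 1.
Proof.
elim: N => [|N IH]; first by rewrite nsum_geq //; lra.
rewrite nsum_recl // tree_term_0 nsum_shift.
rewrite (nsum_ext _ _ _ (fun n => / 2 * nsum 0 n.+1 (fun i => mass1 i * mass1 (n - i)))); last first.
  by move=> i _; exact: mass1_S.
rewrite nsum_scal nsum_triangle.
have h0 : 0 <= nsum 0 N mass1 by apply: nsum_pos => i _; exact: mass1_pos.
suff : nsum 0 N (fun i => mass1 i * nsum 0 (N - i) mass1) <= 1 by lra.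
apply: (Rle_trans _ (nsum 0 N mass1)) => //.
apply: nsum_le => i hi; have := mass1_pos i => h.
have : nsum 0 (N - i) mass1 <= 1.
  by apply: Rle_trans IH; apply: nsum_widen; try lia; move=> j _; exact: mass1_pos.
nra.
Qed.

Lemma ex_series_mass1 : ex_series mass1.
Proof.
have h : ex_finite_lim_seq (sum_n mass1).
  apply: (ex_finite_lim_seq_incr _ 1) => n; last by rewrite sum_n_nsum; exact: mass1_sum_le.
  by rewrite sum_Sn /plus /=; have := mass1_pos n.+1; lra.
by case: h => l hl; exists l.
Qed.

Lemma tree_term_abs_le f C n : (forall t, Rabs (f t) <= C) -> Rabs (tree_term f n) <= C * mass1 n.
Proof.
move=> h; rewrite /tree_term /treesum; elim: (trees_eq n) => [|t s IH] /=; first by rewrite Rabs_R0; lra.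
apply: Rle_trans (Rabs_triang _ _) _; rewrite Rabs_mult (Rabs_pos_eq (w t)); last by apply/Rlt_le/weight_pos.
by have := h t; have := weight_pos t; nra.
Qed.

Lemma ex_series_abs_tree f : tree_bounded f -> ex_series (fun n => Rabs (tree_term f n)).
Proof.
case=> C hC; apply: (ex_series_le _ (fun n => C * mass1 n)).
  by move=> n; rewrite /norm /= /abs /= Rabs_Rabsolu; exact: tree_term_abs_le.
by apply: (ex_series_scal_l C); exact: ex_series_mass1.
Qed.

Lemma ex_series_tree f : tree_bounded f -> ex_series (tree_term f).
Proof. by move=> h; apply: ex_series_Rabs; apply: ex_series_abs_tree. Qed.

Lemma ex_series_pair g : pair_bounded g -> ex_series (pair_term g).
Proof.
case=> C hC; apply: (ex_series_le _ (fun n => 2 * C * mass1 n.+1)); last first.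
  by apply: (ex_series_scal_l (2 * C)); apply/(ex_series_incr_1 mass1); exact: ex_series_mass1.
move=> n; rewrite mass1_S -pair_term_prod /norm /= /abs /=.
have -> : 2 * C * (/ 2 * pair_term (fun _ _ => 1 * 1) n) = C * pair_term (fun _ _ => 1 * 1) n by lra.
rewrite /pair_term -nsum_scal.
apply: (Rle_trans _ (nsum 0 n.+1 (fun i => Rabs (treesum i (fun l => treesum (n - i) (fun r => w l * w r * g l r)))))).
  exact: Rabs_Rsum_le.
apply: nsum_le => i _; rewrite -treesum_scal; apply: Rle_trans (Rabs_Rsum_le _ _) _.
apply: treesum_le => l; rewrite -treesum_scal; apply: Rle_trans (Rabs_Rsum_le _ _) _.
apply: treesum_le => r; have hl := weight_pos l; have hr := weight_pos r.
rewrite Rabs_mult (Rabs_pos_eq (w l * w r)); last by nra.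
have hw : 0 < w l * w r by nra.
by have := Rmult_le_compat_l _ _ _ (Rlt_le _ _ hw) (hC l r); lra.
Qed.

Lemma tree_E_ext f f' : (forall t, f t = f' t) -> tree_E f = tree_E f'.
Proof. by move=> h; apply: Series_ext => n; apply: treesum_ext => t; rewrite h. Qed.

Lemma tree_E_plus f f' : tree_bounded f -> tree_bounded f' -> tree_E (fun t => f t + f' t) = tree_E f + tree_E f'.
Proof.
move=> h h'; rewrite /tree_E -Series_plus; try exact: ex_series_tree.
by apply: Series_ext => n; rewrite /tree_term -treesum_plus; apply: treesum_ext => t; ring.
Qed.

Lemma tree_E_scal c f : tree_E (fun t => c * f t) = c * tree_E f.
Proof.
rewrite /tree_E -Series_scal_l; apply: Series_ext => n.
by rewrite /tree_term -treesum_scal; apply: treesum_ext => t; ring.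
Qed.

Lemma tree_E_le f f' : (forall t, f t <= f' t) -> tree_bounded f -> tree_bounded f' -> tree_E f <= tree_E f'.
Proof.
move=> h hf hf'.
suff : 0 <= tree_E (fun t => f' t + (-1) * f t).
  rewrite tree_E_plus // ?tree_E_scal; first by lra.
  case: hf => C hC; exists C => t; rewrite Rabs_mult Rabs_Ropp Rabs_R1 Rmult_1_l; exact: hC.
have : ex_series (tree_term (fun t => f' t + (-1) * f t)).
  apply: ex_series_tree; case: hf => C hC; case: hf' => C' hC'; exists (C' + C) => t.
  apply: Rle_trans (Rabs_triang _ _) _; rewrite Rabs_mult Rabs_Ropp Rabs_R1 Rmult_1_l.
  by have := hC t; have := hC' t; lra.
move=> hex.
have e0 : Series (fun=> 0) = 0.
  by rewrite (Series_ext _ (fun n => 0 * (fun=> 0) n)) ?Series_scal_l => [|n]; ring.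
rewrite -e0.
apply: Series_le => // n; split; first by lra.
by apply: tree_term_pos => t; have := h t; lra.
Qed.

Lemma tree_E_one_le : tree_E (fun=> 1) <= 1.
Proof.
have h := Series_correct _ ex_series_mass1.
have : Rbar_le (tree_E (fun=> 1)) 1; last by [].
apply: (is_lim_seq_le_loc (sum_n mass1) (fun=> 1)) => //; last exact: is_lim_seq_const.
by exists 0%nat => n _; rewrite sum_n_nsum; exact: mass1_sum_le.
Qed.

Lemma pair_E_ext g g' : (forall l r, g l r = g' l r) -> pair_E g = pair_E g'.
Proof.
move=> h; apply: Series_ext => n; apply: nsum_ext => i _.
by apply: treesum_ext => l; apply: treesum_ext => r; rewrite h.
Qed.

Lemma pair_E_plus g g' : pair_bounded g -> pair_bounded g' ->
  pair_E (fun l r => g l r + g' l r) = pair_E g + pair_E g'.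
Proof.
move=> h h'; rewrite /pair_E -Series_plus; try exact: ex_series_pair.
apply: Series_ext => n; rewrite /pair_term -nsum_plus; apply: nsum_ext => i _.
rewrite -treesum_plus; apply: treesum_ext => l; rewrite -treesum_plus; apply: treesum_ext => r; ring.
Qed.

Lemma pair_E_prod x y : tree_bounded x -> tree_bounded y -> pair_E (fun l r => x l * y r) = tree_E x * tree_E y.
Proof.
move=> hx hy; apply: is_series_unique.
apply: (is_series_ext (fun n => sum_f_R0 (fun k => tree_term x k * tree_term y (n - k)%coq_nat) n)).
  by move=> n; rewrite pair_term_prod sum_f_R0_nsum.
apply: is_series_mult; try exact: ex_series_abs_tree.
  by apply: Series_correct; apply: ex_series_tree.
by apply: Series_correct; apply: ex_series_tree.
Qed.

Lemma tree_E_node f : tree_bounded f -> tree_E f = f Leaf / 2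
  + p / 2 * pair_E (fun l r => f (Node true l r)) + (1 - p) / 2 * pair_E (fun l r => f (Node false l r)).
Proof.
move=> hf; rewrite /tree_E Series_incr_1; last exact: ex_series_tree.
rewrite tree_term_0 Rplus_assoc; congr (_ + _).
rewrite /pair_E -!Series_scal_l -Series_plus.
- by apply: Series_ext => n; exact: tree_term_S.
- apply: ex_series_scal_l; apply: ex_series_pair; case: hf => C hC.
  by exists C => l r; exact: hC.
- apply: ex_series_scal_l; apply: ex_series_pair; case: hf => C hC.
  by exists C => l r; exact: hC.
Qed.

End Expectation.

(** * Recursions for the law of the LIS and the moments of the cap *)

Definition lis_ind (k : nat) (t : tree) : R := if LIS t == k then 1 else 0.
Definition lis_below (k : nat) (t : tree) : R := if (LIS t < k)%nat then 1 else 0.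
Definition capR (t : tree) : R := INR (size (Lmax_cap t)).

(** The cap is unbounded over all trees, but at most [k] on the event [LIS = k]; this is what makes
    the restricted series converge absolutely. *)
Definition level_bounded (f : tree -> R) : Prop := forall k, tree_bounded (fun t => lis_ind k t * f t).

Lemma level_bounded_const c : level_bounded (fun=> c).
Proof.
move=> k; exists (Rabs c) => t; rewrite /lis_ind; case: eqP => _.
  by rewrite Rmult_1_l; lra.
by rewrite Rmult_0_l Rabs_R0; exact: Rabs_pos.
Qed.

Lemma level_bounded_capR (h : R -> R) :
  (forall k, exists C, forall x, 0 <= x <= k -> Rabs (h x) <= C) -> level_bounded (fun t => h (capR t)).
Proof.
move=> hh k; have [C hC] := hh (INR k); have [h0 hk0] := pair (Rabs_pos (h 0)) (hC 0 ltac:(have := pos_INR k; lra)).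
exists C => t; rewrite /lis_ind; case: eqP => e.
  rewrite Rmult_1_l; apply: hC; split; first exact: pos_INR.
  by apply: INR_leq; rewrite -e; exact: cap_le_LIS.
by rewrite Rmult_0_l Rabs_R0; lra.
Qed.

Lemma level_bounded_cap1 : level_bounded capR.
Proof. by apply: (level_bounded_capR (fun x => x)) => k; exists k => x hx; rewrite Rabs_pos_eq; lra. Qed.

Lemma level_bounded_cap2 : level_bounded (fun t => capR t ^ 2).
Proof.
apply: (level_bounded_capR (fun x => x ^ 2)) => k; exists (k ^ 2) => x hx.
by rewrite Rabs_pos_eq; [apply: pow_incr | apply: pow2_ge_0].
Qed.

Lemma bounded_lis_ind k : tree_bounded (lis_ind k).
Proof. by exists 1 => t; rewrite /lis_ind; case: eqP => _; rewrite ?Rabs_R1 ?Rabs_R0; lra. Qed.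

Lemma bounded_lis_below k : tree_bounded (lis_below k).
Proof. by exists 1 => t; rewrite /lis_below; case: ltnP => _; rewrite ?Rabs_R1 ?Rabs_R0; lra. Qed.

Lemma nsum_pick1 a k (H : nat -> R) : (0 < a)%nat ->
  nsum 1 k (fun i => if a == i then H i else 0) = if (a < k)%nat then H a else 0.
Proof.
move=> ha; case: k => [|k]; first by rewrite nsum_geq.
rewrite -nsum_pick [RHS]nsum_recl // ifF; [lra | by apply/eqP; lia].
Qed.

Lemma lis_below_sum k t : lis_below k t = nsum 1 k (fun i => lis_ind i t).
Proof. by rewrite /lis_below /lis_ind (nsum_pick1 _ _ (fun=> 1)) ?LIS_gt0. Qed.

Lemma lis_ind_plus k l r :
  lis_ind k (Node true l r) = nsum 1 k (fun i => lis_ind i l * lis_ind (k - i) r).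
Proof.
rewrite (nsum_ext _ _ _ (fun i => if LIS l == i then lis_ind (k - i) r else 0)); last first.
  by move=> i _; rewrite {1}/lis_ind; case: eqP => _; ring.
rewrite nsum_pick1 ?LIS_gt0 // /lis_ind LIS_plus; have := LIS_gt0 r => hr.
case: ltnP => h; last by rewrite ifF //; apply/eqP; lia.
by congr (if _ then _ else _); apply/eqP/eqP; lia.
Qed.

Lemma bounded_mult_pair (x y : tree -> R) : tree_bounded x -> tree_bounded y -> pair_bounded (fun l r => x l * y r).
Proof.
case=> C hC [C' hC']; exists (C * C') => l r; rewrite Rabs_mult.
by apply: Rmult_le_compat => //; exact: Rabs_pos.
Qed.

Lemma pair_bounded_plus g g' : pair_bounded g -> pair_bounded g' -> pair_bounded (fun l r => g l r + g' l r).
Proof.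
case=> C hC [C' hC']; exists (C + C') => l r; apply: Rle_trans (Rabs_triang _ _) _.
by have := hC l r; have := hC' l r; lra.
Qed.

Lemma bounded_plus (f f' : tree -> R) : tree_bounded f -> tree_bounded f' -> tree_bounded (fun t => f t + f' t).
Proof.
case=> C hC [C' hC']; exists (C + C') => t; apply: Rle_trans (Rabs_triang _ _) _.
by have := hC t; have := hC' t; lra.
Qed.

Lemma bounded_scal c (f : tree -> R) : tree_bounded f -> tree_bounded (fun t => c * f t).
Proof.
case=> C hC; exists (Rabs c * C) => t; rewrite Rabs_mult.
by apply: Rmult_le_compat_l; [exact: Rabs_pos | exact: hC].
Qed.

Lemma bounded_ext (f f' : tree -> R) : (forall t, f t = f' t) -> tree_bounded f -> tree_bounded f'.
Proof. by move=> h [C hC]; exists C => t; rewrite -h. Qed.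

Section Recursion.
Context (p : R) (hp : 0 < p < 1).
Local Notation E := (tree_E p).
Local Notation EE := (pair_E p).

Lemma tree_E_nsum (x : nat -> tree -> R) b : (forall i, tree_bounded (x i)) ->
  tree_bounded (fun t => nsum 1 b (fun i => x i t)) /\
  E (fun t => nsum 1 b (fun i => x i t)) = nsum 1 b (fun i => E (x i)).
Proof.
move=> hx; have base : tree_bounded (fun _ : tree => 0) /\ E (fun=> 0) = 0.
  split; first by exists 0 => t; rewrite Rabs_R0; lra.
  by rewrite (tree_E_ext p _ (fun t => 0 * (fun=> 1) t)) ?tree_E_scal => [|t]; ring.
elim: b => [//|b [IH1 IH2]]; case: (posnP b) => [->//|hb].
have e t : nsum 1 b.+1 (fun i => x i t) = nsum 1 b (fun i => x i t) + x b t by rewrite nsum_recr.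
split.
  by apply: (bounded_ext (fun t => nsum 1 b (fun i => x i t) + x b t)) => //; apply: bounded_plus.
rewrite (tree_E_ext p _ _ e) (tree_E_plus p hp) // IH2 nsum_recr //.
Qed.

Lemma pair_E_nsum (x y : nat -> tree -> R) b : (forall i, tree_bounded (x i)) -> (forall i, tree_bounded (y i)) ->
  pair_bounded (fun l r => nsum 1 b (fun i => x i l * y i r)) /\
  EE (fun l r => nsum 1 b (fun i => x i l * y i r)) = nsum 1 b (fun i => E (x i) * E (y i)).
Proof.
move=> hx hy.
have base : pair_bounded (fun _ _ => 0) /\ EE (fun _ _ => 0) = 0.
  split; first by exists 0 => l r; rewrite Rabs_R0; lra.
  have h1 : tree_bounded (fun _ : tree => 0) by exists 0 => t; rewrite Rabs_R0; lra.
  rewrite (pair_E_ext p _ (fun l r => (fun=> 0) l * (fun=> 0) r)); last by move=> *; ring.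
  rewrite (pair_E_prod p hp) //.
  by rewrite (tree_E_ext p _ (fun t => 0 * (fun=> 1) t)) ?tree_E_scal => [|t]; ring.
elim: b => [//|b [IH1 IH2]]; case: (posnP b) => [->//|hb].
have e l r : nsum 1 b.+1 (fun i => x i l * y i r) = nsum 1 b (fun i => x i l * y i r) + x b l * y b r.
  by rewrite nsum_recr.
have hb2 : pair_bounded (fun l r => x b l * y b r) by apply: bounded_mult_pair.
split.
  have [C hC] := pair_bounded_plus _ _ IH1 hb2.
  by exists C => l r; rewrite e; exact: hC.
by rewrite (pair_E_ext p _ _ e) (pair_E_plus p hp) // IH2 (pair_E_prod p hp) // nsum_recr.
Qed.

Lemma pair_E_plus_node k (f g : tree -> R) : level_bounded f -> level_bounded g ->
  pair_bounded (fun l r => lis_ind k (Node true l r) * (f l * g r)) /\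
  EE (fun l r => lis_ind k (Node true l r) * (f l * g r)) =
  nsum 1 k (fun i => E (fun t => lis_ind i t * f t) * E (fun t => lis_ind (k - i) t * g t)).
Proof.
move=> hf hg.
have [h1 h2] := pair_E_nsum (fun i t => lis_ind i t * f t) (fun i t => lis_ind (k - i) t * g t) k
   (fun i => hf i) (fun i => hg _).
have e l r : lis_ind k (Node true l r) * (f l * g r) =
   nsum 1 k (fun i => lis_ind i l * f l * (lis_ind (k - i) r * g r)).
  rewrite lis_ind_plus Rmult_comm -nsum_scal; apply: nsum_ext => i _; ring.
split; last by rewrite (pair_E_ext p _ _ e).
by case: h1 => C hC; exists C => l r; rewrite e.
Qed.

Lemma tree_E_lis_below k : E (lis_below k) = nsum 1 k (fun i => E (lis_ind i)).
Proof.
rewrite (tree_E_ext p _ _ (lis_below_sum k)).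
by have [_ ->] := tree_E_nsum lis_ind k bounded_lis_ind.
Qed.

(** The maximum equals [k] if one child attains it and the other stays below, in two symmetric ways,
    or at a tie. The value [c] at a tie is 1 for the law of the [LIS] and 0 for the powers of the
    cap. *)
Lemma pair_E_minus_node k (f : tree -> R) c : level_bounded f ->
  EE (fun l r => lis_ind k (Node false l r) *
     (if (LIS r < LIS l)%nat then f l else if (LIS l < LIS r)%nat then f r else c)) =
  2 * E (fun t => lis_ind k t * f t) * nsum 1 k (fun i => E (lis_ind i)) + c * (E (lis_ind k) * E (lis_ind k)).
Proof.
move=> hf; rewrite -tree_E_lis_below.
have hb := bounded_lis_below k; have hi := bounded_lis_ind k; have hfk := hf k.
have b1 := bounded_mult_pair _ _ hfk hb; have b2 := bounded_mult_pair _ _ hb hfk.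
have b3 := bounded_mult_pair _ _ (bounded_scal c _ hi) hi.
rewrite (pair_E_ext p _ (fun l r => (lis_ind k l * f l * lis_below k r
   + lis_below k l * (lis_ind k r * f r)) + c * lis_ind k l * lis_ind k r)).
  rewrite (pair_E_plus p hp) //; last exact: pair_bounded_plus.
  by rewrite (pair_E_plus p hp) // !(pair_E_prod p hp) // ?tree_E_scal; [ring | exact: bounded_scal].
move=> l r; rewrite /lis_ind /lis_below LIS_minus.
move: (LIS l) (LIS r) (f l) (f r) => x y u v.
by case: (ltngtP y x) => h /=; do 2?case: eqP => ?; do 2?case: (ltnP _ k) => ?; (ring || (exfalso; lia)).
Qed.

Definition lis_prob k := E (lis_ind k).
Definition cap_moment1 k := E (fun t => lis_ind k t * capR t).
Definition cap_moment2 k := E (fun t => lis_ind k t * capR t ^ 2).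
(** Defined as a complement, so that [G 1 = 1] and [mass G = q] hold by construction; its sign comes
    from [tree_E_one_le]. *)
Definition lis_tail_fun k := 1 - nsum 1 k lis_prob.
Local Notation q := lis_prob.
Local Notation a := cap_moment1.
Local Notation b := cap_moment2.
Local Notation G := lis_tail_fun.

Lemma lis_ind_leaf k : lis_ind k Leaf = if k == 1%nat then 1 else 0.
Proof. by rewrite /lis_ind (_ : LIS Leaf = 1%nat) // eq_sym. Qed.

Lemma capR_leaf : capR Leaf = 1.
Proof. by []. Qed.

Lemma capR_plus l r : capR (Node true l r) = capR l + capR r.
Proof. by rewrite /capR cap_plus INR_addn. Qed.

Lemma capR_minus l r : capR (Node false l r) =
  if (LIS r < LIS l)%nat then capR l else if (LIS l < LIS r)%nat then capR r else 0.
Proof. by rewrite /capR cap_minus; case: ltnP => _ //; case: ltnP. Qed.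

Let one_lb := level_bounded_const 1.

Let E_one i : E (fun t => lis_ind i t * 1) = q i.
Proof. by apply: tree_E_ext => t; ring. Qed.

Lemma lis_prob_rec k : q k = (if k == 1%nat then / 2 else 0)
  + p / 2 * nsum 1 k (fun i => q i * q (k - i)) + (1 - p) / 2 * (2 * q k * (1 - G k) + q k * q k).
Proof.
rewrite {1}/q (tree_E_node p hp); last exact: bounded_lis_ind.
congr (_ + _ + _).
- by rewrite lis_ind_leaf; case: eqP => _; lra.
- congr (_ * _); rewrite (pair_E_ext p _ (fun l r => lis_ind k (Node true l r) * (1 * 1))); last by move=> *; ring.
  have [_ ->] := pair_E_plus_node k (fun=> 1) (fun=> 1) one_lb one_lb.
  by apply: nsum_ext => i _; rewrite !E_one.
- congr (_ * _).
  have := pair_E_minus_node k (fun=> 1) 1 one_lb; rewrite E_one => h.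
  rewrite (pair_E_ext p _ (fun l r => lis_ind k (Node false l r) *
    (if (LIS r < LIS l)%nat then (fun=> 1) l else if (LIS l < LIS r)%nat then (fun=> 1) r else 1))).
    by rewrite h /lis_tail_fun /q; ring.
  by move=> l r; case: ifP => _; [|case: ifP => _]; ring.
Qed.

Lemma cap_moment1_rec k : a k = (if k == 1%nat then / 2 else 0)
  + p * nsum 1 k (fun i => a i * q (k - i)) + (1 - p) * (a k * (1 - G k)).
Proof.
rewrite {1}/a (tree_E_node p hp); last exact: level_bounded_cap1.
congr (_ + _ + _).
- by rewrite lis_ind_leaf capR_leaf; case: eqP => _; lra.
- have [b1 e1] := pair_E_plus_node k capR (fun=> 1) level_bounded_cap1 one_lb.
  have [b2 e2] := pair_E_plus_node k (fun=> 1) capR one_lb level_bounded_cap1.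
  rewrite (pair_E_ext p _ (fun l r => lis_ind k (Node true l r) * (capR l * 1)
    + lis_ind k (Node true l r) * (1 * capR r))); last by move=> l r; rewrite capR_plus; ring.
  rewrite (pair_E_plus p hp) // e1 e2.
  rewrite (nsum_ext 1 k (fun i => E (fun t => lis_ind i t * 1) * _) (fun i => q i * a (k - i))); last first.
    by move=> i _; rewrite E_one.
  rewrite (nsum_ext 1 k _ (fun i => a i * q (k - i))); last by move=> i _; rewrite E_one.
  rewrite (nsum_conv k q a); lra.
- have h := pair_E_minus_node k capR 0 level_bounded_cap1.
  rewrite (pair_E_ext p _ _ (fun l r => f_equal (Rmult _) (capR_minus l r))) h /lis_tail_fun -/(a k).
  by rewrite /q; field.
Qed.

Lemma cap_moment2_rec k : b k = (if k == 1%nat then / 2 else 0)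
  + (p * nsum 1 k (fun i => b i * q (k - i)) + p * nsum 1 k (fun i => a i * a (k - i)))
  + (1 - p) * (b k * (1 - G k)).
Proof.
rewrite {1}/b (tree_E_node p hp); last exact: level_bounded_cap2.
congr (_ + _ + _).
- by rewrite lis_ind_leaf capR_leaf; case: eqP => _; lra.
- have [b1 e1] := pair_E_plus_node k (fun t => capR t ^ 2) (fun=> 1) level_bounded_cap2 one_lb.
  have [b2 e2] := pair_E_plus_node k (fun=> 1) (fun t => capR t ^ 2) one_lb level_bounded_cap2.
  have [b3 e3] := pair_E_plus_node k capR capR level_bounded_cap1 level_bounded_cap1.
  rewrite -[nsum 1 k _]/(nsum 1 k (fun i => a i * a (k - i))) in e3.
  rewrite (pair_E_ext p _ (fun l r => (lis_ind k (Node true l r) * (capR l ^ 2 * 1)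
    + lis_ind k (Node true l r) * (1 * capR r ^ 2)) + (lis_ind k (Node true l r) * (capR l * capR r)
    + lis_ind k (Node true l r) * (capR l * capR r)))); last by move=> l r; rewrite capR_plus; ring.
  rewrite (pair_E_plus p hp); try exact: pair_bounded_plus.
  rewrite !(pair_E_plus p hp) // e1 e2 e3.
  rewrite (nsum_ext 1 k (fun i => E (fun t => lis_ind i t * 1) * _) (fun i => q i * b (k - i))); last first.
    by move=> i _; rewrite E_one.
  rewrite (nsum_ext 1 k (fun i => _ * E (fun t => lis_ind (k - i) t * 1)) (fun i => b i * q (k - i))); last first.
    by move=> i _; rewrite E_one.
  rewrite (nsum_conv k q b); lra.
- have h := pair_E_minus_node k (fun t => capR t ^ 2) 0 level_bounded_cap2.
  rewrite (pair_E_ext p _ (fun l r => lis_ind k (Node false l r) *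
    (if (LIS r < LIS l)%nat then capR l ^ 2 else if (LIS l < LIS r)%nat then capR r ^ 2 else 0))).
    by rewrite h /lis_tail_fun -/(b k) /q; field.
  by move=> l r; rewrite capR_minus; case: ifP => _; [|case: ifP => _]; ring.
Qed.

Lemma mass_lis_tail k : (1 <= k)%nat -> mass G k = q k.
Proof. by move=> h; rewrite /mass /lis_tail_fun nsum_recr //; lra. Qed.

Lemma lis_prob_ge0 k : 0 <= q k.
Proof.
have -> : 0 = E (fun=> 0 * 1) by rewrite tree_E_scal; ring.
apply: (tree_E_le p hp); last exact: bounded_lis_ind.
  by move=> t; rewrite /lis_ind; case: eqP => _; lra.
by exists 0 => t; rewrite Rmult_0_l Rabs_R0; lra.
Qed.

Lemma lis_tail_ge0 k : 0 <= G k.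
Proof.
rewrite /lis_tail_fun -tree_E_lis_below; suff : E (lis_below k) <= 1 by lra.
apply: Rle_trans (tree_E_one_le p hp).
apply: (tree_E_le p hp); [| exact: bounded_lis_below | by exists 1 => t; rewrite Rabs_R1; lra].
by move=> t; rewrite /lis_below; case: ltnP => _; lra.
Qed.

Lemma lis_tail_1 : G 1%nat = 1.
Proof. by rewrite /lis_tail_fun nsum_geq //; lra. Qed.

Lemma lis_tail_S k : (1 <= k)%nat -> G k.+1 = G k - q k.
Proof. by move=> h; rewrite -mass_lis_tail // /mass; lra. Qed.

Lemma lis_prob_conv k : (2 <= k)%nat ->
  p / 2 * nsum 1 k (fun i => q i * q (k - i)) = q k * (p + (1 - p) * (G k - q k / 2)).
Proof.
move=> hk; have := lis_prob_rec k; rewrite ifF; last by apply/eqP; lia.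
move=> h; lra.
Qed.

Lemma lis_prob_pos k : (1 <= k)%nat -> 0 < q k.
Proof.
elim/ltn_ind: k => k IH hk; have h0 := lis_prob_ge0 k.
case: (eqVneq k 1%nat) => [e|hk1].
  have := lis_prob_rec k; rewrite e /= nsum_geq // lis_tail_1 => h.
  have : 0 <= (1 - p) * (q 1%nat * q 1%nat) by apply: Rmult_le_pos; [lra | rewrite e in h0; nra].
  by lra.
have h := lis_prob_conv k ltac:(lia).
have hs : 0 < nsum 1 k (fun i => q i * q (k - i)).
  rewrite nsum_recl; last by lia.
  have : 0 <= nsum 2 k (fun i => q i * q (k - i)).
    by apply: nsum_pos => i hi; apply: Rmult_le_pos; exact: lis_prob_ge0.
  by have := IH 1%nat ltac:(lia) erefl; have := IH (k - 1)%nat ltac:(lia) ltac:(lia); nra.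
case: h0 => // h0; rewrite -h0 in h; nra.
Qed.

(** Summed form of [lis_prob_conv]: shifting the index and writing [G i.+1 = G i - q i] relates the
    sums at [k] and [k.+1]. The base case 2 is the recursion for [q 1], where the leaf enters. *)
Lemma lis_tail_conv k : (2 <= k)%nat ->
  p * nsum 1 k (fun i => G i * q (k - i)) = G k * (p + (1 - p) * G k).
Proof.
elim: k => [//|k IH] hk; case: (eqVneq k 1%nat) => [->|hk1].
  have := lis_prob_rec 1; rewrite /= nsum_geq // lis_tail_1 => h.
  rewrite nsum_recr // nsum_geq // (lis_tail_S 1) // lis_tail_1 (_ : 2 - 1 = 1)%nat //; lra.
have {}IH := IH ltac:(lia).
have h := lis_prob_conv k ltac:(lia).
rewrite nsum_recl // nsum_shift lis_tail_1 subn1 -pred_Sn.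
rewrite (nsum_ext _ _ _ (fun i => G i * q (k - i) - q i * q (k - i))); last first.
  by move=> i hi; rewrite subSS lis_tail_S; [ring | lia].
rewrite nsum_minus lis_tail_S; last by lia.
have -> : p * (1 * q k + (nsum 1 k (fun i => G i * q (k - i)) - nsum 1 k (fun i => q i * q (k - i))))
  = p * q k + p * nsum 1 k (fun i => G i * q (k - i)) - 2 * (p / 2 * nsum 1 k (fun i => q i * q (k - i))).
  by field.
by rewrite IH h; field.
Qed.

Lemma lis_tail_model : lis_tail p G.
Proof.
have mass_conv f k : nsum 1 k (fun i => f i * mass G (k - i)) = nsum 1 k (fun i => f i * q (k - i)).
  by apply: nsum_ext => i hi; rewrite mass_lis_tail //; lia.
split.
- exact: lis_tail_1.
- case=> [|k]; first by rewrite /lis_tail_fun nsum_geq //; lra.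
  by have := lis_tail_ge0 k.+2; rewrite lis_tail_S //; have := lis_prob_pos k.+1 erefl; lra.
- by move=> k hk; rewrite mass_lis_tail //; exact: lis_prob_pos.
- by move=> k hk; rewrite mass_conv; exact: lis_tail_conv.
- move=> k hk; rewrite mass_conv mass_lis_tail ?(nsum_ext 1 k _ (fun i => q i * q (k - i))); try lia.
    exact: lis_prob_conv.
  by move=> i hi; rewrite mass_lis_tail //; lia.
Qed.

(* The formula comes from Remy's bijection: deleting a leaf lowers the LIS exactly when the leaf
   lies in every maximal positive subtree, so that a (k + 1) = a k - q k / 2. *)
Lemma cap_moment1_eq k : (1 <= k)%nat -> a k = G k / 2.
Proof.
elim/ltn_ind: k => k IH hk; have h := cap_moment1_rec k.
case: (eqVneq k 1%nat) h => [->|hk1] h.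
  by rewrite lis_tail_1 nsum_geq //= in h; rewrite lis_tail_1; lra.
have ht := lis_tail_conv k ltac:(lia).
rewrite (nsum_ext _ _ _ (fun i => / 2 * (G i * q (k - i)))) in h; last first.
  by move=> i hi; rewrite IH; [field | lia | lia].
rewrite nsum_scal in h.
have hg := lt_pos _ _ lis_tail_model k.
apply: (Rmult_eq_reg_r (p + (1 - p) * G k)); last by nra.
lra.
Qed.

End Recursion.

(** * The theorem *)

Lemma E_on_LIS_tree_E p k f : E_on_LIS p k f = tree_E p (fun t => lis_ind k t * f t).
Proof.
apply: Series_ext => n; rewrite /tree_term /treesum Rsum_filter; apply: Rsum_ext => t.
by rewrite /lis_ind; case: eqP => _; ring.
Qed.

Lemma level_bounded_dist alpha k : level_bounded (fun t => Rabs (capR t / k - alpha)).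
Proof.
apply: (level_bounded_capR (fun x => Rabs (x / k - alpha))) => n.
exists (n * Rabs (/ k) + Rabs alpha) => x hx; rewrite Rabs_Rabsolu.
apply: Rle_trans (Rabs_triang _ _) _; rewrite Rabs_Ropp /Rdiv Rabs_mult (Rabs_pos_eq x); last by lra.
by have := Rabs_pos (/ k); nra.
Qed.

(** After inserting the first moment [G k / 2], the terms are grouped so that the first difference
    is controlled by [second_moment_asymp] and the second is [alpha * G k] times the error of the
    slope. *)
Lemma variance_expansion p (hp : 0 < p < 1) alpha k : (1 <= k)%nat ->
  tree_E p (fun t => lis_ind k t * (capR t / INR k - alpha) ^ 2)
  = (cap_moment2 p k - alpha / 2 * (INR k * lis_tail_fun p k)
     + alpha * INR k * (alpha * (INR k * lis_prob p k) - lis_tail_fun p k / 2)) / (INR k * INR k).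
Proof.
move=> hk; have hk0 := INR_ge1 k hk.
rewrite (tree_E_ext p _ (fun t => / (INR k * INR k) * (lis_ind k t * capR t ^ 2)
   + (- (2 * alpha) / INR k * (lis_ind k t * capR t) + alpha * alpha * lis_ind k t))); last first.
  by move=> t; field; lra.
have b1 := bounded_scal (- (2 * alpha) / INR k) _ (level_bounded_cap1 k).
have b2 := bounded_scal (alpha * alpha) _ (bounded_lis_ind k).
rewrite (tree_E_plus p hp); [|apply: bounded_scal; exact: level_bounded_cap2|exact: bounded_plus].
rewrite (tree_E_plus p hp) // !tree_E_scal -/(cap_moment2 p k) -/(cap_moment1 p k) -/(lis_prob p k).
by rewrite (cap_moment1_eq p hp k hk); field; lra.
Qed.

Theorem theorem9p1 (p alpha : R) (hp : 0 < p < 1)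
  (halpha : 1/2 < alpha < 1) (heq : alpha_equation p alpha) :
  exists eps : R, 0 < eps /\
  exists (C : R) (K : nat), forall k : nat, (K <= k)%nat ->
    Rabs (E_cond_LIS p k
            (fun t => Rabs (INR (size (Lmax_cap t)) / INR k - alpha)))
    <= C * Rpower (INR k) (- eps).
Proof.
set G := lis_tail_fun p.
have hG : lis_tail p G := lis_tail_model p hp.
have [rho [e [K [he [hK hrate]]]]] := log_slope_limit p G hp hG.
have hrho : is_lim_seq (log_slope G) rho.
  have l0 := is_lim_seq_mult' _ _ _ _ (is_lim_seq_const K) (is_lim_seq_Rpower_neg e (proj1 he)).
  have l1 := is_lim_seq_minus' _ _ _ _ (is_lim_seq_const rho) l0.
  have l2 := is_lim_seq_plus' _ _ _ _ (is_lim_seq_const rho) l0.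
  rewrite Rmult_0_r Rminus_0_r in l1; rewrite Rmult_0_r Rplus_0_r in l2.
  apply: (is_lim_seq_le_le_loc _ _ _ _ _ l1 l2); exists 1%nat => k hk.
  by have /Rabs_le_between := hrate k ltac:(lia); lra.
have hv := slope_value p G hp hG alpha halpha heq rho hrho; subst rho.
have [K' hb] := second_moment_asymp p G hp hG alpha e K (cap_moment2 p) ltac:(lra) he hK hrate
  ltac:(move=> k hk; have := cap_moment2_rec p hp k; rewrite ifF; [|by apply/eqP; lia];
    rewrite (nsum_ext 1 k (fun i => cap_moment1 p i * _) (fun i => G i / 2 * (G (k - i)%nat / 2)));
      [|by move=> i hi; rewrite !(cap_moment1_eq p hp) //; lia];
    rewrite (nsum_ext 1 k (fun i => cap_moment2 p i * lis_prob p _) (fun i => cap_moment2 p i * mass G (k - i)));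
      [|by move=> i hi; rewrite mass_lis_tail //; lia];
    rewrite -/G; lra).
set q := lis_prob p.
have hq1 : 0 < q 1%nat by apply: (lis_prob_pos p hp).
(* Error constants of the second moment and of the slope; dividing by [q 1] converts [G k] into
   [k * q k] through [mass_lower]. *)
set M := (Rabs K' + alpha * alpha * K) / q 1%nat.
(* The conditional variance is of order [k^(-e)], and the first absolute moment is of the order of
   its square root. *)
exists (e / 2); split; first by lra.
exists ((1 + M) / 2), 1%nat => k hk.
have hk0 := INR_ge1 k hk; have hq := lis_prob_pos p hp k hk; rewrite -/q in hq.
have hg := lt_pos _ _ hG k.
set P := Rpower (INR k) (- e); have hP : 0 < P by apply: Rpower_pos.
(* With [lam^2 = P] both terms of the weighted AM-GM bound are of order [lam], which gives the
   constant [(1 + M) / 2]. *)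
set lam := Rpower (INR k) (- (e / 2)); have hl : 0 < lam by apply: Rpower_pos.
have hlP : lam * lam = P by rewrite -Rpower_plus /P; congr Rpower; lra.
set f := fun t => Rabs (capR t / INR k - alpha).
have hf := level_bounded_dist alpha (INR k) k; rewrite -/f in hf.
set N := tree_E p (fun t => lis_ind k t * f t).
have hE : E_cond_LIS p k (fun t => Rabs (INR (size (Lmax_cap t)) / INR k - alpha)) = N / q k.
  rewrite /E_cond_LIS !E_on_LIS_tree_E -/f; congr (_ / _).
  by apply: tree_E_ext => t; ring.
have hN0 : 0 <= N.
  have -> : 0 = tree_E p (fun=> 0 * 1) by rewrite tree_E_scal; ring.
  apply: (tree_E_le p hp) => //; last by exists 0 => t; rewrite Rmult_0_l Rabs_R0; lra.
  move=> t; rewrite Rmult_0_l /lis_ind; apply: Rmult_le_pos; last exact: Rabs_pos.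
  by case: eqP => _; lra.
have hV : tree_E p (fun t => lis_ind k t * (capR t / INR k - alpha) ^ 2) <= M * P * q k.
  rewrite (variance_expansion p hp) // -/G -/q.
  have h1 := hb k hk; have h2 := hrate k hk.
  have h3 := mass_lower p G hp hG k hk.
  rewrite /log_slope -/P !mass_lis_tail // -/q in h1 h2 h3.
  have h4 : cap_moment2 p k - alpha / 2 * (INR k * G k) <= Rabs K' * (INR k * P * G k).
    apply: Rle_trans (Rle_abs _) _; apply: Rle_trans h1 _.
    by apply: Rmult_le_compat_r; [apply: Rmult_le_pos; nra | exact: Rle_abs].
  have h5 : alpha * (INR k * q k) - G k / 2 <= alpha * K * P * G k.
    have -> : alpha * (INR k * q k) - G k / 2 = alpha * G k * (INR k * q k / G k - / (2 * alpha)).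
      by field; lra.
    have := Rle_abs (INR k * q k / G k - / (2 * alpha)) => h6.
    have : 0 < alpha * G k by nra.
    nra.
  have h6 : alpha * INR k * (alpha * (INR k * q k) - G k / 2) <= alpha * INR k * (alpha * K * P * G k).
    by apply: Rmult_le_compat_l => //; nra.
  apply: (Rmult_le_reg_r (INR k * INR k)); first by nra.
  rewrite /Rdiv Rmult_assoc Rinv_l; last by nra.
  rewrite Rmult_1_r.
  have h7 : (Rabs K' + alpha * alpha * K) * (INR k * P) * G k
     <= (Rabs K' + alpha * alpha * K) * (INR k * P) * (INR k * q k / q 1%nat).
    apply: Rmult_le_compat_l.
      by apply: Rmult_le_pos; [have := Rabs_pos K'; nra | nra].
    apply: (Rmult_le_reg_l (q 1%nat)) => //; have -> : q 1%nat * (INR k * q k / q 1%nat) = INR k * q k by field; lra.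
    exact: h3.
  have -> : M * P * q k * (INR k * INR k) = (Rabs K' + alpha * alpha * K) * (INR k * P) * (INR k * q k / q 1%nat).
    by rewrite /M; field; lra.
  lra.
(* AM-GM: |x| <= lam / 2 + x^2 / (2 lam) *)
have hN : N <= lam / 2 * q k + / (2 * lam) * (M * P * q k).
  have hsq : level_bounded (fun t => (capR t / INR k - alpha) ^ 2).
    apply: (level_bounded_capR (fun x => (x / INR k - alpha) ^ 2)) => n.
    exists ((n / INR k + Rabs alpha) ^ 2) => x hx; rewrite Rabs_pos_eq; last by apply: pow2_ge_0.
    rewrite -(pow2_abs (x / INR k - alpha)); apply: pow_incr; split; first exact: Rabs_pos.
    apply: Rle_trans (Rabs_triang _ _) _; rewrite Rabs_Ropp; apply: Rplus_le_compat_r.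
    rewrite Rabs_pos_eq; last by apply: Rmult_le_pos; [lra | apply/Rlt_le/Rinv_0_lt_compat; lra].
    by apply: Rmult_le_compat_r; [apply/Rlt_le/Rinv_0_lt_compat; lra | lra].
  have b1 := bounded_scal (lam / 2) _ (bounded_lis_ind k).
  have b2 := bounded_scal (/ (2 * lam)) _ (hsq k).
  apply: (Rle_trans _ (tree_E p (fun t => lam / 2 * lis_ind k t
      + / (2 * lam) * (lis_ind k t * (capR t / INR k - alpha) ^ 2)))).
    apply: (tree_E_le p hp) => //; last exact: bounded_plus.
    move=> t; rewrite /f; set x := _ / _ - _.
    have hx : Rabs x <= lam / 2 + / (2 * lam) * x ^ 2.
      rewrite -(pow2_abs x); apply: (Rmult_le_reg_l (2 * lam)); first by lra.
      have -> : 2 * lam * (lam / 2 + / (2 * lam) * Rabs x ^ 2) = lam * lam + Rabs x ^ 2 by field; lra.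
      by have := pow2_ge_0 (lam - Rabs x); lra.
    by rewrite /lis_ind; case: eqP => _; lra.
  rewrite (tree_E_plus p hp) // !tree_E_scal -/(lis_prob p k) -/q.
  apply: Rplus_le_compat_l; apply: Rmult_le_compat_l => //.
  by apply/Rlt_le/Rinv_0_lt_compat; lra.
rewrite hE Rabs_pos_eq; last by apply: Rmult_le_pos => //; apply/Rlt_le/Rinv_0_lt_compat.
apply: (Rmult_le_reg_r (q k)) => //.
have -> : N / q k * q k = N by field; lra.
apply: Rle_trans hN _; rewrite -hlP; apply: Req_le; field; lra.
Qed.
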